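(* Let $d,k\in\mathbb N$. The conditional distribution of the random vector $(\lambda Y_{1,\lambda},\ldots,\lambda Y_{k,\lambda})$, given $|\mathcal C(\lambda)|=k+1$, converges weakly, as $\lambda\to\infty$, to the distribution of $(V_1,\ldots,V_k)$.
   Context: $\|\cdot\|$ is the Euclidean norm on $\mathbb R^d$, $o$ is the origin, $B(x,s)=\{y\in\mathbb R^d:\|y-x\|\le s\}$. For a locally finite set $\mathcal X\subset\mathbb R^d$ and $r>0$, $G(\mathcal X,r)$ is the graph with vertex set $\mathcal X$ and an edge between each pair of distinct points at Euclidean distance at most $r$. For $\lambda>0$, $\mathcal H_\lambda$ is a homogeneous Poisson point process of intensity $\lambda$ in $\mathbb R^d$, and $\mathcal C(\lambda)$ is the vertex set of the connected component containing $o$ of $G(\mathcal H_\lambda\cup\{o\},1)$. On the event $|\mathcal C(\lambda)|=k+1$, $Y_{1,\lambda},\ldots,Y_{k,\lambda}$ are the points of $\mathcal C(\lambda)\setminus\{o\}$ taken in increasing lexicographic order. For $\mathbf z=(z_1,\ldots,z_k)\in(\mathbb R^d)^k$ let $D(\mathbf z):=\bigcup_{i=1}^kB(\tfrac12z_i,\|z_i\|/2)$, $g(\mathbf z):=\int_{D(\mathbf z)}\|x\|^{1-d}\,dx$, and $\alpha_{k+1}:=\frac1{k!}\int_{(\mathbb R^d)^k}\exp(-g(\mathbf z))\,d\mathbf z$. Let $(U_1,\ldots,U_k)$ be a random vector in $(\mathbb R^d)^k$ with joint probability density $(k!\,\alpha_{k+1})^{-1}\exp(-g(\cdot))$ with respect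 to $(dk)$-dimensional Lebesgue measure, and let $V_1,\ldots,V_k$ be the points of $\{U_1,\ldots,U_k\}$ taken in increasing lexicographic order. *)

(* Defs.v *)
From HB Require Import structures.
From Stdlib Require Import Relation_Operators.
From mathcomp Require Import all_boot all_order all_algebra finmap.
From mathcomp Require Import all_classical all_reals all_analysis.
From mathcomp Require Import measurable_realfun.

Set Implicit Arguments.
Unset Strict Implicit.
Unset Printing Implicit Defensive.

Import Order.TTheory GRing.Theory Num.Theory.
Import numFieldNormedType.Exports.

Local Open Scope classical_set_scope.
Local Open Scope ring_scope.

(* Points of R^d are row vectors 'rV[R]_d; an element of (R^d)^k is a matrix
   in 'M[R]_(k, d) whose row i is the i-th point. The matrix norm of the
   library is the sup norm: it only serves to provide the topology. *)
Definition mx_borel_display : measure_display. Proof. exact. Qed.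

Section matrix_borel.
Context (R : realType) (m n : nat).

Let borel : set (set 'M[R]_(m, n)) := <<s [set A | open A] >>.

Let borel0 : borel set0. Proof. exact: sigma_algebra0. Qed.

Let borelC A : borel A -> borel (~` A). Proof. exact: sigma_algebraC. Qed.

Let borel_bigcup (F : (set 'M[R]_(m, n))^nat) :
  (forall i, borel (F i)) -> borel (\bigcup_i F i).
Proof. exact: sigma_algebra_bigcup. Qed.

HB.instance Definition _ := @isMeasurable.Build mx_borel_display
  'M[R]_(m, n) borel borel0 borelC borel_bigcup.

End matrix_borel.

Section cons_measure.
Local Open Scope ereal_scope.
Context {dd} {T : measurableType dd} {R : realType}.
Variables (mu : {sigma_finite_measure set T -> \bar R}) (n : nat)
  (nu : {sigma_finite_measure set (n.-tuple T) -> \bar R}).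

Definition tcons (x : T * n.-tuple T) : n.+1.-tuple T := [tuple of x.1 :: x.2].

Let measurable_tcons : measurable_fun setT tcons.
Proof. exact: measurable_cons. Qed.

Definition cons_measure : set (n.+1.-tuple T) -> \bar R :=
  pushforward (mu \x nu) tcons.

Let cons_measure0 : cons_measure set0 = 0.
Proof. by rewrite /cons_measure /pushforward preimage_set0 measure0. Qed.

Let cons_measure_ge0 A : 0 <= cons_measure A.
Proof. exact: measure_ge0. Qed.

Let cons_measure_sigma_additive : semi_sigma_additive cons_measure.
Proof.
move=> F mF tF mUF; rewrite /cons_measure /pushforward preimage_bigcup.
apply: measure_semi_sigma_additive.
- by move=> i; rewrite -[X in measurable X]setTI; exact: measurable_tcons.
- apply/trivIsetP => /= i j _ _ ij; rewrite -preimage_setI.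
  by move/trivIsetP : tF => /(_ _ _ _ _ ij) ->//; rewrite preimage_set0.
- by rewrite -preimage_bigcup -[X in measurable X]setTI; exact: measurable_tcons.
Qed.

HB.instance Definition _ := isMeasure.Build _ _ _ cons_measure
  cons_measure0 cons_measure_ge0 cons_measure_sigma_additive.

Let cons_measure_sigma_finite : sigma_finite setT cons_measure.
Proof.
have [F TF mF] : sigma_finite setT (mu \x nu).
  have /sigma_finiteP[F [TF ndF Foo]] := sigma_finiteT mu.
  have /sigma_finiteP[G [TG ndG Goo]] := sigma_finiteT nu.
  exists (fun i => F i `*` G i).
    rewrite -setXTT TF TG predeqE => -[x y]; split.
      move=> [/= [i _ Fix] [j _ Gjy]]; exists (maxn i j) => //; split.
      - by move: x Fix; exact/subsetPset/ndF/leq_maxl.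
      - by move: y Gjy; exact/subsetPset/ndG/leq_maxr.
    by move=> [i _ []/= ? ?]; split; exists i.
  move=> i; have [? ?] := Foo i; have [? ?] := Goo i.
  split; first exact: measurableX.
  by rewrite product_measure1E// lte_mul_pinfty// ge0_fin_numE.
pose g (t : n.+1.-tuple T) : T * n.-tuple T := (tnth t ord0, [tuple of behead t]).
have gK t : g (tcons t) = t.
  by case: t => x t; congr pair; apply: val_inj.
have mg : measurable_fun setT g.
  apply: measurable_fun_pair; [exact: measurable_tnth|exact: measurable_behead].
exists (fun i => g @^-1` F i).
  by rewrite -preimage_bigcup -TF preimage_setT.
move=> i; have [mFi Fioo] := mF i; split.
  by rewrite -[X in measurable X]setTI; exact: mg.
by rewrite /cons_measure /pushforward -comp_preimage (_ : g \o tcons = id)//;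
  apply/funext.
Qed.

HB.instance Definition _ := Measure_isSigmaFinite.Build _ _ _ cons_measure
  cons_measure_sigma_finite.

End cons_measure.

Fixpoint tuple_power {dd} {T : measurableType dd} {R : realType}
    (mu : {sigma_finite_measure set T -> \bar R}) (n : nat) :
    {sigma_finite_measure set (n.-tuple T) -> \bar R} :=
  if n is m.+1 then cons_measure mu (tuple_power mu m)
  else \d_([tuple] : 0.-tuple T).

(* The (m * n)-dimensional Lebesgue measure, transported to matrices; for m = 1
   it is the Lebesgue measure on R^n. *)
Section lebesgue_mx.
Context {R : realType} (m n : nat).

Definition mx_of_tuples (t : m.-tuple (n.-tuple (measurableTypeR R))) :
  'M[R]_(m, n) := \matrix_(i, j) tnth (tnth t i) j.

Lemma measurable_mx_of_tuples : measurable_fun setT mx_of_tuples.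
Proof.
apply: (measurability [set A : set 'M[R]_(m, n) | open A]) => //.
move=> _ [U /= oU <-]; rewrite setTI.
pose B (qp : 'M[rat]_(m, n) * nat) : set 'M[R]_(m, n) :=
  ball (map_mx ratr qp.1 : 'M[R]_(m, n)) (qp.2.+1%:R^-1 : R).
have mB qp : measurable (mx_of_tuples @^-1` B qp).
  rewrite (_ : _ @^-1` _ = \bigcap_(ij in [set: 'I_m * 'I_n])
      (fun t : m.-tuple (n.-tuple (measurableTypeR R)) =>
         tnth (tnth t ij.1) ij.2) @^-1`
      ball (ratr (qp.1 ij.1 ij.2) : R) (qp.2.+1%:R^-1 : R)); last first.
    apply/seteqP; split => t /=.
      by move=> [_ h] -[i j] _ /=; have := h i j; rewrite !mxE.
    by move=> h; split=> // i j; rewrite !mxE; exact: (h (i, j)).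
  apply: fin_bigcap_measurable => // -[i j] _ /=.
  rewrite -[X in measurable X]setTI.
  have mij : measurable_fun setT
      (fun t : m.-tuple (n.-tuple (measurableTypeR R)) => tnth (tnth t i) j).
    apply: (@measurableT_comp _ _ _ _ _ _ (fun s => tnth s j)).
      exact: measurable_tnth.
    exact: measurable_tnth.
  by apply: mij => //; rewrite ball_itv; exact: measurable_itv.
rewrite (_ : _ @^-1` _ = \bigcup_i
    (if @choice.unpickle ('M[rat]_(m, n) * nat)%type i is Some qp then
       if `[< B qp `<=` U >] then mx_of_tuples @^-1` B qp else set0
     else set0)); last first.
  apply/seteqP; split => t /=; last first.
    by move=> [i _]; case: choice.unpickle => // qp; case: asboolP => // BU; exact: BU.
  move=> UM; pose M := mx_of_tuples t.
  have /nbhs_ballP[e /= e0 eU] := @open_nbhs_nbhs _ M _ (conj oU UM).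
  pose p := Num.truncn (2 / e).
  have pe : p.+1%:R^-1 + p.+1%:R^-1 <= e.
    rewrite -mulr2n -[_ *+ 2]mulr_natl ler_pdivrMr// -ler_pdivrMl// mulrC.
    by rewrite ltW// truncnS_gt.
  have hq i j : exists q : rat, ball (M i j) (p.+1%:R^-1 : R) (ratr q).
    have p0 : 0 < p.+1%:R^-1 :> R by rewrite invr_gt0.
    have := @rat_in_itvoo R (M i j - p.+1%:R^-1) (M i j + p.+1%:R^-1).
    rewrite ltrD2l gtrN// => /(_ isT)[x xp]; exists x.
    by rewrite ball_itv.
  pose q : 'M[rat]_(m, n) := \matrix_(i, j) projT1 (cid (hq i j)).
  have Mq : ball (map_mx ratr q : 'M[R]_(m, n)) (p.+1%:R^-1 : R) M.
    split=> // i j; rewrite !mxE; apply: ball_sym.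
    by case: cid.
  have BqU : B (q, p) `<=` U.
    move=> N /= BN; apply: eU; apply: le_ball pe _ _.
    by apply: ball_triangle BN; exact: ball_sym.
  exists (choice.pickle (q, p)) => //.
  by rewrite choice.pickleK asboolT.
apply: bigcup_measurable => i _; case: choice.unpickle => // qp.
by case: ifP.
Qed.

Definition lebesgue_mx : set 'M[R]_(m, n) -> \bar R :=
  pushforward (tuple_power (tuple_power (@lebesgue_measure R) n) m)
    mx_of_tuples.

Let lebesgue_mx0 : lebesgue_mx set0 = 0%E.
Proof. by rewrite /lebesgue_mx /pushforward preimage_set0 measure0. Qed.

Let lebesgue_mx_ge0 A : (0 <= lebesgue_mx A)%E.
Proof. by rewrite /lebesgue_mx /pushforward; exact: measure_ge0. Qed.

Let lebesgue_mx_sigma_additive : semi_sigma_additive lebesgue_mx.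
Proof.
move=> F mF tF mUF; rewrite /lebesgue_mx /pushforward preimage_bigcup.
apply: measure_semi_sigma_additive.
- move=> i; rewrite -[X in measurable X]setTI.
  exact: measurable_mx_of_tuples.
- apply/trivIsetP => /= i j _ _ ij; rewrite -preimage_setI.
  by move/trivIsetP : tF => /(_ _ _ _ _ ij) ->//; rewrite preimage_set0.
- rewrite -preimage_bigcup -[X in measurable X]setTI.
  exact: measurable_mx_of_tuples.
Qed.

HB.instance Definition _ := isMeasure.Build _ _ _ lebesgue_mx
  lebesgue_mx0 lebesgue_mx_ge0 lebesgue_mx_sigma_additive.

End lebesgue_mx.
Arguments lebesgue_mx {R} m n _.

Section geometry.
Context {R : realType} {d : nat}.
Implicit Types (x y : 'rV[R]_d) (X : set 'rV[R]_d).

Definition enorm x : R := Num.sqrt (\sum_(j < d) x 0 j ^+ 2).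

Definition eball x (s : R) : set 'rV[R]_d := [set y | enorm (y - x) <= s].

Definition locally_finite X := forall s : R, finite_set (X `&` eball 0 s).

Definition gedge X (r : R) x y : Prop :=
  [/\ X x, X y, x <> y & enorm (x - y) <= r].

Definition graph_component X (r : R) x : set 'rV[R]_d :=
  [set y | clos_refl_trans _ (gedge X r) x y].

Definition origin_cluster X : set 'rV[R]_d := graph_component (X `|` [set 0]) 1 0.

Definition tuple_of_row x : d.-tuple R := [tuple x 0 j | j < d].

Definition lexle x y : bool :=
  ((tuple_of_row x : d.-tuplelexi R) <= (tuple_of_row y : d.-tuplelexi R))%O.

(* Only meaningful when X has exactly k points: otherwise the rows are 0 from
   index #|X| on if X has fewer points or is infinite (with #|X| read as 0), and
   points are dropped if it has more. *)
Definition lex_points (k : nat) X : 'M[R]_(k, d) :=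
  \matrix_(i < k) nth 0 (sort lexle (fset_set X)) i.

End geometry.

Section limit_density.
Context {R : realType} {d k : nat}.
Implicit Type z : 'M[R]_(k, d).

Definition Dset z : set 'rV[R]_d :=
  \bigcup_(i in [set: 'I_k])
    eball (2^-1 *: row i z) (enorm (row i z) / 2).

(* The value at x = 0 is irrelevant, and the integral is finite. *)
Definition gfun z : R :=
  \int[lebesgue_mx 1 d]_(x in Dset z) (enorm x ^ (1 - d%:Z)).

End limit_density.

(* alpha d k is the constant written alpha_(k+1). *)
Definition alpha {R : realType} (d k : nat) : R :=
  k`!%:R^-1 * \int[lebesgue_mx k d]_z expR (- gfun z).

Definition limit_density {R : realType} {d k : nat} (z : 'M[R]_(k, d)) : R :=
  (k`!%:R * alpha d k)^-1 * expR (- gfun z).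

(* The law of the counts is given by poisson_prob and not by poisson_pmf, which
   is the constant 1 at rate 0; the natural number argument of poisson_prob is
   not used. *)
Record poisson_process {R : realType} {d : nat} {dO : measure_display}
    {Omega : measurableType dO} (P : probability Omega R) (lam : R)
    (H : Omega -> set 'rV[R]_d) : Prop := PoissonProcess {
  poisson_locally_finite : forall w, locally_finite (H w) ;
  poisson_measurable : forall A, measurable A ->
    measurable_fun setT (fun w => counting (H w `&` A) : \bar R) ;
  poisson_count : forall A (n : nat), measurable A -> (lebesgue_mx 1 d A < +oo)%E ->
    P [set w | counting (H w `&` A) = n%:R%:E :> \bar R] =
    poisson_prob (lam * fine (lebesgue_mx 1 d A)) 0 [set n] ;
  poisson_independent : forall (p : nat) (A : 'I_p -> set 'rV[R]_d)
      (n : 'I_p -> nat),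
    (forall i, measurable (A i)) -> trivIset setT A ->
    P [set w | forall i, counting (H w `&` A i) = (n i)%:R%:E :> \bar R] =
    (\prod_(i < p)
      P [set w | counting (H w `&` A i) = (n i)%:R%:E :> \bar R])%E }.

(* The conditional distribution of X given the event E, of positive
   probability. *)
Definition cond_distribution {R : realType} {dO dT : measure_display}
    {Omega : measurableType dO} {T : measurableType dT}
    (P : probability Omega R) (E : set Omega) (X : Omega -> T) :
    set T -> \bar R :=
  pushforward (fun A => (fine (P (A `&` E)) / fine (P E))%:E) X.

Definition weak_cvg {R : realType} {m n : nat} {I : Type} (F : set_system I)
    (mu : I -> set 'M[R]_(m, n) -> \bar R) (nu : set 'M[R]_(m, n) -> \bar R) :=
  forall f : 'M[R]_(m, n) -> R, continuous f -> bounded_fun f ->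
    (\int[mu i]_x (f x)%:E)%E @[i --> F] --> (\int[nu]_x (f x)%:E)%E.

(* Main.v *)
(* Idea. Round all points to the grid of mesh 1/(m+1). If the rounded origin
   cluster has k other points in prescribed cells, then each of these cells
   contains one point of the Poisson process, and the rest of their rounded unit
   neighbourhood contains none; the probability of this event is explicit. As
   m tends to infinity, the ordered cluster gets the (unnormalised) density
   lam^k exp(- lam |B(o,1) u B(y_1,1) u ... u B(y_k,1)|) on the lexicographically
   increasing y for which {o, y_1, ..., y_k} is connected at distance 1.

   Put y = z / lam. Up to a factor that cancels in the conditional law, the density
   becomes exp(- lam e(z / lam)), where e(y) is the volume of the union of the balls
   outside B(o,1). On the ray of direction u, the union exceeds B(o,1) by
   h(u) / lam + O(1 / lam^2), with h the positive part of max_i <u, z_i>; since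
   D(z) = {s u : 0 <= s <= h(u)}, polar coordinates give lam e(z / lam) --> g(z).
   On connected configurations e(y) >= c sum_i |y_i|, because |(B(w,1) \ B(o,1))|
   is subadditive along multiples of w; as exp(- C sum_i |z_i|) <= exp(- g(z)) is
   integrable, dominated convergence applies. Finally g is symmetric, so the law
   of (V_1, ..., V_k) has density proportional to exp(- g) on increasing z. *)
From HB Require Import structures.
Require Import Defs.
From Stdlib Require Import Relation_Operators.
From mathcomp Require Import all_boot all_order all_algebra finmap.
From mathcomp Require Import all_classical all_reals all_analysis.
From mathcomp Require Import measurable_realfun.
From mathcomp Require Import fingroup perm.
From mathcomp Require Import ring lra.

Set Implicit Arguments.
Unset Strict Implicit.
Unset Printing Implicit Defensive.

Import Order.TTheory GRing.Theory Num.Theory.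
Import numFieldNormedType.Exports.

Local Open Scope classical_set_scope.
Local Open Scope ring_scope.

(** * Lebesgue measure on matrices *)

Section grid.
Context {R : realType}.

Definition grid (n : nat) {p q} (x : 'M[R]_(p, q)) : 'M[R]_(p, q) :=
  map_mx (fun t => (Num.floor (n.+1%:R * t))%:~R / n.+1%:R) x.

Definition gridpt (n : nat) {p q} (c : 'M[int]_(p, q)) : 'M[R]_(p, q) :=
  map_mx (fun t => t%:~R / n.+1%:R) c.

Lemma gridE n p q (x : 'M[R]_(p, q)) : grid n x = gridpt n (map_mx (fun t => Num.floor (n.+1%:R * t)) x).
Proof. by apply/matrixP => i j; rewrite !mxE. Qed.

Lemma grid_bounds n p q (x : 'M[R]_(p, q)) i j :
  grid n x i j <= x i j < grid n x i j + n.+1%:R^-1.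
Proof.
rewrite mxE; have n0 : 0 < n.+1%:R :> R by [].
rewrite ler_pdivrMr// mulrC floor_le/= -[X in _ + X]mul1r -mulrDl ltr_pdivlMr//.
by rewrite mulrC; have := floorD1_gt (n.+1%:R * x i j); rewrite intrD.
Qed.

Lemma grid_dist n p q (x : 'M[R]_(p, q)) i j :
  `|x i j - grid n x i j| <= n.+1%:R^-1.
Proof.
have /andP[a b] := grid_bounds n x i j.
by rewrite ger0_norm ?subr_ge0// lerBlDl ltW.
Qed.

Lemma gridpt_inj n p q : injective (@gridpt n p q).
Proof.
move=> c c' /matrixP h; apply/matrixP => i j; have := h i j; rewrite !mxE.
by move=> /(mulIf (invr_neq0 (lt0r_neq0 (ltr0Sn R n)))) /intr_inj.
Qed.

Lemma grid0 n p q : grid n (0 : 'M[R]_(p, q)) = 0.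
Proof. by apply/matrixP => i j; rewrite !mxE mulr0 floor0 mul0r. Qed.

Lemma row_grid n p q (x : 'M[R]_(p, q)) i : row i (grid n x) = grid n (row i x).
Proof. by apply/matrixP => a b; rewrite !mxE. Qed.

End grid.

Section matrix_measurable.
Context {R : realType} {p q : nat}.
Implicit Types a b x : 'M[R]_(p, q).

Definition mxbox a b : set 'M[R]_(p, q) :=
  [set x | forall i j, a i j <= x i j < b i j].

Lemma open_mx_measurable (A : set 'M[R]_(p, q)) : open A -> measurable A.
Proof. exact: sub_sigma_algebra. Qed.

Lemma continuous_mx_measurable (f : 'M[R]_(p, q) -> R) : continuous f ->
  measurable_fun setT f.
Proof.
move=> cf; apply: (measurability _ (RGenOpens.measurableE R)) => //.
move=> _ [_ [a [b ->] <-]]; rewrite setTI.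
apply: open_mx_measurable; move/continuousP : cf; apply.
exact: interval_open.
Qed.


Lemma measurable_coord i j : measurable_fun setT (fun x => x i j).
Proof. by apply: continuous_mx_measurable; exact: coord_continuous. Qed.

Lemma mxbox_measurable a b : measurable (mxbox a b).
Proof.
rewrite (_ : mxbox a b = \bigcap_(ij in [set: 'I_p * 'I_q])
  (fun x => x ij.1 ij.2) @^-1` `[a ij.1 ij.2, b ij.1 ij.2[%classic); last first.
  apply/seteqP; split => x /=; first by move=> h [i j] _ /=; rewrite in_itv/= h.
  by move=> h i j; have := h (i, j) I; rewrite /= in_itv.
apply: fin_bigcap_measurable => // -[i j] _ /=.
rewrite -[X in measurable X]setTI; apply: measurable_coord => //.
Qed.

Lemma grid_preimage n (c : 'M[int]_(p, q)) :
  [set x | grid n x = gridpt n c] =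
  mxbox (gridpt n c) (gridpt n (map_mx (fun t => t + 1) c)).
Proof.
apply/seteqP; split => x /=.
  move=> xc i j; have := grid_bounds n x i j; rewrite xc => /andP[-> /lt_le_trans]/=; apply.
  by rewrite !mxE intrD mulrDl mul1r.
move=> h; apply/matrixP => i j; have := h i j; rewrite !mxE.
rewrite ler_pdivrMr// ltr_pdivlMr// ![x i j * _]mulrC => xh.
by congr (_%:~R / _); apply: floor_def.
Qed.

Lemma grid_preimage_measurable n (c : 'M[R]_(p, q)) :
  measurable [set x | grid n x = c].
Proof.
have [[c' ->]|nc] := pselect (exists c', c = gridpt n c').
  by rewrite grid_preimage; exact: mxbox_measurable.
rewrite (_ : mkset _ = set0)// -subset0 => x /= xc; apply: nc.
by exists (map_mx (fun t => Num.floor (n.+1%:R * t)) x); rewrite -xc gridE.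
Qed.

Lemma open_grid_bigcup (U : set 'M[R]_(p, q)) : open U ->
  U = \bigcup_i (if @choice.unpickle (nat * 'M[int]_(p, q))%type i is Some nc then
     if `[< [set x | grid nc.1 x = gridpt nc.1 nc.2] `<=` U >]
     then [set x | grid nc.1 x = gridpt nc.1 nc.2] else set0 else set0).
Proof.
move=> oU; apply/seteqP; split => x /=; last first.
  by move=> [i _]; case: choice.unpickle => // nc; case: asboolP => // BU; exact: BU.
move=> Ux; have /nbhs_ballP[e /= e0 eU] := @open_nbhs_nbhs _ x _ (conj oU Ux).
pose n := Num.truncn e^-1.
have ne : n.+1%:R^-1 < e.
  by rewrite invf_plt ?posrE// truncnS_gt.
exists (choice.pickle (n, map_mx (fun t => Num.floor (n.+1%:R * t)) x)) => //.
rewrite choice.pickleK asboolT/=; first by rewrite gridE.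
rewrite -gridE => y /= xy; apply: eU; split=> // i j.
rewrite -ball_normE/=.
have := grid_bounds n x i j; have := grid_bounds n y i j; rewrite xy => /andP[a b] /andP[a1 b1].
move: n.+1%:R^-1 ne (grid n x i j) (x i j) (y i j) a b a1 b1 => v ve g u w *.
by rewrite ltr_norml; apply/andP; split; lra.
Qed.

Lemma mxbox_generate :
  @measurable _ 'M[R]_(p, q) =
  <<s [set B | exists a b, (forall i j, a i j <= b i j) /\ B = mxbox a b] >>.
Proof.
apply/seteqP; split.
  apply: smallest_sub; first exact: smallest_sigma_algebra.
  move=> U /open_grid_bigcup ->; apply: sigma_algebra_bigcup => i.
  case: choice.unpickle => [nc|]; last exact: sigma_algebra0.
  case: asboolP => _; last exact: sigma_algebra0.
  apply: sub_sigma_algebra; rewrite grid_preimage; do 2!eexists; split; last reflexivity.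
  by move=> i0 j0; rewrite !mxE ler_pM2r// ler_int lerDl.
apply: smallest_sub; first exact: sigma_algebra_measurable.
by move=> _ [a [b [_ ->]]]; exact: mxbox_measurable.
Qed.

Lemma mxbox_setI a b a' b' : mxbox a b `&` mxbox a' b' =
  mxbox (map2_mx Num.max a a')
    (map2_mx Num.max (map2_mx Num.max a a') (map2_mx Num.min b b')).
Proof.
apply/seteqP; split => x /=.
  move=> [h h'] i j; rewrite !mxE; have /andP[? ?] := h i j; have /andP[? ?] := h' i j.
  by rewrite ge_max lt_max lt_min; apply/andP; split; [apply/andP|apply/orP; right; apply/andP].
move=> h; split => i j; have := h i j; rewrite !mxE ge_max !lt_max lt_min;
  by move=> /andP[/andP[? ?] /orP[/orP[]|/andP[]]] *; lra.
Qed.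

End matrix_measurable.

Lemma measurable_mxP {R : realType} (p q : nat) {dT : measure_display} {T : measurableType dT}
  (f : T -> 'M[R]_(p, q)) :
  (forall i j, measurable_fun setT (fun t => f t i j)) -> measurable_fun setT f.
Proof.
move=> mf.
rewrite (_ : f = (@mx_of_tuples R p q) \o
   (fun t => [tuple [tuple (f t i j : measurableTypeR R) | j < q] | i < p])); last first.
  by apply/funext => t; apply/matrixP => i j /=; rewrite mxE !tnth_mktuple.
apply: measurableT_comp; first exact: measurable_mx_of_tuples.
apply/measurable_fun_tnthP => i.
rewrite (_ : _ \o _ = fun t => [tuple (f t i j : measurableTypeR R) | j < q]); last first.
  by apply/funext => t /=; rewrite tnth_mktuple.
apply/measurable_fun_tnthP => j.
rewrite (_ : _ \o _ = fun t => f t i j); first exact: mf.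
by apply/funext => t /=; rewrite tnth_mktuple.
Qed.

Lemma tuple_power_rect {dd} {T : measurableType dd} {R : realType}
    (mu : {sigma_finite_measure set T -> \bar R}) (n : nat) (A : 'I_n -> set T) :
  (forall i, measurable (A i)) ->
  tuple_power mu n [set t | forall i, A i (tnth t i)] = (\prod_(i < n) mu (A i))%E.
Proof.
elim: n A => [|n IH] A mA /=.
  rewrite big_ord0 (_ : mkset _ = setT) ?diracT//.
  by apply/seteqP; split => // t _ [].
rewrite /cons_measure /pushforward.
have -> : tcons (n := n) @^-1` [set t | forall i, A i (tnth t i)] =
   A ord0 `*` [set t : n.-tuple T | forall i, A (lift ord0 i) (tnth t i)].
  apply/seteqP; split => -[x t] /=.
    move=> h; split; first exact: (h ord0).
    by move=> i; have := h (lift ord0 i); rewrite (tnth_nth x)/= -tnth_nth.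
  move=> [h0 h] i; case: (unliftP ord0 i) => [j ->|->]; last exact: h0.
  by rewrite (tnth_nth x)/= -tnth_nth; exact: h.
rewrite product_measure1E//; first by rewrite (IH (fun i => A (lift ord0 i)))// big_ord_recl.
rewrite (_ : mkset _ = \bigcap_(i in [set: 'I_n]) (fun t => tnth t i) @^-1` A (lift ord0 i)); last first.
  by apply/seteqP; split => t /= h => [i _|i]; exact: h.
apply: fin_bigcap_measurable => // i _.
rewrite -[X in measurable X]setTI; exact: measurable_tnth.
Qed.

Lemma lebesgue_mx_box {R : realType} (p q : nat) (a b : 'M[R]_(p, q)) :
  (forall i j, a i j <= b i j) ->
  lebesgue_mx p q (mxbox a b) = (\prod_i \prod_j (b i j - a i j))%:E.
Proof.
move=> ab; rewrite /lebesgue_mx /pushforward.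
have -> : @mx_of_tuples R p q @^-1` mxbox a b =
  [set t | forall i, [set s : q.-tuple (measurableTypeR R) | forall j, `[a i j, b i j[%classic (tnth s j)] (tnth t i)].
  apply/seteqP; split => t /= h i j.
    by have := h i j; rewrite mxE in_itv.
  by have := h i j; rewrite mxE /= in_itv.
rewrite (tuple_power_rect _ (A := fun i => [set s : q.-tuple (measurableTypeR R) | forall j,
    `[a i j, b i j[%classic (tnth s j)])); last first.
  move=> i; rewrite (_ : mkset _ = \bigcap_(j in [set: 'I_q])
     (fun t => tnth t j) @^-1` `[a i j, b i j[%classic); last first.
    by apply/seteqP; split => t /= h => [j _|j]; exact: h.
  apply: fin_bigcap_measurable => // j _.
  rewrite -[X in measurable X]setTI; apply: measurable_tnth => //; exact: measurable_itv.
rewrite -prodEFin; apply: eq_bigr => i _.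
transitivity (\prod_(j < q) (@lebesgue_measure R) `[a i j, b i j[%classic)%E.
  by apply: tuple_power_rect => j; exact: measurable_itv.
rewrite -prodEFin; apply: eq_bigr => j _.
rewrite lebesgue_measure_itv/= lte_fin; case: ltP => //.
by have := ab i j; rewrite le_eqVlt => /orP[/eqP ->|/lt_le_trans /[apply]]; rewrite ?subrr ?ltxx.
Qed.

Section lebesgue_mx_unique.
Context {R : realType} (p q : nat).

Definition mxcube (n : nat) : set 'M[R]_(p, q) := mxbox (const_mx (- n%:R)) (const_mx n%:R).

Lemma mxcube_cover : \bigcup_n mxcube n = setT.
Proof.
apply/seteqP; split => // x _.
exists (Num.truncn (\sum_i \sum_j `|x i j|)).+1 => // i j; rewrite !mxE.
have h : `|x i j| < (Num.truncn (\sum_i \sum_j `|x i j|)).+1%:R.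
  apply: le_lt_trans (truncnS_gt _).
  rewrite (bigD1 i)//= (bigD1 j)//= -addrA lerDl addr_ge0 ?sumr_ge0// => *.
  by rewrite sumr_ge0.
by move: h; rewrite ltr_norml => /andP[/ltW -> ->].
Qed.

Lemma lebesgue_mxcube n : lebesgue_mx p q (mxcube n) =
  (\prod_(i < p) \prod_(j < q) (n%:R + n%:R))%:E.
Proof.
rewrite lebesgue_mx_box; last by move=> i j; rewrite !mxE ge0_cp.
by congr EFin; apply: eq_bigr => i _; apply: eq_bigr => j _; rewrite !mxE opprK.
Qed.

Lemma lebesgue_mx_unique (mu : {measure set 'M[R]_(p, q) -> \bar R}) :
  (forall a b : 'M[R]_(p, q), (forall i j, a i j <= b i j) ->
    mu (mxbox a b) = (\prod_i \prod_j (b i j - a i j))%:E) ->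
  forall A, measurable A -> mu A = lebesgue_mx p q A.
Proof.
move=> muE A mA.
apply: (measure_unique _ _ mxbox_generate _ _ mxcube_cover mu (lebesgue_mx p q)) => //.
- move=> _ _ [a [b [ab ->]]] [a' [b' [ab' ->]]].
  rewrite mxbox_setI; do 2!eexists; split; last reflexivity.
  by move=> i j; rewrite !mxE le_max lexx.
- by move=> n; do 2!eexists; split; last reflexivity; move=> i j; rewrite !mxE ge0_cp.
- by move=> _ [a [b [ab ->]]]; rewrite muE// -lebesgue_mx_box.
- move=> n; rewrite muE ?ltry//.
  by move=> i j; rewrite !mxE ge0_cp.
Qed.

Lemma lebesgue_mx_sigma_finite : sigma_finite setT (@lebesgue_mx R p q).
Proof.
exists mxcube; first by rewrite mxcube_cover.
by move=> n; split; [exact: mxbox_measurable|rewrite lebesgue_mxcube ltry].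
Qed.

HB.instance Definition _ := Measure_isSigmaFinite.Build _ _ _ (@lebesgue_mx R p q)
  lebesgue_mx_sigma_finite.

End lebesgue_mx_unique.

Lemma measure_le {dT} {T : measurableType dT} {R : realType} (mu : {measure set T -> \bar R})
  (A B : set T) : measurable A -> measurable B -> A `<=` B -> (mu A <= mu B)%E.
Proof. by move=> mA mB; apply: le_measure; exact: mem_set. Qed.

Definition pushforward_measure {d1 d2} {T1 : measurableType d1} {T2 : measurableType d2}
    {R : realFieldType} (mu : {measure set T1 -> \bar R}) (f : T1 -> T2)
    (mf : measurable_fun setT f) : {measure set T2 -> \bar R} :=
  measure_function_pushforward__canonical__measure_function_Measure mu mf.

Section change_of_variables.
Context {R : realType} {p q : nat}.
Implicit Types (phi : 'M[R]_(p, q) -> 'M[R]_(p, q)) (A : set 'M[R]_(p, q)).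
Local Notation vol := (@lebesgue_mx R p q).

Lemma lebesgue_mx_preimage phi (c : R) : measurable_fun setT phi -> 0 < c ->
  (forall a b : 'M[R]_(p, q), (forall i j, a i j <= b i j) ->
    vol (phi @^-1` mxbox a b) = (c * \prod_i \prod_j (b i j - a i j))%:E) ->
  forall A, measurable A -> vol (phi @^-1` A) = (c%:E * vol A)%E.
Proof.
move=> mphi c0 h A mA.
have ci0 : 0 <= c^-1 by rewrite invr_ge0 ltW.
pose mu := [the measure _ _ of mscale (NngNum ci0) (pushforward_measure vol mphi)].
have : mu A = vol A.
  apply: lebesgue_mx_unique => // a b ab.
  by rewrite /mu/= /mscale/= /pushforward h// -EFinM mulrA mulVf ?mul1r// lt0r_neq0.
rewrite /mu/= /mscale/= /pushforward => <-.
by rewrite muleA -EFinM mulfV ?mul1e// lt0r_neq0.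
Qed.

Lemma ge0_integral_preimage phi (c : R) : measurable_fun setT phi -> 0 < c ->
  (forall a b : 'M[R]_(p, q), (forall i j, a i j <= b i j) ->
    vol (phi @^-1` mxbox a b) = (c * \prod_i \prod_j (b i j - a i j))%:E) ->
  forall f : 'M[R]_(p, q) -> \bar R, measurable_fun setT f -> (forall x, 0 <= f x)%E ->
  (\int[vol]_x f (phi x) = c%:E * \int[vol]_x f x)%E.
Proof.
move=> mphi c0 h f mf f0.
have := @ge0_integral_pushforward _ _ _ _ R phi mphi vol setT f measurableT mf (fun x _ => f0 x).
rewrite preimage_setT => <-.
have -> : (\int[pushforward vol phi]_x f x = \int[mscale (NngNum (ltW c0)) vol]_x f x)%E.
  apply: (@eq_measure_integral _ _ _ _ (mscale (NngNum (ltW c0)) vol) (pushforward_measure vol mphi)) => A mA _.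
  by rewrite /= /mscale/= -(lebesgue_mx_preimage mphi).
by rewrite ge0_integral_mscale.
Qed.

Lemma measurable_addmx (t : 'M[R]_(p, q)) : measurable_fun setT (fun x : 'M[R]_(p, q) => x + t).
Proof.
apply: measurable_mxP => i j; under eq_fun do rewrite mxE.
by apply: measurable_funD => //; exact: measurable_coord.
Qed.

Lemma measurable_scalemx (s : R) : measurable_fun setT (fun x : 'M[R]_(p, q) => s *: x).
Proof.
apply: measurable_mxP => i j; under eq_fun do rewrite mxE.
by apply: measurable_funM => //; exact: measurable_coord.
Qed.

Lemma measurable_row_perm (s : 'S_p) : measurable_fun setT (fun x : 'M[R]_(p, q) => row_perm s x).
Proof.
apply: measurable_mxP => i j; under eq_fun do rewrite mxE.
exact: measurable_coord.
Qed.

Lemma mxbox_translate (t a b : 'M[R]_(p, q)) : (forall i j, a i j <= b i j) ->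
  vol ((fun x => x + t) @^-1` mxbox a b) = (1 * \prod_i \prod_j (b i j - a i j))%:E.
Proof.
move=> ab; have -> : (fun x => x + t) @^-1` mxbox a b = mxbox (a - t) (b - t).
  by apply/seteqP; split => x /= h i j; have := h i j; rewrite !mxE lerBlDr ltrBrDr.
rewrite lebesgue_mx_box; last by move=> i j; rewrite !mxE lerD2r.
rewrite mul1r; congr EFin; apply: eq_bigr => i _; apply: eq_bigr => j _.
by rewrite !mxE; ring.
Qed.

Lemma mxbox_scale (s : R) (a b : 'M[R]_(p, q)) : 0 < s -> (forall i j, a i j <= b i j) ->
  vol ((fun x => s *: x) @^-1` mxbox a b) = (s ^- (p * q) * \prod_i \prod_j (b i j - a i j))%:E.
Proof.
move=> s0 ab; have -> : (fun x => s *: x) @^-1` mxbox a b = mxbox (s^-1 *: a) (s^-1 *: b).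
  by apply/seteqP; split => x /= h i j; have := h i j;
    rewrite !mxE [s^-1 * a i j]mulrC [s^-1 * b i j]mulrC ler_pdivrMr// ltr_pdivlMr// [s * _]mulrC.
rewrite lebesgue_mx_box; last by move=> i j; rewrite !mxE ler_pM2l ?invr_gt0.
congr EFin.
rewrite [LHS](eq_bigr (fun i => s ^- q * \prod_j (b i j - a i j))).
  by rewrite big_split/= prodr_const card_ord exprVn -exprM mulnC.
move=> i _; rewrite [LHS](eq_bigr (fun j => s^-1 * (b i j - a i j))).
  by rewrite big_split/= prodr_const card_ord exprVn.
by move=> j _; rewrite !mxE mulrBr.
Qed.

Lemma mxbox_row_perm (s : 'S_p) (a b : 'M[R]_(p, q)) : (forall i j, a i j <= b i j) ->
  vol ((fun x => row_perm s x) @^-1` mxbox a b) = (1 * \prod_i \prod_j (b i j - a i j))%:E.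
Proof.
move=> ab.
have -> : (fun x => row_perm s x) @^-1` mxbox a b = mxbox (row_perm s^-1 a) (row_perm s^-1 b).
  apply/seteqP; split => x /= h i j; first by have := h (s^-1%g i) j; rewrite !mxE permKV.
  by have := h (s i) j; rewrite !mxE permK.
rewrite lebesgue_mx_box; last by move=> i j; rewrite !mxE.
rewrite mul1r; congr EFin; rewrite (reindex_inj (@perm_inj _ s)); apply: eq_bigr => i _.
by apply: eq_bigr => j _; rewrite !mxE permK.
Qed.

Lemma lebesgue_mx_translate (t : 'M[R]_(p, q)) A : measurable A ->
  vol [set x | A (x + t)] = vol A.
Proof.
by move=> mA; have := lebesgue_mx_preimage (measurable_addmx t) ltr01 (mxbox_translate t) mA; rewrite mul1e.
Qed.

Lemma lebesgue_mx_scale (s : R) A : 0 < s -> measurable A ->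
  vol [set x | A (s *: x)] = ((s ^- (p * q))%:E * vol A)%E.
Proof.
move=> s0 mA; apply: (lebesgue_mx_preimage (measurable_scalemx s)) => //.
  by rewrite invr_gt0 exprn_gt0.
by move=> a b; exact: mxbox_scale.
Qed.

Lemma ge0_integral_scalemx (s : R) (f : 'M[R]_(p, q) -> \bar R) : 0 < s ->
  measurable_fun setT f -> (forall x, 0 <= f x)%E ->
  (\int[vol]_x f (s *: x) = (s ^- (p * q))%:E * \int[vol]_x f x)%E.
Proof.
move=> s0; apply: (ge0_integral_preimage (measurable_scalemx s)) => //.
  by rewrite invr_gt0 exprn_gt0.
by move=> a b; exact: mxbox_scale.
Qed.

Lemma ge0_integral_row_perm (s : 'S_p) (f : 'M[R]_(p, q) -> \bar R) :
  measurable_fun setT f -> (forall x, 0 <= f x)%E ->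
  (\int[vol]_x f (row_perm s x) = \int[vol]_x f x)%E.
Proof.
move=> mf f0; have := ge0_integral_preimage (measurable_row_perm s) ltr01 (mxbox_row_perm s) mf f0.
by rewrite mul1e.
Qed.

End change_of_variables.

Section equal_rows.
Context {R : realType} {p q : nat}.
Local Notation vol := (@lebesgue_mx R p q).

Lemma measurable_row_eq (i j : 'I_p) : measurable [set x : 'M[R]_(p, q) | row i x = row j x].
Proof.
rewrite (_ : mkset _ = \bigcap_(l in [set: 'I_q]) [set x : 'M[R]_(p, q) | x i l = x j l]).
  apply: fin_bigcap_measurable => // l _.
  rewrite (_ : mkset _ = [set x : 'M[R]_(p, q) | x i l - x j l = 0]); last first.
    by apply/seteqP; split => x /= /eqP; rewrite ?subr_eq0 => /eqP // ->; rewrite subrr.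
  have mB : measurable_fun setT (fun x : 'M[R]_(p, q) => x i l - x j l).
    by apply: measurable_funB; exact: measurable_coord.
  have := mB measurableT [set 0] (measurable_set1 _).
  by rewrite setTI.
apply/seteqP; split => x /=.
  by move=> /rowP h l _ /=; have := h l; rewrite !mxE.
by move=> h; apply/rowP => l; rewrite !mxE; exact: h.
Qed.

(* The translates of a bounded part of the diagonal along row [i] are pairwise
   disjoint, have equal measure, and fit in a common box of finite measure. *)
Lemma lebesgue_mx_row_eq (i j : 'I_p) : (0 < q)%N -> i != j ->
  vol [set x : 'M[R]_(p, q) | row i x = row j x] = 0%E.
Proof.
move=> q0 ij; set D := mkset _.
have mD : measurable D by exact: measurable_row_eq.
suff h n : vol (D `&` mxcube n) = 0%E.
  rewrite -[D]setIT -(@mxcube_cover R p q) setI_bigcupr.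
  have mDc n : measurable (D `&` mxcube n) by apply: measurableI => //; exact: mxbox_measurable.
  apply/negligibleP; first exact: bigcupT_measurable.
  by apply: negligible_bigcup => n; apply/negligibleP => //; exact: h.
have mDn : measurable (D `&` mxcube n) by apply: measurableI => //; exact: mxbox_measurable.
pose t (m : nat) : 'M[R]_(p, q) := \matrix_(a, b) (if a == i then m.+1%:R^-1 else 0).
pose F m := [set x | (D `&` mxcube n) (x + t m)].
have mF m : measurable (F m).
  by rewrite -[F m]setTI; exact: (measurable_addmx (t m)).
have tF : trivIset setT F.
  apply/trivIsetP => a b _ _ ab; rewrite -subset0 => x /= [[/= Da _] [/= Db _]].
  have {Da}/rowP/(_ (Ordinal q0)) := Da; have {Db}/rowP/(_ (Ordinal q0)) := Db.
  rewrite !mxE eqxx eq_sym (negbTE ij) !addr0 => <- /addrI/invr_inj/eqP.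
  by rewrite eqr_nat eqSS => /eqP abE; rewrite abE eqxx in ab.
have FE m : vol (F m) = vol (D `&` mxcube n) by exact: lebesgue_mx_translate.
have FU m : F m `<=` mxcube n.+1.
  move=> x [_ /= cx] a b; have := cx a b; rewrite !mxE => /andP[l u].
  have t0 : 0 <= (if a == i then m.+1%:R^-1 else 0 : R) <= 1.
    by case: ifP => _; rewrite ?lexx ?ler01 ?invr_ge0 ?ler0n ?invf_le1 ?ler1n.
  by rewrite -[n.+1%:R]natr1; move: (if _ then _ else _) n%:R t0 l u => s N /andP[? ?] ? ?; apply/andP; split; lra.
have : (\sum_(0 <= m <oo) vol (F m) <= vol (mxcube n.+1))%E.
  rewrite -measure_semi_bigcup//; last exact: bigcupT_measurable.
  apply: measure_le.
  - by apply: bigcupT_measurable.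
  - exact: mxbox_measurable.
  - by move=> x [m _]; exact: FU.
rewrite lebesgue_mxcube; under eq_eseriesr do rewrite FE.
set V := (X in (_ <= X%:E)%E -> _); set v := vol _ => hV.
have v0 : (0 <= v)%E by exact: measure_ge0.
have hN N : (\sum_(0 <= m < N) v <= V%:E)%E.
  by apply: le_trans hV; apply: nneseries_lim_ge.
have vfin : v \is a fin_num.
  by rewrite ge0_fin_numE//; apply: le_lt_trans (ltry V); have := hN 1%N; rewrite big_nat1.
rewrite -(fineK vfin) in v0 hN *; move: (fine v) v0 hN => r; rewrite lee_fin le_eqVlt => /orP[/eqP <-//|r0] hN.
have := hN (Num.truncn (V / r)).+1; rewrite sumEFin lee_fin sumr_const_nat subn0 leNgt.
by rewrite -[r *+ _]mulr_natr mulrC -ltr_pdivrMr// truncnS_gt.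
Qed.

End equal_rows.

(** * Euclidean norm and unions of balls *)

Section euclidean_norm.
Context {R : realType} {d : nat}.
Implicit Types (x y z : 'rV[R]_d) (s : R).
Local Notation N := (@enorm R d).
Local Notation vol := (@lebesgue_mx R 1 d).

Definition edot x y : R := \sum_(j < d) x 0 j * y 0 j.

Lemma edotC x y : edot x y = edot y x.
Proof. by apply: eq_bigr => j _; rewrite mulrC. Qed.

Lemma edotDl x y z : edot (x + y) z = edot x z + edot y z.
Proof. by rewrite -big_split; apply: eq_bigr => j _; rewrite mxE mulrDl. Qed.

Lemma edotZl s x y : edot (s *: x) y = s * edot x y.
Proof. by rewrite mulr_sumr; apply: eq_bigr => j _; rewrite mxE mulrA. Qed.

Lemma edotDr x y z : edot z (x + y) = edot z x + edot z y.
Proof. by rewrite edotC edotDl ![edot _ z]edotC. Qed.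

Lemma edotZr s x y : edot y (s *: x) = s * edot y x.
Proof. by rewrite edotC edotZl edotC. Qed.

Lemma edot_ge0 x : 0 <= edot x x.
Proof. by apply: sumr_ge0 => j _; rewrite -expr2 sqr_ge0. Qed.

Lemma enorm_ge0 x : 0 <= N x. Proof. exact: sqrtr_ge0. Qed.

Lemma enorm_sqr x : N x ^+ 2 = edot x x.
Proof.
by rewrite /enorm sqr_sqrtr; [apply: eq_bigr => j _; rewrite expr2|apply: sumr_ge0 => j _; rewrite sqr_ge0].
Qed.

Lemma enormZ s x : N (s *: x) = `|s| * N x.
Proof.
apply/eqP; rewrite -(@eqrXn2 _ 2)// ?mulr_ge0 ?enorm_ge0//.
by rewrite exprMn !enorm_sqr edotZl edotZr mulrA real_normK ?num_real.
Qed.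

Lemma enormN x : N (- x) = N x.
Proof. by rewrite -scaleN1r enormZ normrN1 mul1r. Qed.

Lemma enorm_distC x y : N (x - y) = N (y - x).
Proof. by rewrite -enormN opprB. Qed.

Lemma enorm0 : N 0 = 0.
Proof. by rewrite -[0 : 'rV_d](scale0r 0) enormZ normr0 mul0r. Qed.

Lemma edot_le x y : `|edot x y| <= N x * N y.
Proof.
rewrite -(@ler_pXn2r _ 2) ?nnegrE ?mulr_ge0 ?enorm_ge0//.
rewrite exprMn !enorm_sqr real_normK ?num_real//.
have [y0|y0] := eqVneq (edot y y) 0.
  have yj j : y 0 j = 0.
    apply/eqP; rewrite -[_ == _]sqrf_eq0 expr2.
    move/eqP : y0; rewrite psumr_eq0; last by move=> i _; rewrite -expr2 sqr_ge0.
    by move/allP => /(_ j); rewrite mem_index_enum => /(_ isT)/=.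
  by rewrite [edot x y]big1 ?expr0n ?mulr_ge0 ?edot_ge0// => j _; rewrite yj mulr0.
have yp : 0 < edot y y by rewrite lt0r y0 edot_ge0.
have := edot_ge0 (edot y y *: x + (- edot x y) *: y).
rewrite edotDl !edotDr !edotZl !edotZr [edot y x]edotC.
move: (edot x x) (edot x y) (edot y y) yp => a b c c0 h.
by rewrite -subr_ge0 -(pmulr_rge0 _ c0); apply: le_trans h _; lra.
Qed.

Lemma enorm_triangle x y : N (x + y) <= N x + N y.
Proof.
rewrite -(@ler_pXn2r _ 2) ?nnegrE ?addr_ge0 ?enorm_ge0//.
rewrite sqrrD !enorm_sqr edotDl !edotDr [edot y x]edotC.
have /ler_normlP[_] := edot_le x y; lra.
Qed.

Lemma enorm_dist_triangle z x y : N (x - y) <= N (x - z) + N (z - y).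
Proof. by rewrite (le_trans _ (enorm_triangle _ _))// addrA subrK. Qed.

Lemma coord_le_enorm x j : `|x 0 j| <= N x.
Proof.
rewrite -(@ler_pXn2r _ 2) ?nnegrE ?enorm_ge0// enorm_sqr real_normK ?num_real//.
rewrite /edot (bigD1 j)//= -expr2 lerDl sumr_ge0// => i _.
by rewrite -expr2 sqr_ge0.
Qed.

Lemma enorm_le_coord x s : 0 <= s -> (forall j, `|x 0 j| <= s) -> N x <= d%:R * s.
Proof.
move=> s0 h.
rewrite -(@ler_pXn2r _ 2) ?nnegrE ?mulr_ge0 ?enorm_ge0// enorm_sqr.
apply: (@le_trans _ _ (\sum_(j < d) s ^+ 2)).
  apply: ler_sum => j _; rewrite -expr2 -[x 0 j ^+ 2]real_normK ?num_real//.
  by rewrite lerXn2r ?nnegrE.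
rewrite sumr_const card_ord -[s ^+ 2 *+ d]mulr_natl exprMn ler_wpM2r ?sqr_ge0//.
by rewrite -natrX ler_nat; case: (d) => // e; rewrite expnS expn1 leq_pmulr.
Qed.

Lemma enorm_eq0 x : N x = 0 -> x = 0.
Proof.
move=> h; apply/rowP => j; rewrite mxE; apply/eqP; rewrite -normr_le0 -h.
exact: coord_le_enorm.
Qed.

Lemma measurable_enorm : measurable_fun setT N.
Proof.
rewrite (_ : N = Num.sqrt \o (fun x => \sum_(j < d) x 0 j * x 0 j)).
  apply: measurableT_comp; first by apply: continuous_measurable_fun; exact: sqrt_continuous.
  apply: measurable_sum => j; apply: measurable_funM; exact: measurable_coord.
by apply/funext => x /=; rewrite /enorm; congr Num.sqrt; apply: eq_bigr => j _; rewrite expr2.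
Qed.

Lemma measurable_eball x s : measurable (eball x s).
Proof.
have m1 : measurable_fun setT (fun y : 'rV[R]_d => N (y - x)).
  apply: (measurableT_comp measurable_enorm); exact: (measurable_addmx (- x)).
by have := m1 measurableT `]-oo, s]%classic (measurable_itv _); rewrite setTI set_itvNyc.
Qed.

Lemma eball00 : eball (0 : 'rV[R]_d) 0 = [set 0].
Proof.
apply/seteqP; split => [x|x ->]; rewrite /eball/= subr0 ?enorm0// => h.
by apply: enorm_eq0; apply/eqP; rewrite eq_le h enorm_ge0.
Qed.

Lemma lebesgue_eball x s : vol (eball x s) = vol (eball 0 s).
Proof.
rewrite -(lebesgue_mx_translate x (measurable_eball x s)); congr (vol _).
by apply/seteqP; split => y; rewrite /eball/= addrK subr0.
Qed.

Lemma eball_sub_cube s : 0 <= s -> eball 0 s `<=` @mxcube R 1 d (Num.truncn s).+1.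
Proof.
move=> s0 y; rewrite /eball/= subr0 => ys i j; rewrite !mxE ord1.
have : `|y 0 j| < (Num.truncn s).+1%:R.
  by apply: le_lt_trans (truncnS_gt s); apply: le_trans (coord_le_enorm _ _) ys.
by rewrite ltr_norml => /andP[/ltW -> ->].
Qed.

Lemma eball_neg x s : s < 0 -> eball x s = set0.
Proof.
move=> s0; rewrite -subset0 => y; rewrite /eball/= => /(le_trans (enorm_ge0 _)).
by rewrite leNgt s0.
Qed.

Lemma lebesgue_eball_lty x s : (vol (eball x s) < +oo)%E.
Proof.
rewrite lebesgue_eball; have [s0|s0] := leP 0 s; last by rewrite eball_neg// measure0.
apply: (@le_lt_trans _ _ (vol (mxcube (Num.truncn s).+1))).
  apply: measure_le; [exact: measurable_eball|exact: mxbox_measurable|].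
  exact: eball_sub_cube.
by rewrite lebesgue_mxcube ltry.
Qed.

Lemma lebesgue_eball_scale s : 0 < s ->
  vol (eball 0 s) = ((s ^+ d)%:E * vol (eball 0 1))%E.
Proof.
move=> s0; have := lebesgue_mx_scale s0 (measurable_eball 0 s).
rewrite (_ : mkset _ = eball 0 1).
  by move=> ->; rewrite muleA -EFinM mul1n mulfV ?mul1e// expf_neq0// lt0r_neq0.
by apply/seteqP; split => y; rewrite /eball/= !subr0 enormZ gtr0_norm//
  -ler_pdivlMl// mulVf ?lt0r_neq0.
Qed.

Lemma lebesgue_eball_gt0 s : 0 < s -> (0 < vol (eball 0 s))%E.
Proof.
move=> s0; pose a : R := s / d.+1%:R.
have a0 : 0 < a by rewrite divr_gt0.
apply: (@lt_le_trans _ _ (vol (mxbox (const_mx 0) (const_mx a)))).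
  rewrite lebesgue_mx_box; last by move=> i j; rewrite !mxE ltW.
  by rewrite lte_fin; do 2!(apply: prodr_gt0 => ? _); rewrite !mxE subr0.
apply: measure_le; [exact: mxbox_measurable|exact: measurable_eball|].
move=> y /= h; rewrite /eball/= subr0.
apply: (@le_trans _ _ (d%:R * a)).
  apply: enorm_le_coord; first exact: ltW.
  by move=> j; have := h 0 j; rewrite !mxE => /andP[? /ltW]; rewrite ger0_norm.
by rewrite /a mulrCA ger_pMr// ler_pdivrMr// mul1r ler_nat.
Qed.

Lemma lebesgue_rV0 : (0 < d)%N -> vol [set 0] = 0%E.
Proof.
move=> d0; apply/eqP; rewrite eq_le measure_ge0 andbT; apply/lee_addgt0Pr => e e0.
rewrite add0e.
have [r r1] : exists r : R, vol (eball 0 1) = r%:E.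
  by exists (fine (vol (eball 0 1))); rewrite fineK// ge0_fin_numE// lebesgue_eball_lty.
have r0 : 0 < r by have := lebesgue_eball_gt0 ltr01; rewrite r1 lte_fin.
pose s := Num.min 1 (e / r).
have s0 : 0 < s by rewrite lt_min ltr01 divr_gt0.
apply: (@le_trans _ _ (vol (eball 0 s))).
  apply: measure_le; [|exact: measurable_eball|].
    by rewrite -eball00; exact: measurable_eball.
  by move=> _ ->; rewrite /eball/= subrr enorm0 ltW.
rewrite lebesgue_eball_scale// r1 -EFinM lee_fin -ler_pdivlMr//.
apply: (@le_trans _ _ s); last by rewrite /s ge_min lexx orbT.
case: (d) d0 => // n _; rewrite exprS ger_pMr//; apply: exprn_ile1; first exact: ltW.
by rewrite /s ge_min lexx.
Qed.

End euclidean_norm.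

Section ball_union.
Context {R : realType} {d k : nat}.
Implicit Types (x w : 'rV[R]_d) (y z : 'M[R]_(k, d)) (v : option 'I_k).
Local Notation N := (@enorm R d).
Local Notation vol := (@lebesgue_mx R 1 d).
Local Notation B := (eball (0 : 'rV[R]_d) 1).

(* [None] stands for the origin. *)
Definition vertex y v : 'rV[R]_d := if v is Some i then row i y else 0.

Definition ball_union y : set 'rV[R]_d := [set x | exists v, N (x - vertex y v) <= 1].

Definition excess y : R := fine (vol (ball_union y `\` B)).

Definition rows_norm y : R := \sum_(i < k) N (row i y).

Lemma vertexZ s y v : vertex (s *: y) v = s *: vertex y v.
Proof. by case: v => [i|] /=; [apply/rowP => j; rewrite !mxE|rewrite scaler0]. Qed.

Lemma rows_norm_ge0 y : 0 <= rows_norm y.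
Proof. by apply: sumr_ge0 => i _; exact: enorm_ge0. Qed.

Lemma enorm_vertex_le y v : N (vertex y v) <= rows_norm y.
Proof.
case: v => [i|] /=; last by rewrite enorm0 rows_norm_ge0.
by rewrite /rows_norm (bigD1 i)//= lerDl sumr_ge0// => j _; exact: enorm_ge0.
Qed.

Lemma rows_normZ s y : rows_norm (s *: y) = `|s| * rows_norm y.
Proof.
rewrite /rows_norm mulr_sumr; apply: eq_bigr => i _; rewrite -enormZ; congr N.
by apply/rowP => j; rewrite !mxE.
Qed.

Lemma measurable_row (i : 'I_k) : measurable_fun setT (fun y => row i y).
Proof.
apply: measurable_mxP => a b; under eq_fun do rewrite mxE.
exact: measurable_coord.
Qed.

Lemma measurable_rows_norm : measurable_fun setT rows_norm.
Proof.
apply: measurable_sum => i; apply: (measurableT_comp measurable_enorm).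
exact: measurable_row.
Qed.

Lemma ball_unionE y : ball_union y = \bigcup_(v in [set: option 'I_k]) eball (vertex y v) 1.
Proof. by apply/seteqP; split => x; [move=> [v h]; exists v|move=> [v _ h]; exists v]. Qed.

Lemma measurable_ball_union y : measurable (ball_union y).
Proof.
rewrite ball_unionE; apply: fin_bigcup_measurable; first exact: finite_finset.
by move=> v _; exact: measurable_eball.
Qed.

Lemma ball_union_sub y s : (forall v, N (vertex y v) <= s) -> ball_union y `<=` eball 0 (1 + s).
Proof.
move=> h x [v xv]; rewrite /eball/= subr0 -[x](subrK (vertex y v)).
by apply: le_trans (enorm_triangle _ _) _; exact: lerD.
Qed.

Lemma sub_ball_union y v : eball (vertex y v) 1 `<=` ball_union y.
Proof. by move=> x; exists v. Qed.

Lemma vol_ball_union_lty y : (vol (ball_union y) < +oo)%E.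
Proof.
apply: le_lt_trans (lebesgue_eball_lty 0 (1 + rows_norm y)).
apply: measure_le; [exact: measurable_ball_union|exact: measurable_eball|].
by apply: ball_union_sub => v; exact: enorm_vertex_le.
Qed.

Lemma fin_vol_ball : vol B \is a fin_num.
Proof. by rewrite ge0_fin_numE// lebesgue_eball_lty. Qed.

Lemma fine_vol_ball_gt0 : 0 < fine (vol B).
Proof. by rewrite -lte_fin fineK ?fin_vol_ball// lebesgue_eball_gt0. Qed.

Lemma measurable_excess_set y : measurable (ball_union y `\` B).
Proof. by apply: measurableD; [exact: measurable_ball_union|exact: measurable_eball]. Qed.

Lemma excess_fin y : vol (ball_union y `\` B) = (excess y)%:E.
Proof.
rewrite fineK// ge0_fin_numE//; apply: le_lt_trans (vol_ball_union_lty y).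
apply: measure_le; [exact: measurable_excess_set|exact: measurable_ball_union|].
exact: subDsetl.
Qed.

Lemma excess_ge0 y : 0 <= excess y.
Proof. exact: fine_ge0. Qed.

Lemma fine_vol_ball_union y : fine (vol (ball_union y)) = fine (vol B) + excess y.
Proof.
have BU : B `<=` ball_union y by exact: (@sub_ball_union y None).
rewrite -[in LHS](setDUK BU) measureU//; last 3 first.
- exact: measurable_eball.
- exact: measurable_excess_set.
- by rewrite setDE setICA setICr setI0.
have fe : vol (ball_union y `\` B) \is a fin_num by rewrite excess_fin.
by rewrite fineD//; exact: fin_vol_ball.
Qed.

Lemma vol_ball_diff_muln w n :
  (vol (eball (n%:R *: w) 1 `\` B) <= n%:R%:E * vol (eball w 1 `\` B))%E.
Proof.
elim: n => [|n IH]; first by rewrite scale0r setDv measure0 mul0e.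
have mD (a b : 'rV[R]_d) : measurable (eball a 1 `\` eball b 1).
  by apply: measurableD; exact: measurable_eball.
apply: (@le_trans _ _ (vol ((eball (n%:R *: w) 1 `\` B) `|`
    (eball (n.+1%:R *: w) 1 `\` eball (n%:R *: w) 1)))).
  apply: measure_le => //; first exact: measurableU.
  by move=> x [h1 h2]; have [h3|h3] := pselect (eball (n%:R *: w) 1 x); [left|right].
apply: (le_trans (measureU2 _ _ _)) => //.
rewrite -[in leRHS]natr1 EFinD ge0_muleDl ?lee_fin//.
apply: leeD => //; rewrite mul1e.
rewrite -[leLHS]/(vol (eball (n.+1%:R *: w) 1 `\` eball (n%:R *: w) 1)).
rewrite -(lebesgue_mx_translate (n%:R *: w) (mD (n.+1%:R *: w) (n%:R *: w))).
rewrite (_ : mkset _ = eball w 1 `\` B)//.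
have E x : x + n%:R *: w - n.+1%:R *: w = x - w.
  by rewrite -natr1 scalerDl scale1r opprD addrA addrK.
by apply/seteqP; split => x /=; rewrite /eball/= E addrK subr0.
Qed.

Lemma excess_ge (K : R) : 0 <= K -> forall y i, N (row i y) <= K ->
  fine (vol B) / (2 + K) * N (row i y) <= excess y.
Proof.
move=> K0 y i wK; have := enorm_ge0 (row i y).
set w := row i y in wK *; rewrite le_eqVlt => /orP[/eqP <-|w0].
  by rewrite mulr0 excess_ge0.
pose n := (Num.truncn (2 / N w)).+1.
have nw : 2 < n%:R * N w by rewrite -ltr_pdivrMr// truncnS_gt.
have nw' : n%:R * N w <= 2 + K.
  rewrite /n -natr1 mulrDl mul1r lerD// -ler_pdivlMr//.
  by rewrite truncn_le divr_ge0// ltW.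
have h1 : (vol B <= n%:R%:E * vol (eball w 1 `\` B))%E.
  apply: le_trans (vol_ball_diff_muln w n).
  rewrite -(lebesgue_eball (n%:R *: w)); apply: measure_le; [exact: measurable_eball| |].
    by apply: measurableD; exact: measurable_eball.
  move=> x xw; split => //; rewrite /eball/= subr0 => x1.
  have := enorm_dist_triangle x (n%:R *: w) 0.
  rewrite !subr0 enormZ ger0_norm// => /(lt_le_trans nw).
  rewrite ltNge; apply/negP/negPn; rewrite -[leRHS](_ : 1 + 1 = 2)//.
  by rewrite lerD// enorm_distC.
have h2 : (vol B <= n%:R%:E * (excess y)%:E)%E.
  apply: le_trans h1 _; rewrite lee_wpmul2l// -excess_fin.
  apply: measure_le; [|exact: measurable_excess_set|].
    by apply: measurableD; exact: measurable_eball.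
  by apply: setSD; exact: (@sub_ball_union y (Some i)).
rewrite -[vol B]fineK ?fin_vol_ball// -EFinM lee_fin in h2.
rewrite mulrAC ler_pdivrMr ?ltr_wpDr//.
apply: (@le_trans _ _ (n%:R * excess y * N w)); first by rewrite ler_wpM2r// ltW.
by rewrite mulrAC [leRHS]mulrC ler_wpM2r// excess_ge0.
Qed.

End ball_union.

(** * Polar coordinates and the limit of the excess volume *)

Lemma measurable_boolR {dT} {T : measurableType dT} {R : realType} (b : T -> bool) :
  measurable_fun setT b -> measurable_fun setT (fun x => (b x)%:R : R).
Proof.
move=> mb; rewrite (_ : (fun x => _) = fun x => if b x then 1 else 0).
  exact: measurable_fun_ifT.
by apply/funext => x; case: (b x).
Qed.

Lemma integral_interval {R : realType} (a b c : R) : a <= b -> 0 <= c ->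
  (\int[@lebesgue_measure R]_s (c * (a < s <= b)%R%:R)%:E = (c * (b - a))%:E)%E.
Proof.
move=> ab c0.
transitivity (\int[@lebesgue_measure R]_s (c%:E * (\1_(`]a, b]%classic : set R) s)%:E))%E.
  by apply: eq_integral => s _; rewrite EFinM indicE mem_setE in_itv/=.
rewrite ge0_integralZl//=; last by apply/measurable_EFinP; exact: measurable_indic.
rewrite EFinM; congr (_ * _)%E; rewrite integral_indic// setIT.
transitivity (@lebesgue_measure R `]a, b]%classic) => //.
rewrite lebesgue_measure_itv/= lte_fin; case: ltP => //.
by move=> ba; rewrite (le_anti (introT andP (conj ab ba))) subrr.
Qed.

Section ge0_integral_real.
Context {dT} {T : measurableType dT} {R : realType} (mu : {measure set T -> \bar R}).
Implicit Types f g : T -> R.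

Lemma ge0_integralrZ f (c : R) : measurable_fun setT f -> (forall x, 0 <= f x) -> 0 <= c ->
  (\int[mu]_x (c * f x)%:E = c%:E * \int[mu]_x (f x)%:E)%E.
Proof.
move=> mf f0 c0; under eq_integral do rewrite EFinM.
apply: ge0_integralZl => //; first exact/measurable_EFinP.
by move=> x _; rewrite lee_fin.
Qed.

Lemma ge0_integralrD f g : measurable_fun setT f -> (forall x, 0 <= f x) ->
  measurable_fun setT g -> (forall x, 0 <= g x) ->
  (\int[mu]_x (f x + g x)%:E = \int[mu]_x (f x)%:E + \int[mu]_x (g x)%:E)%E.
Proof.
move=> mf f0 mg g0; under eq_integral do rewrite EFinD.
apply: ge0_integralD => //; try exact/measurable_EFinP.
  by move=> x _; rewrite lee_fin.
by move=> x _; rewrite lee_fin.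
Qed.

Lemma ge0_le_integralr f g : measurable_fun setT f -> (forall x, 0 <= f x) ->
  measurable_fun setT g -> (forall x, f x <= g x) ->
  (\int[mu]_x (f x)%:E <= \int[mu]_x (g x)%:E)%E.
Proof.
move=> mf f0 mg fg; apply: ge0_le_integral => //; try exact/measurable_EFinP.
- by move=> x _; rewrite lee_fin.
- by move=> x _; rewrite lee_fin.
Qed.

End ge0_integral_real.

Section polar_coordinates.
Context {R : realType} {e : nat}.
Local Notation d := e.+1.
Implicit Types (x y : 'rV[R]_d) (s : R).
Local Notation N := (@enorm R d).
Local Notation vol := (@lebesgue_mx R 1 d).
Local Notation leb := (@lebesgue_measure R).

(* Weight of the shell 1 <= |y| < 2, over which directions are averaged in place
   of the unit sphere. *)
Definition shell_weight y : R := 2 * (N y)^-1 * (1 <= N y < 2)%R%:R.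

Lemma shell_weight_ge0 y : 0 <= shell_weight y.
Proof. by rewrite /shell_weight !mulr_ge0// invr_ge0 enorm_ge0. Qed.

Lemma measurable_invr : measurable_fun setT (fun s : R => s^-1).
Proof.
rewrite (_ : (fun s => _) = fun s => if s == 0 then 0 else s^-1); last first.
  by apply/funext => s; case: eqP => // ->; rewrite invr0.
apply: measurable_fun_if => //.
- by apply: (measurable_fun_bool true); rewrite setTI (_ : _ @^-1` _ = [set 0])//;
  apply/seteqP; split => x /= /eqP.
- rewrite setTI; apply: open_continuous_measurable_fun.
    rewrite (_ : _ @^-1` _ = ~` [set 0]).
      by apply: closed_openC; exact: closed_eq.
    by apply/seteqP; split => x /= ; case: eqP.
  by move=> x /set_mem/= /negbT x0; exact: inv_continuous.
Qed.

Lemma measurable_shell_weight : measurable_fun setT shell_weight.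
Proof.
apply: measurable_funM; first apply: measurable_funM => //.
  exact: (measurableT_comp measurable_invr measurable_enorm).
apply: measurable_boolR; apply: measurable_and.
  by apply: measurable_fun_ler => //; exact: measurable_enorm.
by apply: measurable_fun_ltr => //; exact: measurable_enorm.
Qed.

Lemma measurable_scale_pair :
  measurable_fun setT (fun p : 'rV[R]_d * R => p.2 *: p.1).
Proof.
apply: measurable_mxP => i j; under eq_fun do rewrite mxE.
apply: measurable_funM => //.
exact: (measurableT_comp (measurable_coord i j) measurable_fst).
Qed.

(* Both sides equal the integral over [(x, s)] of
   [2 / N x * f x] on the region [s <= N x <= 2 s]; on the right [x = s y]. *)
Lemma polar_integral (f : 'rV[R]_d -> R) : measurable_fun setT f -> (forall x, 0 <= f x) ->
  (\int[vol]_x (f x)%:E =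
   \int[vol]_y \int[leb]_s (shell_weight y * ((0 < s)%R%:R * s ^+ e * f (s *: y)))%:E)%E.
Proof.
move=> mf f0.
pose G (p : 'rV[R]_d * R) := 2 * (N p.1)^-1 * (N p.1 / 2 < p.2 <= N p.1)%R%:R * f p.1.
pose H (p : 'rV[R]_d * R) := shell_weight p.1 * ((0 < p.2)%R%:R * p.2 ^+ e * f (p.2 *: p.1)).
have mN : measurable_fun setT (fun p : 'rV[R]_d * R => N p.1) by
    exact: (measurableT_comp measurable_enorm measurable_fst).
have mG : measurable_fun setT (EFin \o G).
  apply/measurable_EFinP; apply: measurable_funM; last exact: measurableT_comp.
  apply: measurable_funM; first by apply: measurable_funM => //; exact: measurableT_comp measurable_invr mN.
  apply: measurable_boolR; apply: measurable_and.
    by apply: measurable_fun_ltr => //; exact: measurable_funM.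
  exact: measurable_fun_ler.
have mH : measurable_fun setT (EFin \o H).
  apply/measurable_EFinP; apply: measurable_funM.
    exact: (measurableT_comp measurable_shell_weight measurable_fst).
  apply: measurable_funM; last exact: (measurableT_comp mf measurable_scale_pair).
  apply: measurable_funM; first by apply: measurable_boolR; exact: measurable_fun_ltr.
  exact: measurable_funX.
have G0 p : (0 <= (EFin \o G) p)%E by rewrite /= lee_fin /G !mulr_ge0// invr_ge0 enorm_ge0.
have H0 p : (0 <= (EFin \o H) p)%E.
  rewrite /= lee_fin /H; have [s0|s0] := ltP 0 p.2; last by rewrite !mul0r mulr0.
  apply: mulr_ge0; first exact: shell_weight_ge0.
  by apply: mulr_ge0 => //; apply: mulr_ge0 => //; apply: exprn_ge0; exact: ltW.
transitivity (\int[vol]_x \int[leb]_s (EFin \o G) (x, s))%E.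
  apply: ae_eq_integral => //.
  - exact/measurable_EFinP.
  - exact: measurable_fun_fubini_tonelli_F.
  exists [set 0]; split => //; first by rewrite -eball00; exact: measurable_eball.
    exact: lebesgue_rV0.
  move=> x /= /not_implyP[_]; apply: contra_notP => /eqP x0.
  have N0 : 0 < N x by rewrite lt0r enorm_ge0 andbT; apply: contra_neq x0; exact: enorm_eq0.
  under eq_integral => s _ do rewrite /= /G/= mulrAC.
  rewrite integral_interval; last 2 first.
  - by rewrite ler_pdivrMr// ler_peMr ?ler1n// ltW.
  - by rewrite !mulr_ge0// invr_ge0 ltW.
  by congr EFin; field; rewrite lt0r_neq0.
rewrite (fubini_tonelli (m1 := vol) (m2 := leb) (EFin \o G) mG G0).
rewrite -[RHS]/(\int[vol]_y \int[leb]_s (EFin \o H) (y, s))%E.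
rewrite (fubini_tonelli (m1 := vol) (m2 := leb) (EFin \o H) mH H0).
apply: eq_integral => s _; have [s0|s0] := ltP 0 s; last first.
  have h1 x : (EFin \o G) (x, s) = 0%E.
    rewrite /= /G/= (_ : (_ && _) = false) ?mulr0 ?mul0r//.
    apply/negP => /andP[]; rewrite ltr_pdivrMr// mulrC => h1 h2.
    by have := lt_le_trans h1 (ler_wpM2l (ler0n R 2) s0); rewrite mulr0 ltNge enorm_ge0.
  have h2 x : (EFin \o H) (x, s) = 0%E.
    by rewrite /= /H/= ltNge s0/= !mul0r mulr0.
  by rewrite !integral0_eq.
have mGs : measurable_fun setT (fun x => (EFin \o G) (x, s)).
  exact: (measurableT_comp mG (measurable_pair2 s)).
have := ge0_integral_scalemx s0 mGs (fun x => G0 (x, s)).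
rewrite mul1n => /(congr1 (fun t => (s ^+ d)%:E * t)%E).
rewrite muleA -EFinM mulfV ?mul1e ?expf_neq0 ?lt0r_neq0// => <-.
rewrite -ge0_integralZl//; last 2 first.
- exact: (measurableT_comp mGs (measurable_scalemx s)).
- by rewrite lee_fin exprn_ge0// ltW.
apply: eq_integral => y _; rewrite /= /G/= /H/= -EFinM /shell_weight s0 mul1r; congr EFin.
rewrite enormZ gtr0_norm//.
have -> : (s * N y / 2 < s <= s * N y)%R = (1 <= N y < 2)%R.
  have e1 : (s * N y / 2 < s) = (N y < 2) by rewrite ltr_pdivrMr// ltr_pM2l.
  have e2 : (s <= s * N y) = (1 <= N y) by rewrite ler_pMr.
  by rewrite e1 e2 andbC.
have [->|N0] := eqVneq (N y) 0; first by rewrite ler10/= !(mulr0, mul0r).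
by rewrite exprS; field; rewrite N0 lt0r_neq0.
Qed.

End polar_coordinates.

Section excess_asymptotics.
Context {R : realType} {e k : nat}.
Local Notation d := e.+1.
Implicit Types (x y : 'rV[R]_d) (z : 'M[R]_(k, d)) (s t : R).
Local Notation N := (@enorm R d).
Local Notation vol := (@lebesgue_mx R 1 d).
Local Notation leb := (@lebesgue_measure R).
Local Notation B := (eball (0 : 'rV[R]_d) 1).

(* [support z y] is the largest [s] with [s y] in [Dset z]; it is also the
   speed at which the boundary of [ball_union (t z)] moves along the ray of [y] *)
Definition support z y : R := \big[Num.max/0]_(i < k) (edot y (row i z) / N y ^+ 2).

Lemma support_ge0 z y : 0 <= support z y.
Proof. exact: bigmax_ge_id. Qed.

Lemma support_ge z y i : edot y (row i z) / N y ^+ 2 <= support z y.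
Proof. exact: le_bigmax. Qed.

Lemma support_exists z y s : 0 < s -> s <= support z y ->
  exists i, s <= edot y (row i z) / N y ^+ 2.
Proof.
move=> s0 sz; apply: contrapT => /forallNP h.
have : support z y < s; last by rewrite ltNge sz.
by apply/bigmax_ltP; split => // i _; rewrite ltNge; apply/negP.
Qed.

Lemma support_le z y : 1 <= N y -> support z y <= rows_norm z.
Proof.
move=> y1; apply/bigmax_leP; split => [|i _]; first exact: rows_norm_ge0.
have y0 : 0 < N y by exact: lt_le_trans y1.
rewrite ler_pdivrMr ?exprn_gt0//; apply: le_trans (ler_norm _) _.
apply: le_trans (edot_le _ _) _; rewrite mulrC.
apply: ler_pM; rewrite ?enorm_ge0 ?exprn_ge0//; first exact: (enorm_vertex_le z (Some i)).
by rewrite expr2 ler_peMr// ltW.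
Qed.

Lemma measurable_support z : measurable_fun setT (support z).
Proof.
rewrite /support; elim: (index_enum _) => [|i r IH].
  by rewrite (_ : (fun=> _) = cst 0)//; apply/funext => y; rewrite big_nil.
under eq_fun do rewrite big_cons.
apply: measurable_maxr => //; apply: measurable_funM.
  apply: measurable_sum => j; apply: measurable_funM => //; exact: measurable_coord.
apply: (measurableT_comp measurable_invr); apply: measurable_funX.
exact: measurable_enorm.
Qed.

Lemma excess_ray_le z y t s : 0 < t -> 1 <= N y -> 0 < s ->
  (ball_union (t *: z) `\` B) (s *: y) ->
  (N y)^-1 < s <= (N y)^-1 + t * (support z y + t * rows_norm z ^+ 2).
Proof.
move=> t0 y1 s0 [[v yv]]; rewrite /eball/= subr0 => /negP; rewrite -ltNge.
have n0 : 0 < N y by exact: lt_le_trans y1.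
rewrite enormZ gtr0_norm// => sn1.
case: v yv => [i|]; last by rewrite subr0 enormZ gtr0_norm// leNgt sn1.
rewrite vertexZ/=; set w := row i z => h.
have ns : (N y)^-1 < s by rewrite -[_^-1]mul1r ltr_pdivrMr.
rewrite ns/=.
have wT : N w <= rows_norm z by exact: (enorm_vertex_le z (Some i)).
have T0 := rows_norm_ge0 z.
apply: (@le_trans _ _ ((N y)^-1 + t * (edot y w / N y ^+ 2 + t * rows_norm z ^+ 2))); last first.
  by rewrite lerD2l ler_pM2l// lerD2r; exact: support_ge.
have : N (s *: y - t *: w) ^+ 2 <= 1 by rewrite expr_le1// enorm_ge0.
rewrite enorm_sqr -scaleNr edotDl !edotDr !edotZl !edotZr -!enorm_sqr [edot w y]edotC.
have := edot_le y w; rewrite ler_norml => /andP[_ pn].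
move: (N y) (N w) (edot y w) (rows_norm z) n0 y1 (enorm_ge0 w) sn1 wT T0 pn {h} ns => n q p T n0 n1 q0 sn qT T0 pn ns h.
pose u := t * p / n; pose a := t * T; pose hh := s * n - 1.
have hh0 : 0 < hh by rewrite subr_gt0.
have h1 : hh * (2 + hh) <= 2 * (1 + hh) * u.
  have -> : 2 * (1 + hh) * u = 2 * s * t * p.
    by rewrite /u /hh; field; rewrite lt0r_neq0.
  have -> : hh * (2 + hh) = s * (s * n ^+ 2) - 1 by rewrite /hh; ring.
  have : 0 <= t * (t * q ^+ 2) by rewrite !mulr_ge0 ?sqr_ge0// ltW.
  by move: h; nra.
have u0 : 0 < u.
  have h2 : 0 < 2 * (1 + hh) * u by apply: lt_le_trans h1; rewrite mulr_gt0// addr_gt0.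
  by move: h2; rewrite pmulr_rgt0// mulr_gt0// addr_gt0.
have ua : u <= a.
  rewrite /u /a -mulrA ler_pM2l// ler_pdivrMr//; apply: le_trans pn _.
  by rewrite mulrC ler_pM2r.
have h3 : hh <= u + a ^+ 2 / 2.
  have : u ^+ 2 <= a ^+ 2 by rewrite lerXn2r// nnegrE ltW// (lt_le_trans u0).
  have := sqr_ge0 (hh - u); rewrite sqrrB; move: h1; rewrite mulrDr -!expr2.
  by move: (a ^+ 2) (u ^+ 2) => A U; nra.
have -> : n^-1 + t * (p / n ^+ 2 + t * T ^+ 2) = (1 + (u + n * a ^+ 2)) / n.
  by rewrite /u /a; field; rewrite lt0r_neq0.
rewrite ler_pdivlMr// -lerBlDl; apply: le_trans h3 _; rewrite lerD2l.
have := sqr_ge0 a; move: (a ^+ 2) => A A0; nra.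
Qed.

Lemma excess_ray_ge z y t s : 0 < t -> 1 <= N y -> 0 < s ->
  (N y)^-1 < s <= (N y)^-1 + t * (support z y - t * rows_norm z ^+ 2) ->
  (ball_union (t *: z) `\` B) (s *: y).
Proof.
move=> t0 y1 s0 /andP[ns sle].
have n0 : 0 < N y by exact: lt_le_trans y1.
have sn : 1 < s * N y by rewrite -ltr_pdivrMr// mul1r.
split; last by rewrite /eball/= subr0 enormZ gtr0_norm//; apply/negP; rewrite -ltNge.
pose r := (s - (N y)^-1) / t + t * rows_norm z ^+ 2.
have r0 : 0 < r.
  by rewrite /r ltr_pwDl// ?divr_gt0 ?subr_gt0// mulr_ge0 ?sqr_ge0// ltW.
have rz : r <= support z y.
  by rewrite /r -lerBrDr ler_pdivrMr// lerBlDl mulrC.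
have [i] := support_exists r0 rz; set w := row i z => rp.
exists (Some i); rewrite vertexZ/= -/w.
have wT : N w <= rows_norm z by exact: (enorm_vertex_le z (Some i)).
have T0 := rows_norm_ge0 z.
rewrite -(@ler_pXn2r _ 2) ?nnegrE ?enorm_ge0// expr1n.
rewrite enorm_sqr -scaleNr edotDl !edotDr !edotZl !edotZr -!enorm_sqr [edot w y]edotC.
move: rp; rewrite /r.
move: (N y) (N w) (edot y w) (rows_norm z) n0 y1 (enorm_ge0 w) sn wT T0 {r r0 rz sle} ns
    => n q p T n0 n1 q0 sn qT T0 ns rp.
pose u := t * p / n; pose a := t * T; pose hh := s * n - 1.
have hh0 : 0 < hh by rewrite subr_gt0.
have h1 : hh <= u - n * a ^+ 2.
  rewrite -subr_ge0 in rp; rewrite -subr_ge0.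
  have -> : u - n * a ^+ 2 - hh = (t * n) * (p / n ^+ 2 - ((s - n^-1) / t + t * T ^+ 2)).
    by rewrite /u /hh /a; field; rewrite !lt0r_neq0.
  by rewrite mulr_ge0// mulr_ge0// ltW.
have a0 := sqr_ge0 a.
have h2 : hh <= u - a ^+ 2.
  by apply: le_trans h1 _; rewrite lerD2l lerN2 ler_peMl.
have qa : t * (t * q ^+ 2) <= a ^+ 2.
  by rewrite /a exprMn [t ^+ 2]expr2 -mulrA !ler_pM2l// lerXn2r// nnegrE.
rewrite -subr_ge0.
have -> : 1 - (s * (s * n ^+ 2) + s * (- t * p) + (- t * (s * p) + - t * (- t * q ^+ 2))) =
   2 * u + 2 * hh * u - 2 * hh - hh ^+ 2 - t * (t * q ^+ 2).
  by rewrite /u /hh; field; rewrite lt0r_neq0.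
move: (a ^+ 2) a0 h2 qa => A A0 h2 qa.
have : 0 <= hh * (2 * u - hh) by rewrite mulr_ge0 ?ltW//; lra.
by move: (t * (t * _)) qa => Q qa; nra.
Qed.

Definition ray_integral z : \bar R :=
  (\int[vol]_y (shell_weight y * ((N y)^-1 ^+ e * support z y))%:E)%E.

Definition shell_constant : R :=
  fine (\int[vol]_y (shell_weight y * (N y)^-1 ^+ e)%:E)%E.

Lemma enorm_gt0_shell y : shell_weight y != 0 -> 1 <= N y < 2.
Proof. by rewrite /shell_weight; case: (_ && _) => //; rewrite mulr0 eqxx. Qed.

Lemma shell_weight_le y : shell_weight y <= 2 * (\1_(eball 0 2 : set 'rV[R]_d) y).
Proof.
have [->|/enorm_gt0_shell/andP[y1 y2]] := eqVneq (shell_weight y) 0.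
  by rewrite mulr_ge0.
rewrite indicE mem_set ?mulr1; last by rewrite /eball/= subr0 ltW.
rewrite /shell_weight y1 y2/= mulr1 ler_piMr// invf_le1//.
exact: lt_le_trans y1.
Qed.

Lemma measurable_shell_fun : measurable_fun setT (fun y => shell_weight y * (N y)^-1 ^+ e).
Proof.
apply: measurable_funM; first exact: measurable_shell_weight.
apply: measurable_funX; exact: (measurableT_comp measurable_invr measurable_enorm).
Qed.

Lemma shell_fun_ge0 y : 0 <= shell_weight y * (N y)^-1 ^+ e.
Proof. by rewrite mulr_ge0 ?shell_weight_ge0// exprn_ge0// invr_ge0 enorm_ge0. Qed.

Lemma shell_constantE :
  (\int[vol]_y (shell_weight y * (N y)^-1 ^+ e)%:E)%E = shell_constant%:E.
Proof.
rewrite fineK// ge0_fin_numE; last by apply: integral_ge0 => y _; rewrite lee_fin shell_fun_ge0.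
have mI : measurable_fun setT (\1_(eball (0 : 'rV[R]_d) 2) : 'rV[R]_d -> R).
  by apply: measurable_indic; exact: measurable_eball.
apply: (@le_lt_trans _ _ (\int[vol]_y (2 * (\1_(eball (0 : 'rV[R]_d) 2) y))%:E)%E).
  apply: ge0_le_integralr; [exact: measurable_shell_fun|exact: shell_fun_ge0|exact: measurable_funM|].
  move=> y; apply: le_trans (shell_weight_le y).
  have [->|/enorm_gt0_shell/andP[y1 y2]] := eqVneq (shell_weight y) 0.
    by rewrite mul0r.
  rewrite ler_piMr ?shell_weight_ge0// exprn_ile1 ?invr_ge0 ?enorm_ge0//.
  by rewrite invf_le1//; exact: lt_le_trans y1.
rewrite ge0_integralrZ// integral_indic//; last exact: measurable_eball.
by rewrite setIT lte_mul_pinfty// lebesgue_eball_lty.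
Qed.

Lemma shell_constant_ge0 : 0 <= shell_constant.
Proof. by rewrite -lee_fin -shell_constantE; apply: integral_ge0 => y _; rewrite lee_fin shell_fun_ge0. Qed.

Lemma measurable_ray_fun z :
  measurable_fun setT (fun y => shell_weight y * ((N y)^-1 ^+ e * support z y)).
Proof.
under eq_fun do rewrite mulrA; apply: measurable_funM; first exact: measurable_shell_fun.
exact: measurable_support.
Qed.

Lemma ray_fun_ge0 z y : 0 <= shell_weight y * ((N y)^-1 ^+ e * support z y).
Proof. by rewrite mulrA mulr_ge0 ?shell_fun_ge0 ?support_ge0. Qed.

Lemma ray_integral_le z : (ray_integral z <= (rows_norm z * shell_constant)%:E)%E.
Proof.
rewrite EFinM -shell_constantE -ge0_integralrZ; last 3 first.
- exact: measurable_shell_fun.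
- exact: shell_fun_ge0.
- exact: rows_norm_ge0.
apply: ge0_le_integralr; [exact: measurable_ray_fun|exact: ray_fun_ge0| |].
  by apply: measurable_funM => //; exact: measurable_shell_fun.
move=> y; have [->|/enorm_gt0_shell/andP[y1 y2]] := eqVneq (shell_weight y) 0.
  by rewrite !mul0r mulr0.
by rewrite [leLHS]mulrA [leLHS]mulrC ler_wpM2r ?shell_fun_ge0// support_le.
Qed.

Lemma Dset_ray z y s : 0 < N y -> 0 < s -> Dset z (s *: y) <-> s <= support z y.
Proof.
move=> n0 s0.
have E i : eball (2^-1 *: row i z) (enorm (row i z) / 2) (s *: y) <-> s <= edot y (row i z) / N y ^+ 2.
  rewrite /eball/=; set w := row i z.
  have -> : (N (s *: y - 2^-1 *: w) <= N w / 2) = (N (s *: y - 2^-1 *: w) ^+ 2 <= (N w / 2) ^+ 2).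
    by rewrite ler_pXn2r// nnegrE ?enorm_ge0// divr_ge0// enorm_ge0.
  rewrite exprMn !enorm_sqr -scaleNr edotDl !edotDr !edotZl !edotZr -!enorm_sqr [edot w y]edotC.
  rewrite ler_pdivlMr ?exprn_gt0//.
  move: (N y ^+ 2) (N w ^+ 2) (edot y w) => n q p.
  rewrite -(ler_pM2l s0 (s * n) p).
  have -> : (s * (s * n) <= s * p) = (0 <= s * p - s * (s * n)) by rewrite subr_ge0.
  rewrite -subr_ge0.
  have -> : q * 2^-1 ^+ 2 - (s * (s * n) + s * (- 2^-1 * p) + (- 2^-1 * (s * p) + - 2^-1 * (- 2^-1 * q))) =
    s * p - s * (s * n).
    by field.
  by [].
split.
  by move=> [i _ /E] /le_trans; apply; exact: support_ge.
by move=> /(support_exists s0)[i /E]; exists i.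
Qed.

Lemma measurable_Dset z : measurable (Dset z).
Proof.
apply: fin_bigcup_measurable; first exact: finite_finset.
by move=> i _; exact: measurable_eball.
Qed.

Lemma gfun_ray_integral z : (gfun z)%:E = ray_integral z.
Proof.
have fr : ray_integral z \is a fin_num.
  rewrite ge0_fin_numE; first exact: le_lt_trans (ray_integral_le z) (ltry _).
  by apply: integral_ge0 => y _; rewrite lee_fin ray_fun_ge0.
rewrite -[RHS]fineK//; congr (fine _)%:E; rewrite integral_mkcond.
pose f x : R := (N x)^-1 ^+ e * \1_(Dset z) x.
have mf : measurable_fun setT f.
  apply: measurable_funM; last by apply: measurable_indic; exact: measurable_Dset.
  apply: measurable_funX; exact: (measurableT_comp measurable_invr measurable_enorm).
have f0 x : 0 <= f x by rewrite mulr_ge0// exprn_ge0// invr_ge0 enorm_ge0.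
transitivity (\int[vol]_x (f x)%:E)%E.
  apply: eq_integral => x _; rewrite patchE /f indicE; case: ifP => _; last by rewrite mulr0.
  have E (n : nat) : 1 - n.+1%:Z = - n%:Z by rewrite -addn1 PoszD opprD addrC subrK.
  by rewrite mulr1 E -exprnN exprVn.
rewrite polar_integral//; apply: eq_integral => y _.
have [->|/enorm_gt0_shell/andP[y1 y2]] := eqVneq (shell_weight y) 0.
  by rewrite integral0_eq ?mul0r// => s _; rewrite mul0r.
have n0 : 0 < N y by exact: lt_le_trans y1.
transitivity (\int[leb]_s (shell_weight y * (N y)^-1 ^+ e * (0 < s <= support z y)%R%:R)%:E)%E.
  apply: eq_integral => s _; rewrite -[in RHS]mulrA; congr (_ * _)%:E.
  have [s0|s0] := ltP 0 s; last by rewrite !mul0r mulr0.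
  rewrite mul1r /f enormZ gtr0_norm// indicE/=.
  rewrite (_ : (s *: y \in Dset z) = (s <= support z y)).
    by rewrite mulrA -exprMn invfM mulrA mulfV ?mul1r// lt0r_neq0.
  by apply/idP/idP => [/set_mem/Dset_ray|/Dset_ray h]; [exact|apply/mem_set; exact: h].
by rewrite integral_interval ?support_ge0 ?shell_fun_ge0// subr0 mulrA.
Qed.

Definition ray_excess (A : set 'rV[R]_d) y : \bar R :=
  (\int[leb]_s ((0 < s)%R%:R * s ^+ e * \1_A (s *: y))%:E)%E.

Lemma measurable_ray_integrand (A : set 'rV[R]_d) : measurable A ->
  measurable_fun setT (fun p : 'rV[R]_d * R => (0 < p.2)%R%:R * p.2 ^+ e * \1_A (p.2 *: p.1) : R).
Proof.
move=> mA; apply: measurable_funM.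
  apply: measurable_funM; first by apply: measurable_boolR; exact: measurable_fun_ltr.
  exact: measurable_funX.
apply: (measurableT_comp (f := \1_A : 'rV[R]_d -> R)); last exact: measurable_scale_pair.
exact: measurable_indic.
Qed.

Lemma ray_integrand_ge0 (A : set 'rV[R]_d) y s : 0 <= (0 < s)%R%:R * s ^+ e * \1_A (s *: y) :> R.
Proof.
have [s0|s0] := ltP 0 s; last by rewrite !mul0r.
by rewrite mul1r mulr_ge0// exprn_ge0// ltW.
Qed.

Lemma ray_excess_ge0 A y : (0 <= ray_excess A y)%E.
Proof. by apply: integral_ge0 => s _; rewrite lee_fin ray_integrand_ge0. Qed.

Lemma measurable_ray_excess A : measurable A -> measurable_fun setT (ray_excess A).
Proof.
move=> mA; apply: (measurable_fun_fubini_tonelli_F (m2 := leb)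
  (fun p : 'rV[R]_d * R => ((0 < p.2)%R%:R * p.2 ^+ e * \1_A (p.2 *: p.1))%:E)).
  by apply/measurable_EFinP; exact: measurable_ray_integrand.
by move=> p; rewrite lee_fin ray_integrand_ge0.
Qed.

Lemma vol_ray_excess A : measurable A ->
  (vol A = \int[vol]_y ((shell_weight y)%:E * ray_excess A y))%E.
Proof.
move=> mA; rewrite -[A in LHS]setIT -(integral_indic vol measurableT mA).
rewrite polar_integral//; apply: eq_integral => y _.
rewrite -ge0_integralZl//.
- by apply/measurable_EFinP; exact: (measurableT_comp (measurable_ray_integrand mA) (measurable_pair1 y)).
- by move=> s _; rewrite lee_fin ray_integrand_ge0.
- by rewrite lee_fin shell_weight_ge0.
Qed.

Section ray_bounds.
Variables (z : 'M[R]_(k, d)) (t : R).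
Hypothesis t0 : 0 < t.
Local Notation T := (rows_norm z).
Local Notation A := (ball_union (t *: z) `\` B).

Lemma measurable_ray_section y : measurable_fun setT (fun s => (0 < s)%R%:R * s ^+ e * \1_A (s *: y) : R).
Proof.
exact: (measurableT_comp (measurable_ray_integrand (measurable_excess_set (t *: z))) (measurable_pair1 y)).
Qed.

Lemma ray_excess_le y : 1 <= N y < 2 ->
  (ray_excess A y <= ((1 + 2 * (t * (T + t * T ^+ 2))) ^+ e *
    ((N y)^-1 ^+ e * (t * (support z y + t * T ^+ 2))))%:E)%E.
Proof.
move=> /andP[y1 y2]; have n0 : 0 < N y by exact: lt_le_trans y1.
have T0 := rows_norm_ge0 z.
set b := t * (support z y + t * T ^+ 2).
have b0 : 0 <= b by rewrite mulr_ge0 ?addr_ge0 ?support_ge0 ?mulr_ge0 ?sqr_ge0// ltW.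
pose c := ((N y)^-1 + b) ^+ e.
have nb0 : 0 <= (N y)^-1 + b by rewrite addr_ge0// invr_ge0 ltW.
apply: (@le_trans _ _ (c * b)%:E).
  apply: (@le_trans _ _ (\int[leb]_s (c * ((N y)^-1 < s <= (N y)^-1 + b)%R%:R)%:E)%E).
    apply: ge0_le_integral => //.
    - by move=> s _; rewrite lee_fin ray_integrand_ge0.
    - by apply/measurable_EFinP; exact: measurable_ray_section.
    - apply/measurable_EFinP; apply: measurable_funM => //; apply: measurable_boolR.
      by apply: measurable_and; [exact: measurable_fun_ltr|exact: measurable_fun_ler].
    - move=> s _; rewrite lee_fin indicE.
      have [s0|s0] := ltP 0 s; last by rewrite !mul0r mulr_ge0 ?exprn_ge0.
      rewrite mul1r; case: (boolP (_ \in _)) => [|_]; last by rewrite mulr0 mulr_ge0 ?exprn_ge0.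
      move=> /set_mem/(excess_ray_le t0 y1 s0) h; rewrite h !mulr1.
      by rewrite lerXn2r ?nnegrE ?(ltW s0)//; case/andP: h.
  by rewrite integral_interval ?exprn_ge0// ?lerDl// addrAC subrr add0r.
rewrite lee_fin [leRHS]mulrA ler_wpM2r// -exprMn lerXn2r ?nnegrE//.
  rewrite mulr_ge0 ?invr_ge0 ?ltW// ltr_wpDr// !mulr_ge0 ?addr_ge0 ?mulr_ge0 ?sqr_ge0//; exact: ltW.
have -> : (N y)^-1 + b = (1 + N y * b) / N y by field; rewrite lt0r_neq0.
rewrite ler_pM2r ?invr_gt0// lerD2l; apply: ler_pM => //; [exact: ltW|exact: ltW|].
by rewrite ler_pM2l// lerD2r support_le.
Qed.

Lemma ray_excess_ge y : 1 <= N y < 2 ->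
  (((N y)^-1 ^+ e * (t * (support z y)))%:E <=
    ray_excess A y + (t * (t * T ^+ 2) * (N y)^-1 ^+ e)%:E)%E.
Proof.
move=> /andP[y1 y2]; have n0 : 0 < N y by exact: lt_le_trans y1.
have T0 := rows_norm_ge0 z.
pose c := (N y)^-1 ^+ e; have c0 : 0 <= c by rewrite exprn_ge0// invr_ge0 ltW.
rewrite -/c; set b := t * (support z y - t * T ^+ 2).
have -> : c * (t * support z y) = c * b + t * (t * T ^+ 2) * c by rewrite /b; ring.
rewrite EFinD leeD2r//.
have [b0|b0] := ltP b 0.
  by apply: le_trans (ray_excess_ge0 _ _); rewrite lee_fin mulr_ge0_le0// ltW.
apply: (@le_trans _ _ (\int[leb]_s (c * ((N y)^-1 < s <= (N y)^-1 + b)%R%:R)%:E)%E).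
  by rewrite integral_interval// ?lerDl// addrAC subrr add0r.
apply: ge0_le_integral => //.
- by move=> s _; rewrite lee_fin mulr_ge0.
- apply/measurable_EFinP; apply: measurable_funM => //; apply: measurable_boolR.
  by apply: measurable_and; [exact: measurable_fun_ltr|exact: measurable_fun_ler].
- by apply/measurable_EFinP; exact: measurable_ray_section.
move=> s _; rewrite lee_fin; case: (boolP (_ && _)) => [h|_]; last by rewrite mulr0 ray_integrand_ge0.
have s0 : 0 < s by case/andP: h => + _; apply: le_lt_trans; rewrite invr_ge0 ltW.
rewrite s0 mul1r indicE mem_set ?mulr1; last exact: excess_ray_ge.
by rewrite lerXn2r ?nnegrE ?invr_ge0 ?(ltW s0) ?(ltW n0)//; case/andP: h => /ltW.
Qed.

Lemma excess_upper : excess (t *: z) <=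
  t * ((1 + 2 * (t * (T + t * T ^+ 2))) ^+ e * (gfun z + t * T ^+ 2 * shell_constant)).
Proof.
have T0 := rows_norm_ge0 z.
set K := (_ ^+ e).
have K0 : 0 <= K.
  by rewrite exprn_ge0// addr_ge0// !mulr_ge0 ?addr_ge0// ?mulr_ge0 ?sqr_ge0// ltW.
have tT : 0 <= t * T ^+ 2 by rewrite mulr_ge0 ?sqr_ge0// ltW.
rewrite -lee_fin -excess_fin vol_ray_excess; last exact: measurable_excess_set.
pose h y := K * (t * (t * T ^+ 2) * (shell_weight y * (N y)^-1 ^+ e) +
  t * (shell_weight y * ((N y)^-1 ^+ e * support z y))).
have mF1 := measurable_shell_fun; have mF2 := measurable_ray_fun z.
have F10 := shell_fun_ge0; have F20 := ray_fun_ge0 z.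
have tt : 0 <= t * (t * T ^+ 2) by rewrite mulr_ge0// ltW.
have -> : (t * (K * (gfun z + t * T ^+ 2 * shell_constant)))%:E = (\int[vol]_y (h y)%:E)%E.
  have e1 : (\int[vol]_y (t * (t * T ^+ 2) * (shell_weight y * (N y)^-1 ^+ e))%:E)%E =
      (t * (t * T ^+ 2) * shell_constant)%:E.
    by rewrite ge0_integralrZ// [in RHS]EFinM -shell_constantE.
  have e2 : (\int[vol]_y (t * (shell_weight y * ((N y)^-1 ^+ e * support z y)))%:E)%E =
      (t * gfun z)%:E.
    by rewrite ge0_integralrZ// ?(ltW t0)// [in RHS]EFinM gfun_ray_integral.
  transitivity (K%:E * ((t * (t * T ^+ 2) * shell_constant)%:E + (t * gfun z)%:E))%E.
    by rewrite -EFinD -EFinM; congr EFin; ring.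
  rewrite ge0_integralrZ//; last 2 first.
  - by apply: measurable_funD; exact: measurable_funM.
  - by move=> y; rewrite addr_ge0// mulr_ge0// ltW.
  rewrite ge0_integralrD//; last 4 first.
  - exact: measurable_funM.
  - by move=> y; rewrite mulr_ge0.
  - exact: measurable_funM.
  - by move=> y; rewrite mulr_ge0// ltW.
  by rewrite -e1 -e2.
have mh : measurable_fun setT h.
  by apply: measurable_funM => //; apply: measurable_funD; exact: measurable_funM.
apply: ge0_le_integral => //.
- by move=> y _; rewrite mule_ge0 ?ray_excess_ge0// lee_fin shell_weight_ge0.
- apply: emeasurable_funM; first by apply/measurable_EFinP; exact: measurable_shell_weight.
  by apply: measurable_ray_excess; exact: measurable_excess_set.
- exact/measurable_EFinP.
move=> y _; have [y0|/enorm_gt0_shell y12] := eqVneq (shell_weight y) 0.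
  by rewrite y0 mul0e /h y0 !mul0r !mulr0 addr0 mulr0.
apply: le_trans (lee_wpmul2l _ (ray_excess_le y12)) _; first by rewrite lee_fin shell_weight_ge0.
by rewrite -EFinM lee_fin -/K /h le_eqVlt; apply/orP; left; apply/eqP; ring.
Qed.

Lemma excess_lower : t * gfun z <= excess (t *: z) + t * (t * T ^+ 2) * shell_constant.
Proof.
have T0 := rows_norm_ge0 z.
have tT : 0 <= t * (t * T ^+ 2) by rewrite !mulr_ge0 ?sqr_ge0// ltW.
have mF1 := measurable_shell_fun; have mF2 := measurable_ray_fun z.
have F10 := shell_fun_ge0; have F20 := ray_fun_ge0 z.
rewrite -lee_fin EFinD 2!EFinM gfun_ray_integral -excess_fin -shell_constantE.
rewrite vol_ray_excess; last exact: measurable_excess_set.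
rewrite -ge0_integralrZ ?(ltW t0)// -ge0_integralrZ//.
have mr : measurable_fun setT (fun y => (shell_weight y)%:E * ray_excess A y)%E.
  apply: emeasurable_funM; first by apply/measurable_EFinP; exact: measurable_shell_weight.
  by apply: measurable_ray_excess; exact: measurable_excess_set.
have ms : measurable_fun setT (fun y => (t * (t * T ^+ 2) * (shell_weight y * (N y)^-1 ^+ e))%:E).
  by apply/measurable_EFinP; exact: measurable_funM.
have r0 y : (0 <= (shell_weight y)%:E * ray_excess A y)%E.
  by rewrite mule_ge0 ?ray_excess_ge0// lee_fin shell_weight_ge0.
have s0 y : (0 <= (t * (t * T ^+ 2) * (shell_weight y * (N y)^-1 ^+ e))%:E)%E.
  by rewrite lee_fin mulr_ge0.
rewrite -(ge0_integralD vol measurableT (fun y _ => r0 y) mr (fun y _ => s0 y) ms).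
apply: ge0_le_integral => //.
- by move=> y _; rewrite lee_fin mulr_ge0// ltW.
- by apply/measurable_EFinP; exact: measurable_funM.
- exact: emeasurable_funD.
move=> y _; have [y0|/enorm_gt0_shell y12] := eqVneq (shell_weight y) 0.
  by rewrite y0 mul0e !mul0r !mulr0 add0e.
have := lee_wpmul2l (_ : (0 <= (shell_weight y)%:E)%E) (ray_excess_ge y12).
rewrite lee_fin shell_weight_ge0 => /(_ isT).
rewrite ge0_muleDr ?ray_excess_ge0 ?lee_fin//; last by rewrite mulr_ge0// exprn_ge0// invr_ge0 enorm_ge0.
rewrite -!EFinM => h; apply: le_trans (le_trans h _).
  by rewrite lee_fin le_eqVlt; apply/orP; left; apply/eqP; ring.
by rewrite leeD2l// lee_fin le_eqVlt; apply/orP; left; apply/eqP; ring.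
Qed.

End ray_bounds.

End excess_asymptotics.

(** * Lexicographic order and rounded clusters *)

Lemma near_finite_set {T U : Type} {F : set_system U} {FF : Filter F} (A : set T)
  (P : T -> U -> Prop) : finite_set A ->
  (forall x, A x -> \forall u \near F, P x u) ->
  \forall u \near F, forall x, A x -> P x u.
Proof.
move=> [n]; elim: n A => [|n IH] A.
  by rewrite II0 card_eq0 => /eqP -> _; exact: nearW.
move=> /eq_cardSP[x Ax /IH {}IH] h.
have h1 : \forall u \near F, forall y, (A `\` [set x]) y -> P y u.
  by apply: IH => y [Ay _]; exact: h.
apply: filterS2 (h x Ax) h1 => u Px h1 y Ay.
by have [->//|yx] := pselect (y = x); exact: h1.
Qed.

Lemma card_range_ord {T : Type} (n : nat) (f : 'I_n -> T) : injective f ->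
  (range f #= `I_n)%card.
Proof.
move=> injf; have c1 : (range f #= [set: 'I_n])%card.
  by apply: inj_card_eq; apply: in2W.
have c2 : (`I_n #= [set: 'I_n])%card.
  have -> : `I_n = val @` [set: 'I_n].
    by apply/seteqP; split => [m mn|_ [[m mn] _ <-]//]; exists (Ordinal mn).
  by apply: inj_card_eq; apply: in2W; exact: val_inj.
by rewrite card_eq_sym in c2; exact: card_eq_trans c1 c2.
Qed.

Lemma clos_refl_trans_ind_set (T : Type) (e : T -> T -> Prop) (S : set T) (x y : T) :
  (forall a b, S a -> e a b -> S b) -> S x -> clos_refl_trans _ e x y -> S y.
Proof.
move=> h Sx xy; elim: xy Sx => [a b ab Sa|//|a b c _ IH1 _ IH2 /IH1/IH2//].
exact: h ab.
Qed.

Section lexicographic_order.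
Context {R : realType} {d : nat}.
Implicit Types (x y z : 'rV[R]_d) (X : set 'rV[R]_d).

Definition lexlt x y : bool := lexle x y && (x != y).

Lemma tuple_of_row_inj : injective (@tuple_of_row R d).
Proof.
move=> x y h; apply/rowP => j; have := congr1 (fun t => tnth t j) h.
by rewrite !tnth_mktuple.
Qed.

Lemma lexle_trans : transitive (@lexle R d).
Proof. by move=> y x z; exact: le_trans. Qed.

Lemma lexle_total : total (@lexle R d).
Proof. by move=> x y; exact: le_total. Qed.

Lemma lexle_anti : antisymmetric (@lexle R d).
Proof. by move=> x y /le_anti/tuple_of_row_inj. Qed.

Lemma lexlt_total x y : x != y -> lexlt x y \/ lexlt y x.
Proof.
by move=> xy; have /orP[h|h] := lexle_total x y; [left|right]; rewrite /lexlt h// eq_sym.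
Qed.

Lemma lexltxx x : lexlt x x = false.
Proof. by rewrite /lexlt eqxx andbF. Qed.

Lemma lexltNge x y : lexlt x y = ~~ lexle y x.
Proof.
apply/idP/idP => [/andP[xy]|]; first by apply: contraNN => yx; apply/eqP/lexle_anti; rewrite xy.
move=> yx; apply/andP; split; first by have /orP[//|h] := lexle_total x y; rewrite h in yx.
by apply: contraNneq yx => ->; have := lexle_total y y; rewrite orbb.
Qed.

Lemma lexltP x y : lexlt x y <->
  exists2 l : 'I_d, (forall j : 'I_d, (j < l)%N -> x 0 j = y 0 j) & x 0 l < y 0 l.
Proof.
have -> : lexlt x y = ((tuple_of_row x : d.-tuplelexi R) < (tuple_of_row y : d.-tuplelexi R))%O.
  by rewrite lt_def andbC /lexlt (inj_eq tuple_of_row_inj) eq_sym.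
split.
  move=> /ltxi_tupleP[l h]; exists l.
    by move=> j jl; have := h j (ltnW jl); rewrite !tnth_mktuple neq_ltn jl/= => /leifP/eqP.
  by have := h l (leqnn _); rewrite !tnth_mktuple eqxx => /leifP.
move=> [l h xy]; apply/ltxi_tupleP; exists l => j.
rewrite !tnth_mktuple leq_eqVlt => /orP[/eqP/val_inj ->|jl].
  by rewrite eqxx; apply/leifP.
by rewrite neq_ltn jl/=; apply/leifP; rewrite h.
Qed.

Lemma near_grid_lexlt x y : lexlt x y -> \forall m \near \oo, lexlt (grid m x) (grid m y).
Proof.
move=> /lexltP[l h xy].
have : \forall m \near \oo, m.+1%:R^-1 < y 0 l - x 0 l.
  have yx : 0 < y 0 l - x 0 l by rewrite subr_gt0.
  exact: near_infty_natSinv_lt (PosNum yx).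
apply: filterS => m hm; apply/lexltP; exists l => [j jl|].
  by rewrite !mxE h.
have /andP[a _] := grid_bounds m x 0 l; have /andP[_ b] := grid_bounds m y 0 l.
by apply: le_lt_trans a _; move: hm b; move: m.+1%:R^-1 (grid m y 0 l) => v g; lra.
Qed.

End lexicographic_order.

Section lex_points.
Context {R : realType} {d k : nat}.
Implicit Types (x y z : 'rV[R]_d) (X : set 'rV[R]_d) (a b : 'M[R]_(k, d)).

Definition rows a : set 'rV[R]_d := range (fun i => row i a).

Definition lexinc a : bool :=
  [forall i : 'I_k, forall j : 'I_k, (i < j)%N ==> lexlt (row i a) (row j a)].

Lemma lexincP a : reflect (forall i j : 'I_k, (i < j)%N -> lexlt (row i a) (row j a)) (lexinc a).
Proof.
apply: (iffP forallP) => h i; first by move=> j; have /forallP/(_ j)/implyP := h i.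
by apply/forallP => j; apply/implyP; exact: h.
Qed.

Lemma lexinc_inj a : lexinc a -> injective (fun i => row i a).
Proof.
move=> /lexincP h i j /= ij; apply: val_inj => /=.
by have [/h|/h|//] := ltngtP i j; rewrite ij lexltxx.
Qed.

Lemma finite_rows a : finite_set (rows a).
Proof. by apply: finite_image; exact: finite_finset. Qed.

Lemma sort_lexinc a : lexinc a ->
  sort lexle (fset_set (rows a)) = [seq row i a | i <- enum 'I_k].
Proof.
move=> ha; apply: (@sorted_eq _ lexle).
- exact: lexle_trans.
- exact: lexle_anti.
- by apply: sort_sorted; exact: lexle_total.
- rewrite sorted_map; apply: (@sub_sorted _ (relpre val ltn)).
    by move=> i j ij; have /lexincP/(_ i j ij)/andP[] := ha.
  by rewrite -sorted_map val_enum_ord iota_ltn_sorted.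
rewrite perm_sort; apply: uniq_perm.
- exact: fset_uniq.
- by rewrite map_inj_uniq ?enum_uniq//; exact: lexinc_inj.
move=> x; rewrite in_fset_set; last exact: finite_rows.
apply/idP/mapP => [/set_mem[i _ <-]|[i _ ->]]; first by exists i; rewrite ?mem_enum.
by apply/mem_set; exists i.
Qed.

Lemma lex_points_rows a : lexinc a -> lex_points k (rows a) = a.
Proof.
move=> ha; apply/row_matrixP => i; rewrite rowK sort_lexinc//.
by rewrite (nth_map i) ?nth_ord_enum// size_enum_ord.
Qed.

Lemma lexinc_rows_inj a b : lexinc a -> lexinc b -> rows a = rows b -> a = b.
Proof. by move=> /lex_points_rows {2}<- /lex_points_rows {2}<- ->. Qed.

Lemma size_sort_fset X : finite_set X -> (X #= `I_k)%card ->
  size (sort lexle (fset_set X)) = k.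
Proof. by move=> fX Xk; rewrite size_sort; exact: card_fset_set. Qed.

Lemma lexinc_lex_points X : finite_set X -> (X #= `I_k)%card -> lexinc (lex_points k X).
Proof.
move=> fX Xk; apply/lexincP => i j ij; rewrite !rowK.
have sz := size_sort_fset fX Xk.
apply/andP; split.
  apply: (sorted_leq_nth lexle_trans) => //; rewrite ?inE ?sz//; last exact: ltnW.
  - by move=> x; have := lexle_total x x; rewrite orbb.
  - by apply: sort_sorted; exact: lexle_total.
rewrite nth_uniq ?sz// ?sort_uniq ?fset_uniq//.
by rewrite neq_ltn ij.
Qed.

Lemma rows_lex_points X : finite_set X -> (X #= `I_k)%card -> rows (lex_points k X) = X.
Proof.
move=> fX Xk; have sz := size_sort_fset fX Xk.
have memX x : (x \in sort lexle (fset_set X)) = (x \in X) by rewrite mem_sort in_fset_set.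
apply/seteqP; split => [_ [i _ <-]|x Xx].
  by apply: set_mem; rewrite rowK -memX mem_nth// sz.
have xs : x \in sort lexle (fset_set X) by rewrite memX; exact: mem_set.
have ik : (index x (sort lexle (fset_set X)) < k)%N by rewrite -[X in (_ < X)%N]sz index_mem.
by exists (Ordinal ik) => //; rewrite rowK/= nth_index.
Qed.

Lemma lex_points_image (phi : 'rV[R]_d -> 'rV[R]_d) X : finite_set X -> phi 0 = 0 ->
  (forall x y, X x -> X y -> lexlt x y -> lexlt (phi x) (phi y)) ->
  forall i, row i (lex_points k (phi @` X)) = phi (row i (lex_points k X)).
Proof.
move=> fX phi0 h i; rewrite !rowK.
have -> : sort lexle (fset_set (phi @` X)) = map phi (sort lexle (fset_set X)).
  apply: (@sorted_eq _ lexle).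
  - exact: lexle_trans.
  - exact: lexle_anti.
  - by apply: sort_sorted; exact: lexle_total.
  - rewrite sorted_map; apply: (@sub_in_sorted _ (mem X) lexle).
    + move=> x y /set_mem Xx /set_mem Xy xy /=; have [->|xny] := eqVneq x y.
        by have := lexle_total (phi y) (phi y); rewrite orbb.
      by have /andP[] := h x y Xx Xy (introT andP (conj xy xny)).
    + by apply/allP => x; rewrite mem_sort in_fset_set.
    + by apply: sort_sorted; exact: lexle_total.
  rewrite perm_sort; apply: uniq_perm.
  - exact: fset_uniq.
  - rewrite map_inj_in_uniq ?sort_uniq ?fset_uniq// => x y.
    rewrite !mem_sort !in_fset_set// => /set_mem Xx /set_mem Xy xy; apply/eqP.
    apply/negPn/negP => /lexlt_total[] /h => [/(_ Xx Xy)|/(_ Xy Xx)];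
      by rewrite xy lexltxx.
  move=> y; rewrite in_fset_set; last exact: finite_image.
  apply/idP/mapP => [/set_mem[x Xx <-]|[x + ->]]; last first.
    by rewrite mem_sort in_fset_set// => /set_mem Xx; apply/mem_set; exists x.
  by exists x => //; rewrite mem_sort in_fset_set//; exact: mem_set.
have [ik|ik] := ltnP i (size (sort lexle (fset_set X))); first by rewrite (nth_map 0).
by rewrite !nth_default// size_map.
Qed.

Lemma near_lex_points_grid X : finite_set X ->
  \forall m \near \oo, lex_points k (grid m @` X) = grid m (lex_points k X).
Proof.
move=> fX.
have : \forall m \near \oo, forall p, (X `*` X) p -> lexlt p.1 p.2 -> lexlt (grid m p.1) (grid m p.2).
  apply: near_finite_set; first exact: finite_setX.
  move=> [x y] _ /=; have [/near_grid_lexlt|/negP xy] := boolP (lexlt x y).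
    by apply: filterS.
  by apply: nearW.
apply: filterS => m h; apply/row_matrixP => i; rewrite row_grid.
apply: lex_points_image => //; first exact: grid0.
by move=> x y Xx Xy; exact: (h (x, y)).
Qed.

Lemma grid_rows m a : grid m @` rows a = rows (grid m a).
Proof.
apply/seteqP; split => [_ [_ [i _ <-] <-]|_ [i _ <-]].
  by exists i => //; rewrite row_grid.
by exists (row i a); [exists i|rewrite row_grid].
Qed.

Lemma near_lexinc_grid a : \forall m \near \oo, lexinc (grid m a) = lexinc a.
Proof.
have h (p : 'I_k * 'I_k) : \forall m \near \oo,
    lexlt (row p.1 (grid m a)) (row p.2 (grid m a)) = lexlt (row p.1 a) (row p.2 a).
  set x := row p.1 a; set y := row p.2 a.
  have [xy|xy] := eqVneq x y.
    by apply: nearW => m; rewrite !row_grid -/x -/y xy !lexltxx.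
  have [/near_grid_lexlt|] := boolP (lexlt x y).
    by apply: filterS => m; rewrite !row_grid.
  rewrite lexltNge negbK => yx.
  have : lexlt y x by rewrite /lexlt yx eq_sym.
  move/near_grid_lexlt; apply: filterS => m; rewrite !row_grid lexltNge.
  by rewrite /lexlt => /negbTE ->.
have : \forall m \near \oo, forall p : 'I_k * 'I_k, setT p ->
    lexlt (row p.1 (grid m a)) (row p.2 (grid m a)) = lexlt (row p.1 a) (row p.2 a).
  by apply: near_finite_set => [|p _]; [exact: finite_finset|exact: h].
apply: filterS => m /= hm.
by apply/lexincP/lexincP => g i j ij; [rewrite -(hm (i, j) I)|rewrite (hm (i, j) I)]; exact: g.
Qed.

End lex_points.

Section cluster.
Context {R : realType} {d : nat}.
Implicit Types (x y : 'rV[R]_d) (X : set 'rV[R]_d).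
Local Notation N := (@enorm R d).

(* Rounding two points to the grid changes their distance by at most twice
   [d%:R / m.+1%:R]; with this radius the rounded graph contains the original one. *)
Definition grid_radius (m : nat) : R := 1 + 2 * (d%:R * m.+1%:R^-1).

Lemma enorm_grid m x : N (x - grid m x) <= d%:R * m.+1%:R^-1.
Proof.
apply: enorm_le_coord; first by rewrite invr_ge0.
by move=> j; rewrite mxE [X in _ + X]mxE; exact: grid_dist.
Qed.

Lemma grid_radius_ge1 m : 1 <= grid_radius m.
Proof. by rewrite lerDl !mulr_ge0// invr_ge0. Qed.

Lemma grid_radius_le m : grid_radius m <= 1 + 2 * d%:R.
Proof. by rewrite lerD2l ler_pM2l// ler_piMr// invf_le1 ?ler1n. Qed.

Lemma enorm_grid_le m x y : N (grid m x - grid m y) <= N (x - y) + 2 * (d%:R * m.+1%:R^-1).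
Proof.
apply: (le_trans (enorm_dist_triangle x _ _)); apply: (le_trans (lerD (lexx _) (enorm_dist_triangle y _ _))).
have := enorm_grid m x; have := enorm_grid m y; rewrite [N (grid m x - x)]enorm_distC.
by move: (_ * _^-1) (N _) (N _) (N _) => v p q r *; lra.
Qed.

Lemma enorm_le_grid m x y : N (x - y) <= N (grid m x - grid m y) + 2 * (d%:R * m.+1%:R^-1).
Proof.
apply: (le_trans (enorm_dist_triangle (grid m x) _ _));
    apply: (le_trans (lerD (lexx _) (enorm_dist_triangle (grid m y) _ _))).
have := enorm_grid m x; have := enorm_grid m y; rewrite [N (grid m y - y)]enorm_distC.
by move: (_ * _^-1) (N _) (N _) (N _) => v p q r *; lra.
Qed.

Lemma near_grid_edge x y : \forall m \near \oo,
  (N (grid m x - grid m y) <= grid_radius m) = (N (x - y) <= 1).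
Proof.
have [xy|xy] := leP (N (x - y)) 1.
  apply: nearW => m; apply: le_trans (enorm_grid_le m x y) _.
  by rewrite lerD2r.
have e0 : 0 < (N (x - y) - 1) / (4 * d.+1%:R) by rewrite divr_gt0 ?subr_gt0// mulr_gt0.
apply: filterS (near_infty_natSinv_lt (PosNum e0)) => m /=.
rewrite ltr_pdivlMr ?mulr_gt0// => h; apply/negbTE; rewrite -ltNge.
rewrite -(ltrD2r (2 * (d%:R * m.+1%:R^-1))); apply: lt_le_trans (enorm_le_grid m x y).
rewrite /grid_radius; apply: le_lt_trans (_ : 1 + m.+1%:R^-1 * (4 * d.+1%:R) < _); last by rewrite -ltrBrDl.
have m0 : 0 <= m.+1%:R^-1 :> R by rewrite invr_ge0.
rewrite -[d.+1%:R]natr1; move: m0; move: d%:R m.+1%:R^-1 => D v v0; nra.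
Qed.

Definition grid_edge m X x y : Prop :=
  [/\ (X `|` [set 0]) x, (X `|` [set 0]) y & N (grid m x - grid m y) <= grid_radius m].

Definition grid_cluster m X : set 'rV[R]_d :=
  [set y | clos_refl_trans _ (grid_edge m X) 0 y].

Lemma origin_cluster_sub X : origin_cluster X `<=` X `|` [set 0].
Proof.
move=> y; apply: clos_refl_trans_ind_set; last by right.
by move=> a b _ [].
Qed.

Lemma origin_cluster0 X : origin_cluster X 0.
Proof. exact: rt_refl. Qed.

Lemma origin_cluster_closed X x y : origin_cluster X x -> X y -> N (x - y) <= 1 ->
  origin_cluster X y.
Proof.
move=> Cx Xy xy; have [<-//|xny] := pselect (x = y).
have X0x := origin_cluster_sub Cx.
by apply: rt_trans Cx _; apply: rt_step; split => //; left.
Qed.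

Lemma origin_cluster_sub_grid m X : origin_cluster X `<=` grid_cluster m X.
Proof.
move=> y; apply: clos_refl_trans_ind_set; last exact: rt_refl.
move=> a b Ca [Xa Xb _ ab]; apply: rt_trans Ca _; apply: rt_step; split => //.
by apply: le_trans (enorm_grid_le m a b) _; rewrite lerD2r.
Qed.

Lemma near_grid_cluster X : locally_finite X -> finite_set (origin_cluster X) ->
  \forall m \near \oo, grid_cluster m X = origin_cluster X.
Proof.
move=> lX fC; set C := origin_cluster X in fC *.
have [B hB] : exists B : R, forall x, C x -> N x <= B.
  have /finite_fsetP[S CS] := fC.
  exists (\sum_(x <- S) N x) => x; rewrite CS/= => xS.
  by rewrite (big_fsetD1 x)//= lerDl sumr_ge0// => *; exact: enorm_ge0.
pose K := X `&` eball 0 (B + (1 + 4 * d%:R)).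
have fK : finite_set K by exact: lX.
have : \forall m \near \oo, forall p, (C `*` K) p ->
    (N (grid m p.1 - grid m p.2) <= grid_radius m) = (N (p.1 - p.2) <= 1).
  by apply: near_finite_set; [exact: finite_setX|move=> p _; exact: near_grid_edge].
apply: filterS => m hm; apply/seteqP; split; last exact: origin_cluster_sub_grid.
move=> y; apply: clos_refl_trans_ind_set; last exact: origin_cluster0.
move=> a b Ca [_ [Xb|->] ab]; last exact: origin_cluster0.
apply: (origin_cluster_closed Ca Xb); rewrite -(hm (a, b))//; split => //; split => //.
rewrite /eball/= subr0 -[b](subrK a) addrC; apply: le_trans (enorm_triangle _ _) _.
apply: lerD; first exact: hB.
rewrite enorm_distC; apply: le_trans (enorm_le_grid m a b) _.
apply: le_trans (lerD ab (lexx _)) _; apply: le_trans (lerD (grid_radius_le m) (lexx _)) _.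
have : d%:R * m.+1%:R^-1 <= d%:R :> R by rewrite ler_piMr// invf_le1 ?ler1n.
by move: (_ * _^-1) => v; lra.
Qed.

End cluster.

Section pattern.
Context {R : realType} {d k : nat}.
Implicit Types (x y : 'rV[R]_d) (X : set 'rV[R]_d) (a : 'M[R]_(k, d)).
Local Notation N := (@enorm R d).

Definition vconnected a (r : R) : bool :=
  [forall i, connect (fun u v => N (vertex a u - vertex a v) <= r) None (Some i)].

(* The origin is a vertex of the graph whether or not X contains it: it is left
   out of the cells and of the gap. *)
Definition grid_cell m a (i : 'I_k) : set 'rV[R]_d := [set x | grid m x = row i a] `\ 0.

Definition grid_union m a : set 'rV[R]_d :=
  [set x | exists v, N (grid m x - vertex a v) <= @grid_radius R d m].

Definition grid_gap m a : set 'rV[R]_d :=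
  (grid_union m a `\` \bigcup_(i in [set: 'I_k]) [set x | grid m x = row i a]) `\ 0.

(* When [a] is connected, these point counts in disjoint sets force the cluster of
   the rounded graph to consist of the origin and one point in each cell. *)
Definition pattern m X a : Prop :=
  (forall i, exists x, X `&` grid_cell m a i = [set x]) /\ X `&` grid_gap m a = set0.

Lemma pattern_cluster m X a : vconnected a (@grid_radius R d m) -> pattern m X a ->
  grid_cluster m X `\ 0 = X `&` \bigcup_(i in [set: 'I_k]) grid_cell m a i.
Proof.
move=> ca [h1 h2].
have cellX i x : X x -> grid_cell m a i x -> forall y, X y -> grid_cell m a i y -> x = y.
  move=> Xx cx y Xy cy; have [z Ez] := h1 i.
  by have : [set z] x; [rewrite -Ez|have : [set z] y; [rewrite -Ez|move=> -> ->]].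
apply/seteqP; split => [y [Cy y0]|x [Xx [i _ cx]]].
  have : [set y | y = 0 \/ (X `&` \bigcup_(i in [set: 'I_k]) grid_cell m a i) y] y.
    move: Cy; apply: clos_refl_trans_ind_set; last by left.
    move=> u v Su [_ Xv uv].
    have [->|v0] := pselect (v = 0); [by left|right].
    have {}Xv : X v by case: Xv.
    split => //.
    have gv : grid_union m a v.
      case: Su uv => [->|[_ [i _ [gi _]]]]; rewrite enorm_distC.
        by rewrite grid0 => ?; exists None.
      by rewrite gi => ?; exists (Some i).
    apply: contrapT => ncell.
    have : (X `&` grid_gap m a) v; last by rewrite h2.
    split => //; split => //; split => // -[i _ gi]; apply: ncell.
    by exists i.
  by case.
split; last by case: cx.
have /forallP/(_ i)/connectP[p pp pl] := ca.
have [pnt hp] : exists pnt : option 'I_k -> 'rV[R]_d,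
    pnt None = 0 /\ forall j, X (pnt (Some j)) /\ grid_cell m a j (pnt (Some j)).
  pose f j := projT1 (cid (h1 j)).
  exists (fun v => if v is Some j then f j else 0); split => // j.
  rewrite /f; case: cid => z /= Ez; have : [set z] z by [].
  by rewrite -Ez.
have gp v : grid m (pnt v) = vertex a v.
  by case: v => [j|]; [case: (hp.2 j) => _ []|rewrite hp.1 grid0].
have Xp v : (X `|` [set 0]) (pnt v).
  by case: v => [j|]; [left; case: (hp.2 j)|right; rewrite hp.1].
have : grid_cluster m X (pnt (last None p)).
  have : grid_cluster m X (pnt None) by rewrite hp.1; exact: rt_refl.
  elim: p None pp {pl} => [//|v p IH] u /= /andP[uv pp] Cu.
  apply: IH => //; apply: rt_trans Cu _; apply: rt_step; split => //.
  by rewrite !gp.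
rewrite -pl => h; have [Xi ci] := hp.2 i.
by rewrite (cellX i x Xx cx _ Xi ci).
Qed.

Lemma pattern_rows m X a : vconnected a (@grid_radius R d m) -> pattern m X a ->
  rows a = grid m @` (grid_cluster m X `\ 0).
Proof.
move=> ca pa; rewrite (pattern_cluster ca pa); case: (pa) => h1 _.
apply/seteqP; split => [_ [i _ <-]|_ [x [Xx [i _ [xi _]]] <-]]; last first.
  by exists i => //; rewrite -xi.
have [z Ez] := h1 i; have : [set z] z by [].
by rewrite -Ez => -[Xz cz]; exists z; [split => //; exists i|case: cz].
Qed.

Lemma pattern_unique m X a b : lexinc a -> vconnected a (@grid_radius R d m) -> pattern m X a ->
  lexinc b -> vconnected b (@grid_radius R d m) -> pattern m X b -> a = b.
Proof.
move=> la ca pa lb cb pb; apply: lexinc_rows_inj => //.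
by rewrite (pattern_rows ca pa) (pattern_rows cb pb).
Qed.

Lemma card_eqS (T : choiceType) (S : set T) (x : T) (n : nat) :
  S x -> (S `\ x #= `I_n)%card <-> (S #= `I_n.+1)%card.
Proof.
move=> Sx; split => [h|].
  by apply/eq_cardSP; exists x.
move=> h; have fS : finite_set S by exists n.+1.
have fD : finite_set (S `\ x) by exact: finite_setD.
have [p hp] := fD.
suff <- : p = n by [].
have h' : (S #= `I_p.+1)%card by apply/eq_cardSP; exists x.
have := card_fset_set h; rewrite (card_fset_set h') => -[].
by [].
Qed.

Lemma pattern_card m X a : lexinc a -> vconnected a (@grid_radius R d m) -> pattern m X a ->
  (grid_cluster m X #= `I_k.+1)%card.
Proof.
move=> la ca pa; apply/card_eqS; first exact: rt_refl.
have [h1 _] := pa; rewrite (pattern_cluster ca pa).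
pose f j := projT1 (cid (h1 j)).
have hf j : X (f j) /\ grid_cell m a j (f j).
  by rewrite /f; case: cid => z /= Ez; have : [set z] z by []; rewrite -Ez.
have -> : X `&` \bigcup_(i in [set: 'I_k]) grid_cell m a i = f @` [set: 'I_k].
  apply/seteqP; split => [x [Xx [i _ cx]]|_ [i _ <-]]; last first.
    by have [Xi ci] := hf i; split => //; exists i.
  exists i => //; rewrite /f; case: cid => z /= Ez.
  by have : [set z] x by rewrite -Ez.
have fi : injective f.
  move=> i j ij; apply: (lexinc_inj la).
  by have [_ [<- _]] := hf i; have [_ [<- _]] := hf j; rewrite ij.
exact: card_range_ord fi.
Qed.

Lemma near_no_pattern X : locally_finite X -> ~ (origin_cluster X #= `I_k.+1)%card ->
  \forall m \near \oo, forall a, lexinc a -> vconnected a (@grid_radius R d m) -> ~ pattern m X a.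
Proof.
move=> lX nC; have [fC|iC] := pselect (finite_set (origin_cluster X)).
  apply: filterS (near_grid_cluster lX fC) => m E a la ca pa; apply: nC.
  by rewrite -E; exact: pattern_card pa.
apply: nearW => m a la ca pa; apply: iC.
apply: sub_finite_set (@origin_cluster_sub_grid _ _ m X) _.
by exists k.+1; exact: pattern_card pa.
Qed.

Lemma near_pattern X : locally_finite X -> (origin_cluster X #= `I_k.+1)%card ->
  let L := lex_points k (origin_cluster X `\ 0) in
  [/\ lexinc L, vconnected L 1 &
  \forall m \near \oo, [/\ lexinc (grid m L), vconnected (grid m L) (@grid_radius R d m) &
    pattern m X (grid m L)]].
Proof.
move=> lX cC L.
have fC : finite_set (origin_cluster X) by exists k.+1.
have fD : finite_set (origin_cluster X `\ 0) by exact: finite_setD.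
have cD : (origin_cluster X `\ 0 #= `I_k)%card.
  by apply/card_eqS => //; exact: origin_cluster0.
have lL : lexinc L by exact: lexinc_lex_points.
have rL : rows L = origin_cluster X `\ 0 by exact: rows_lex_points.
have CL x : origin_cluster X x -> exists v, x = vertex L v.
  move=> Cx; have [->|x0] := pselect (x = 0); first by exists None.
  have : rows L x by rewrite rL.
  by move=> [i _ <-]; exists (Some i).
have LC v : origin_cluster X (vertex L v).
  case: v => [i|]; last exact: origin_cluster0.
  have : rows L (row i L) by exists i.
  by rewrite rL => -[].
have Xrow i : X (row i L) /\ row i L <> 0.
  have : rows L (row i L) by exists i.
  by rewrite rL => -[Ci ni]; split => //; case: (origin_cluster_sub Ci).
have cL : vconnected L 1.
  apply/forallP => i; have := LC (Some i).
  pose S := [set x | origin_cluster X x /\ forall v, x = vertex L v ->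
      connect (fun u v => N (vertex L u - vertex L v) <= 1) None v].
  suff h x : origin_cluster X x -> S x by move/h => -[_]; exact.
  apply: clos_refl_trans_ind_set; last first.
    split; first exact: origin_cluster0.
    case=> [j /= r0|_]; last exact: connect0.
    by have [_] := Xrow j; rewrite -r0.
  move=> u v [Cu hu] [Xu Xv _ uv]; split.
    by case: Xv => [Xv|->]; [exact: origin_cluster_closed Cu Xv uv|exact: origin_cluster0].
  move=> w vw; have [u' uu'] := CL u Cu.
  apply: connect_trans (hu u' uu') _; apply: connect1.
  by rewrite -uu' -vw.
split => //.
have vg m v : vertex (grid m L) v = grid m (vertex L v).
  by case: v => [i|] /=; rewrite ?row_grid ?grid0.
have : \forall m \near \oo, grid_cluster m X = origin_cluster X /\ lexinc (grid m L) = lexinc L.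
  by apply: filterI; [exact: near_grid_cluster|exact: near_lexinc_grid].
apply: filterS => m [E lg]; have {}lg : lexinc (grid m L) by rewrite lg.
have inC x v : X x -> x <> 0 -> N (grid m x - vertex (grid m L) v) <= @grid_radius R d m -> rows L x.
  move=> Xx x0 xv; rewrite rL; split => //; rewrite -E.
  have := LC v; rewrite -E => Cv; apply: rt_trans Cv _; apply: rt_step; split => //.
  - by have := LC v => /origin_cluster_sub.
  - by left.
  - by rewrite -vg enorm_distC.
split => //.
  apply/forallP => i; have /forallP/(_ i) := cL; apply: connect_sub => u v uv.
  apply: connect1; rewrite !vg; apply: le_trans (enorm_grid_le m _ _) _.
  by rewrite lerD2r.
split => [i|].
  exists (row i L); apply/seteqP; split => [x [Xx [gx x0]]|_ ->]; last first.
    by have [Xi i0] := Xrow i; split => //; split => //=; rewrite row_grid.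
  have : rows L x.
    apply: (inC x (Some i)) => //=; rewrite gx subrr enorm0.
    exact: le_trans (grid_radius_ge1 m).
  move=> [j _ jx]; have jE : j = i by apply: (lexinc_inj lg); rewrite /= -gx row_grid jx.
  by rewrite -jx jE.
rewrite -subset0 => x [Xx [[[v xv] nx] x0]]; apply: nx.
have [j _ jx] := inC x v Xx x0 xv.
by exists j => //=; rewrite row_grid jx.
Qed.

End pattern.

(** * The law of the cluster *)

Section discrete_integral.
Context {dT} {T : measurableType dT} {R : realType} {C : countType}.
Variables (u : T -> R) (F : C -> set T) (h : C -> R).
Hypotheses (mF : forall c, measurable (F c))
  (dF : forall c c' w, F c w -> F c' w -> c = c')
  (uF : forall c w, F c w -> u w = h c)
  (u0 : forall w, (forall c, ~ F c w) -> u w = 0).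

Lemma bigcup_countable_measurable (G : C -> set T) :
  (forall c, measurable (G c)) -> measurable (\bigcup_c G c).
Proof.
move=> mG; rewrite (_ : \bigcup_c G c =
  \bigcup_n (if choice.pickle_inv n is Some c then G c else set0)).
  by apply: bigcupT_measurable => n; case: choice.pickle_inv.
apply/seteqP; split => [w [c _ Gw]|w [n _]].
  by exists (choice.pickle c) => //; rewrite choice.pickleK_inv.
by case: choice.pickle_inv => // c Gw; exists c.
Qed.

Lemma measurable_discrete : measurable_fun setT u.
Proof.
move=> _ B mB; rewrite setTI.
rewrite (_ : u @^-1` B = (\bigcup_c (if `[< B (h c) >] then F c else set0)) `|`
    (if `[< B 0 >] then ~` (\bigcup_c F c) else set0)).
  apply: measurableU; first by apply: bigcup_countable_measurable => c; case: asboolP.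
  by case: asboolP => // _; apply: measurableC; exact: bigcup_countable_measurable.
apply/seteqP; split => w /=.
  move=> Bw; have [[c Fc]|/forallNP nF] := pselect (exists c, F c w).
    by left; exists c => //; rewrite asboolT// -(uF Fc).
  by right; rewrite asboolT; [move=> [c _]; exact: nF|rewrite -(u0 nF)].
move=> [[c _]|].
  by case: asboolP => // Bc Fc; rewrite (uF Fc).
by case: asboolP => // B0 nF; rewrite u0// => c Fc; apply: nF; exists c.
Qed.

Lemma integral_discrete (mu : {measure set T -> \bar R}) : (forall c, 0 <= h c) ->
  (\int[mu]_w (u w)%:E =
   \sum_(n <oo) (if choice.pickle_inv n is Some c then (h c)%:E * mu (F c) else 0))%E.
Proof.
move=> h0.
have uge0 w : 0 <= u w.
  have [[c Fc]|/forallNP/u0 ->//] := pselect (exists c, F c w).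
  by rewrite (uF Fc).
pose G n := if @choice.pickle_inv C n is Some c then F c else set0.
have mG n : measurable (G n) by rewrite /G; case: choice.pickle_inv.
have tG : trivIset setT G.
  apply/trivIsetP => i j _ _ ij; rewrite -subset0 => w []; rewrite /G.
  case Ei : (choice.pickle_inv i) => [c|//]; case Ej : (choice.pickle_inv j) => [c'|//].
  move=> Fc Fc'; have E := dF Fc Fc'; move/eqP : ij; apply.
  have := @choice.pickle_invK C i; have := @choice.pickle_invK C j.
  by rewrite Ei Ej /= E => -> ->.
transitivity (\int[mu]_(w in \bigcup_n G n) (u w)%:E)%E.
  rewrite [RHS]integral_mkcond; apply: eq_integral => w _.
  rewrite patchE; case: ifPn => // /negP nG.
  rewrite u0// => c Fc; apply: nG; apply/mem_set; exists (choice.pickle c) => //.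
  by rewrite /G choice.pickleK_inv.
rewrite ge0_integral_bigcup//; last first.
  by move=> w _; rewrite lee_fin.
  by apply/measurable_EFinP; apply: measurable_funTS; exact: measurable_discrete.
apply: eq_eseriesr => n _; rewrite /G; case: choice.pickle_inv => [c|]; last by rewrite integral_set0.
rewrite -integral_cst//; apply: eq_integral => w /set_mem Fc.
by rewrite (uF Fc).
Qed.

End discrete_integral.

Section convergence.
Context {dT} {T : measurableType dT} {R : realType} (mu : {measure set T -> \bar R}).

Lemma bounded_convergence (u : nat -> T -> R) (v g : T -> R) :
  (forall n, measurable_fun setT (u n)) -> (forall x, u n x @[n --> \oo] --> v x) ->
  (forall n x, 0 <= u n x <= g x) -> measurable_fun setT g ->
  (\int[mu]_x (g x)%:E < +oo)%E ->
  [/\ measurable_fun setT v, (forall x, 0 <= v x), (\int[mu]_x (v x)%:E < +oo)%E &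
  (\int[mu]_x (u n x)%:E @[n --> \oo] --> \int[mu]_x (v x)%:E)%E].
Proof.
move=> mu_ uv ug mg ig.
have g0 x : 0 <= g x by have /andP[h1 h2] := ug 0 x; exact: le_trans h2.
have mv : measurable_fun setT v by apply: (measurable_fun_cvg mu_) => x _; exact: uv.
have ig' : mu.-integrable setT (EFin \o g).
  apply/integrableP; split; first exact/measurable_EFinP.
  by under eq_integral do rewrite /= ger0_norm//.
have v0 x : 0 <= v x.
  rewrite -(cvg_lim _ (uv x))//; apply: limr_ge; first by apply/cvg_ex; exists (v x); exact: uv.
  by apply: nearW => n; have /andP[] := ug n x.
have [iv _ h] : [/\ mu.-integrable setT (EFin \o v),
  [sequence \int[mu]_x `|(u n x)%:E - (v x)%:E|]_n @ \oo --> 0 &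
  [sequence \int[mu]_x (u n x)%:E]_n @ \oo --> \int[mu]_x (v x)%:E]%E.
  apply: (@dominated_convergence _ T R mu setT measurableT (fun n => EFin \o u n) (EFin \o v) (EFin \o g)) => //.
  - by move=> n; exact/measurable_EFinP.
  - exact/measurable_EFinP.
  - by apply: aeW => x _; apply: cvg_EFin; [exact: nearW|exact: uv].
  - by apply: aeW => x n _ /=; rewrite lee_fin; have /andP[h1 h2] := ug n x; rewrite ger0_norm.
split => //.
have /integrableP[_] := iv.
by under eq_integral do rewrite /= ger0_norm//.
Qed.

End convergence.

Lemma cvg_grid {R : realType} {p q : nat} (x : 'M[R]_(p, q)) : grid m x @[m --> \oo] --> x.
Proof.
apply/cvgrPdist_lt => e e0.
apply: filterS (near_infty_natSinv_lt (PosNum e0)) => m /= me.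
rewrite /Num.norm/= mx_normrE.
apply/bigmax_ltP; split => // -[i j] _; rewrite mxE [X in _ + X]mxE.
exact: le_lt_trans (grid_dist m x i j) me.
Qed.

Section grid_measure.
Context {R : realType} {d : nat}.
Local Notation N := (@enorm R d).
Local Notation vol := (@lebesgue_mx R 1 d).

Lemma measurable_grid_fun {p q : nat} {dT} {T : measurableType dT} m (g : 'M[R]_(p, q) -> T) :
  measurable_fun setT (fun x => g (grid m x)).
Proof.
move=> _ B mB; rewrite setTI.
rewrite (_ : _ @^-1` B = \bigcup_(c : 'M[int]_(p, q))
   (if `[< B (g (gridpt m c)) >] then [set x | grid m x = gridpt m c] else set0)).
  by apply: bigcup_countable_measurable => c; case: asboolP => // _; exact: grid_preimage_measurable.
apply/seteqP; split => x /=.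
  by move=> Bx; exists (map_mx (fun t => Num.floor (m.+1%:R * t)) x) => //; rewrite asboolT -?gridE.
by move=> [c _]; case: asboolP => // Bc /= ->.
Qed.

Lemma measurable_grid_set {p q : nat} m (Q : set 'M[R]_(p, q)) : measurable [set x | Q (grid m x)].
Proof.
have := @measurable_grid_fun p q _ bool m (fun x => `[< Q x >]) measurableT [set true] I.
rewrite setTI (_ : _ @^-1` _ = [set x | Q (grid m x)])//.
by apply/seteqP; split => x /=; [move/asboolP|move/asboolP].
Qed.

Lemma lebesgue_grid_cell {p q : nat} m (c : 'M[int]_(p, q)) :
  lebesgue_mx p q [set x | grid m x = @gridpt R m p q c] = (m.+1%:R ^- (p * q))%:E.
Proof.
rewrite grid_preimage lebesgue_mx_box; last by move=> i j; rewrite !mxE ler_pM2r// ler_int lerDl.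
congr EFin; rewrite (eq_bigr (fun=> m.+1%:R ^- q)).
  by rewrite prodr_const card_ord exprVn -exprM mulnC.
move=> i _; rewrite (eq_bigr (fun=> m.+1%:R^-1)) ?prodr_const ?card_ord ?exprVn//.
by move=> j _; rewrite !mxE -mulrBl intrD addrAC subrr add0r mul1r.
Qed.

Lemma lebesgue_setD0 (A : set 'rV[R]_d) : (0 < d)%N -> measurable A -> vol (A `\ 0) = vol A.
Proof.
move=> d0 mA; have m0 : measurable [set (0 : 'rV[R]_d)] by rewrite -eball00; exact: measurable_eball.
apply/eqP; rewrite eq_le; apply/andP; split.
  by apply: measure_le => //; exact: measurableD.
apply: (@le_trans _ _ (vol ((A `\ 0) `|` [set 0]))).
  apply: measure_le => //; first by apply: measurableU => //; exact: measurableD.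
  by move=> x Ax; have [->|x0] := pselect (x = 0); [right|left].
apply: le_trans (measureU2 _ _ _) _ => //; first exact: measurableD.
by rewrite -[X in (_ + X <= _)%E]/(vol [set 0]) (lebesgue_rV0 d0) adde0.
Qed.

End grid_measure.

Section grid_pattern_measure.
Context {R : realType} {d k : nat}.
Hypothesis d0 : (0 < d)%N.
Local Notation N := (@enorm R d).
Local Notation vol := (@lebesgue_mx R 1 d).
Implicit Types (a y : 'M[R]_(k, d)).

Lemma grid_union_sub m a : grid_union m a `<=` eball 0 (rows_norm a + (1 + 3 * d%:R)).
Proof.
move=> x [v xv]; rewrite /eball/= subr0 -[x](subrK (vertex a v)) addrC.
apply: le_trans (enorm_triangle _ _) _; apply: lerD; first exact: enorm_vertex_le.
apply: le_trans (enorm_dist_triangle (grid m x) _ _) _.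
apply: le_trans (lerD (enorm_grid m x) (le_trans xv (@grid_radius_le R d m))) _.
have : d%:R * m.+1%:R^-1 <= d%:R :> R by rewrite ler_piMr// invf_le1 ?ler1n.
by move: (_ * _^-1) => v'; lra.
Qed.

Lemma measurable_grid_union m a : measurable (grid_union m a).
Proof.
pose Q : set 'rV[R]_d := [set x | exists v, N (x - vertex a v) <= @grid_radius R d m].
have := @measurable_grid_set R 1 d m Q; exact.
Qed.

Lemma vol_grid_union_lty m a : (vol (grid_union m a) < +oo)%E.
Proof.
apply: le_lt_trans (lebesgue_eball_lty 0 (rows_norm a + (1 + 3 * d%:R))).
by apply: measure_le; [exact: measurable_grid_union|exact: measurable_eball|exact: grid_union_sub].
Qed.

Lemma measurable_rV0 : measurable [set (0 : 'rV[R]_d)].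
Proof. by rewrite -eball00; exact: measurable_eball. Qed.

Lemma measurable_grid_cell m a i : measurable (grid_cell m a i).
Proof. by apply: measurableD; [exact: grid_preimage_measurable|exact: measurable_rV0]. Qed.

Lemma measurable_grid_cells m a :
  measurable (\bigcup_(i in [set: 'I_k]) [set x | grid m x = row i a]).
Proof.
by apply: fin_bigcup_measurable => [|i _]; [exact: finite_finset|exact: grid_preimage_measurable].
Qed.

Lemma measurable_grid_gap m a : measurable (grid_gap m a).
Proof.
apply: measurableD; last exact: measurable_rV0.
by apply: measurableD; [exact: measurable_grid_union|exact: measurable_grid_cells].
Qed.

Lemma vol_grid_cell m (c : 'M[int]_(k, d)) i :
  vol (grid_cell m (gridpt m c) i) = (m.+1%:R ^- d)%:E.
Proof.
rewrite lebesgue_setD0//; last exact: grid_preimage_measurable.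
rewrite (_ : row i (gridpt m c) = gridpt m (row i c)); last by apply/rowP => j; rewrite !mxE.
by rewrite lebesgue_grid_cell mul1n.
Qed.

Lemma lexinc_trivIset m a : lexinc a ->
  trivIset setT (fun i => [set x : 'rV[R]_d | grid m x = row i a]).
Proof.
move=> la; apply/trivIsetP => i j _ _ ij; rewrite -subset0 => x [/= -> E].
by move/eqP : ij; apply; exact: (lexinc_inj la).
Qed.

Lemma fine_vol_grid_gap m (c : 'M[int]_(k, d)) : lexinc (@gridpt R m k d c) ->
  fine (vol (grid_gap m (gridpt m c))) =
  fine (vol (grid_union m (gridpt m c))) - k%:R * m.+1%:R ^- d.
Proof.
move=> lc; set a := gridpt m c in lc *.
have mU := measurable_grid_union m a; have mC := measurable_grid_cells m a.
have CU : \bigcup_(i in [set: 'I_k]) [set x | grid m x = row i a] `<=` grid_union m a.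
  move=> x [i _ /= xi]; exists (Some i); rewrite /= xi subrr enorm0.
  exact: le_trans (@grid_radius_ge1 R d m).
rewrite /grid_gap lebesgue_setD0//; last exact: measurableD.
have vC : vol (\bigcup_(i in [set: 'I_k]) [set x | grid m x = row i a]) = (k%:R * m.+1%:R ^- d)%:E.
  have vi i : vol [set x | grid m x = row i a] = (m.+1%:R ^- d)%:E.
    rewrite (_ : row i a = gridpt m (row i c)); last by apply/rowP => j; rewrite !mxE.
    by rewrite lebesgue_grid_cell mul1n.
  have E : [set: 'I_k] = [set` enum 'I_k] by apply/seteqP; split => i //= _; rewrite mem_enum.
  have := mC; rewrite E bigcup_seq big_enum/= => mC'.
  rewrite [LHS]measure_semi_additive_ord//; last 2 first.
  - by move=> i; exact: grid_preimage_measurable.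
  - exact: lexinc_trivIset.
  rewrite (eq_bigr (fun=> (m.+1%:R ^- d)%:E)).
    by rewrite sumEFin sumr_const card_ord -[_ *+ k]mulr_natl.
  by move=> i _; exact: vi.
rewrite measureD//; last exact: vol_grid_union_lty.
have fU : vol (grid_union m a) \is a fin_num by rewrite ge0_fin_numE// vol_grid_union_lty.
rewrite setIidr// -[X in (_ - X)%E]/(vol _) vC fineB//.
Qed.

Lemma cvg_grid_union y : fine (vol (grid_union m (grid m y))) @[m --> \oo] --> fine (vol (ball_union y)).
Proof.
pose W : set 'rV[R]_d := eball 0 (rows_norm y + k%:R * d%:R + (1 + 3 * d%:R)).
have mW : measurable W by exact: measurable_eball.
have sW m : grid_union m (grid m y) `<=` W.
  move=> x /grid_union_sub; rewrite /W /eball/= => h; apply: le_trans h _; rewrite lerD2r.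
  rewrite /rows_norm -[k in k%:R]card_ord -sumr_const mulr_suml -big_split/=.
  apply: ler_sum => i _; rewrite mul1r row_grid -[grid m _](subrK (row i y)) addrC.
  apply: le_trans (enorm_triangle _ _) _; rewrite lerD2r enorm_distC.
  apply: le_trans (enorm_grid m _) _.
  by rewrite ler_piMr// invf_le1 ?ler1n.
have := @bounded_convergence _ _ R vol
   (fun m => \1_(grid_union m (grid m y))) (\1_(ball_union y)) (\1_W)
   (fun m => measurable_indic (measurable_grid_union m (grid m y))) _ _ (measurable_indic mW) _.
case.
- move=> x; apply: cvg_near_cst.
  have : \forall m \near \oo, forall v : option 'I_k, setT v ->
     (N (grid m x - grid m (vertex y v)) <= @grid_radius R d m) = (N (x - vertex y v) <= 1).
    by apply: near_finite_set => [|v _]; [exact: finite_finset|exact: near_grid_edge].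
  apply: filterS => m h; rewrite !indicE; congr (nat_of_bool _)%:R.
  have vg v : vertex (grid m y) v = grid m (vertex y v).
    by case: v => [i|] /=; rewrite ?row_grid ?grid0.
  apply/idP/idP => /set_mem[v xv]; apply/mem_set; exists v.
    by rewrite -(h v I) -vg.
  by rewrite vg (h v I).
- move=> m x; rewrite !indicE ler0n/= ler_nat.
  by case: (boolP (x \in grid_union m (grid m y))) => [/set_mem/sW/mem_set ->|].
- by rewrite integral_indic// setIT lebesgue_eball_lty.
move=> _ _ _; rewrite integral_indic//; last exact: measurable_ball_union.
rewrite (_ : (fun n => _) = (fun m => vol (grid_union m (grid m y)))); last first.
  by apply/funext => m; rewrite integral_indic ?setIT//; exact: measurable_grid_union.
rewrite setIT => h; apply: fine_cvg.
by rewrite fineK// ge0_fin_numE// vol_ball_union_lty.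
Qed.

Lemma connect_vertex_norm a r : 0 <= r -> vconnected a r ->
  forall i, N (row i a) <= k%:R * r.
Proof.
move=> r0 /forallP h i; have /connectP[p pp pl] := h i.
case: (shortenP pp) pl => q pq uq _ ql.
have -> : row i a = vertex a (last None q) by rewrite -ql.
have sq : (size q <= k)%N.
  rewrite -ltnS -[(size q).+1]/(size (None :: q)) -(card_uniqP uq).
  by apply: leq_trans (max_card _) _; rewrite card_option card_ord.
apply: (@le_trans _ _ ((size q)%:R * r)); last by rewrite ler_wpM2r// ler_nat.
have : N (vertex a (last None q) - vertex a None) <= (size q)%:R * r.
  elim: q {uq ql sq} None pq => [|v q IH] u /=; first by rewrite subrr enorm0 mul0r.
  move=> /andP[uv pq]; apply: le_trans (enorm_dist_triangle (vertex a v) _ _) _.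
  by rewrite -natr1 mulrDl mul1r lerD// ?IH// enorm_distC.
by rewrite subr0.
Qed.

End grid_pattern_measure.

Lemma counting1P {T : choiceType} {R : realType} (A : set T) :
  counting A = 1%:R%:E :> \bar R <-> exists x, A = [set x].
Proof.
rewrite /counting; split.
  case: asboolP => // fA [/eqP]; rewrite eqr_nat => /cardfs1P[x E].
  by exists x; rewrite -(fset_setK fA) E set_fset1.
move=> [x ->]; rewrite asboolT; last exact: finite_set1.
by rewrite fset_set1 cardfs1.
Qed.

Lemma counting0P {T : choiceType} {R : realType} (A : set T) :
  counting A = 0%:R%:E :> \bar R <-> A = set0.
Proof.
rewrite /counting; split.
  case: asboolP => // fA [/eqP]; rewrite eqr_nat cardfs_eq0 => /eqP E.
  by rewrite -(fset_setK fA) E; apply/seteqP; split => y //=; rewrite inE.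
by move=> ->; rewrite asboolT; [rewrite fset_set0 cardfs0|exact: finite_set0].
Qed.

Lemma poisson_prob_set1 {R : realType} (r : R) (n : nat) : 0 <= r ->
  poisson_prob r 0 [set n] = (r ^+ n / n`!%:R * expR (- r))%:E.
Proof.
move=> r0; rewrite /poisson_prob; case: ltP => [rp|r0'].
  by rewrite esum_set1 /poisson_pmf rp// lee_fin !mulr_ge0 ?invr_ge0 ?exprn_ge0 ?expR_ge0.
have -> : r = 0 by apply/eqP; rewrite eq_le r0 r0'.
rewrite oppr0 expR0 mulr1 diracE expr0n; case: n => [|n] /=.
  by rewrite mem_set// fact0 divr1.
by rewrite mul0r memNset.
Qed.

Section poisson_cluster.
Context {R : realType} {d k : nat} {dO : measure_display} {Omega : measurableType dO}
  (P : probability Omega R) (lam : R) (H : Omega -> set 'rV[R]_d).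
Hypotheses (d0 : (0 < d)%N) (lam0 : 0 < lam) (HP : poisson_process P lam H).
Local Notation N := (@enorm R d).
Local Notation vol := (@lebesgue_mx R 1 d).
Implicit Types (a y : 'M[R]_(k, d)) (c : 'M[int]_(k, d)).

Definition pattern_set m a (i : 'I_k.+1) : set 'rV[R]_d :=
  if unlift ord0 i is Some j then grid_cell m a j else grid_gap m a.

(* The coercions read 0 for the gap, at index [ord0], and 1 for a cell. *)
Definition pattern_count (i : 'I_k.+1) : nat := unlift ord0 i.

Lemma pattern_countE m a w : pattern m (H w) a <->
  forall i, counting (H w `&` pattern_set m a i) = (pattern_count i)%:R%:E :> \bar R.
Proof.
split=> [[h1 h2] i|h]; rewrite /pattern_set /pattern_count.
  by case: unliftP => [j _|_] /=; [apply/counting1P; exact: h1|apply/counting0P; exact: h2].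
split=> [j|].
  have := h (lift ord0 j); rewrite /pattern_set /pattern_count liftK/= => /counting1P; exact.
have := h ord0; rewrite /pattern_set /pattern_count unlift_none/= => /counting0P; exact.
Qed.

Lemma measurable_pattern_set m a i : measurable (pattern_set m a i).
Proof.
by rewrite /pattern_set; case: unlift => [j|]; [exact: measurable_grid_cell|exact: measurable_grid_gap].
Qed.

Lemma measurable_pattern m a : measurable [set w | pattern m (H w) a].
Proof.
rewrite (_ : mkset _ = \bigcap_(i in [set: 'I_k.+1])
    [set w | counting (H w `&` pattern_set m a i) = (pattern_count i)%:R%:E :> \bar R]).
  apply: fin_bigcap_measurable => [|i _]; first exact: finite_finset.
  have := poisson_measurable HP (measurable_pattern_set m a i) measurableT.
  move=> /(_ [set (pattern_count i)%:R%:E] (emeasurable_set1 _)).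
  by rewrite setTI.
by apply/seteqP; split => w /= => [/pattern_countE h i _|h]; [exact: h|apply/pattern_countE => i; exact: h].
Qed.

Lemma probability_pattern m c : lexinc (@gridpt R m k d c) ->
  P [set w | pattern m (H w) (gridpt m c)] =
  (lam ^+ k * m.+1%:R ^- (k * d) * expR (- (lam * fine (vol (grid_union m (gridpt m c))))))%:E.
Proof.
move=> lc; set a := gridpt m c in lc *.
rewrite (_ : mkset _ = [set w | forall i,
    counting (H w `&` pattern_set m a i) = (pattern_count i)%:R%:E :> \bar R]); last first.
  by apply/seteqP; split => w /pattern_countE.
rewrite (poisson_independent HP); last 2 first.
- exact: measurable_pattern_set.
- apply/trivIsetP => i j _ _; rewrite /pattern_set -subset0.
  have /trivIsetP tC := @lexinc_trivIset R d k m a lc.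
  have cg l : grid_cell m a l `&` grid_gap m a `<=` set0.
    by move=> x [[xl _] [[_ nx] _]]; apply: nx; exists l.
  case: unliftP => [i' ->|->]; case: unliftP => [j' ->|->] // ij.
  + have ij' : i' != j' by apply: contraNneq ij => ->.
    by have := tC i' j' I I ij'; rewrite -subset0 => h x [[xi _] [xj _]]; exact: (h x).
  + by move=> x [h1 h2]; apply: (cg j' x).
have pc A n : measurable A -> (vol A < +oo)%E ->
    P [set w | counting (H w `&` A) = n%:R%:E :> \bar R] =
    ((lam * fine (vol A)) ^+ n / n`!%:R * expR (- (lam * fine (vol A))))%:E.
  move=> mA vA; rewrite (poisson_count HP)// poisson_prob_set1// mulr_ge0 ?(ltW lam0)//.
  exact: fine_ge0.
have gl : (vol (grid_gap m a) < +oo)%E.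
  apply: le_lt_trans (vol_grid_union_lty m a).
  by apply: measure_le; [exact: measurable_grid_gap|exact: measurable_grid_union|move=> x [[]]].
rewrite big_ord_recl.
have E0 : P [set w | counting (H w `&` pattern_set m a ord0) = (pattern_count ord0)%:R%:E :> \bar R] =
   (expR (- (lam * fine (vol (grid_gap m a)))))%:E.
  rewrite /pattern_set /pattern_count unlift_none/= pc//; last exact: measurable_grid_gap.
  by rewrite expr0 fact0 divr1 mul1r.
pose q : R := m.+1%:R ^- d.
have E1 i : P [set w | counting (H w `&` pattern_set m a (lift ord0 i)) =
    (pattern_count (lift ord0 i))%:R%:E :> \bar R] =
   (lam * q * expR (- (lam * q)))%:E.
  rewrite /pattern_set /pattern_count liftK/= pc ?vol_grid_cell ?ltry//; last exact: measurable_grid_cell.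
  by rewrite /= expr1 divr1.
rewrite E0 (eq_bigr (fun=> (lam * q * expR (- (lam * q)))%:E)); last by move=> i _; exact: E1.
rewrite prodEFin -EFinM prodr_const card_ord; congr EFin.
rewrite [LHS]mulrC !exprMn -expRM_natl -[LHS]mulrA -expRD fine_vol_grid_gap//; congr (_ * _).
  by rewrite /q exprVn -exprM mulnC.
by congr expR; rewrite /q; ring.
Qed.

Definition good m a w : Prop :=
  [/\ lexinc a, vconnected a (@grid_radius R d m) & pattern m (H w) a].

Definition cluster_event : set Omega :=
  [set w | (origin_cluster (H w) #= `I_k.+1)%card].

Definition cluster_points w : 'M[R]_(k, d) := lex_points k (origin_cluster (H w) `\ 0).

Definition approx_event m c : set Omega := [set w | good m (gridpt m c) w].

Definition approx_fun (f : 'M[R]_(k, d) -> R) m w : R :=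
  if pselect (exists c, approx_event m c w) is left e then f (gridpt m (projT1 (cid e))) else 0.

Lemma measurable_approx_event m c : measurable (approx_event m c).
Proof.
rewrite /approx_event/= /good.
have [[h1 h2]|h] := pselect (lexinc (@gridpt R m k d c) /\ vconnected (@gridpt R m k d c) (@grid_radius R d m)).
  rewrite (_ : mkset _ = [set w | pattern m (H w) (gridpt m c)]); first exact: measurable_pattern.
  by apply/seteqP; split => w /= => [[]|].
rewrite (_ : mkset _ = set0)// -subset0 => w [h1 h2 _]; exact: h.
Qed.

Lemma approx_event_unique m c c' w : approx_event m c w -> approx_event m c' w -> c = c'.
Proof.
move=> [l1 c1 p1] [l2 c2 p2]; apply: (@gridpt_inj R m).
exact: pattern_unique l1 c1 p1 l2 c2 p2.
Qed.

Lemma approx_funE f m c w : approx_event m c w -> approx_fun f m w = f (gridpt m c).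
Proof.
move=> h; rewrite /approx_fun; case: pselect => [e|]; last by case; exists c.
by case: cid => c' /= h'; rewrite (approx_event_unique h h').
Qed.

Lemma approx_fun0 f m w : (forall c, ~ approx_event m c w) -> approx_fun f m w = 0.
Proof. by move=> h; rewrite /approx_fun; case: pselect => // e; case: (e) => c hc; case: (h c hc). Qed.

Lemma measurable_approx_fun f m : measurable_fun setT (approx_fun f m).
Proof.
apply: (measurable_discrete (F := approx_event m) (h := fun c => f (gridpt m c))).
- exact: measurable_approx_event.
- by move=> c w; exact: approx_funE.
- by move=> w; exact: approx_fun0.
Qed.

Definition cluster_fun (f : 'M[R]_(k, d) -> R) w : R :=
  if `[< cluster_event w >] then f (cluster_points w) else 0.

Lemma cvg_approx_fun f w : continuous f ->
  approx_fun f m w @[m --> \oo] --> cluster_fun f w.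
Proof.
move=> cf; have lH := poisson_locally_finite HP w.
rewrite /cluster_fun; case: asboolP => [E|nE]; last first.
  apply: cvg_near_cst; apply: filterS (near_no_pattern lH nE) => m h.
  by apply: approx_fun0 => c [h1 h2]; exact: h.
have [_ _ h] := near_pattern lH E.
have : f (grid m (cluster_points w)) @[m --> \oo] --> f (cluster_points w).
  apply: (@cvg_comp _ _ _ (fun m => grid m (cluster_points w)) f); first exact: cvg_grid.
  exact: cf.
apply: cvg_trans; apply: near_eq_cvg; apply: filterS h => m [h1 h2 h3].
rewrite gridE; apply/esym; apply: approx_funE; rewrite /approx_event/= -gridE.
by split.
Qed.

Lemma measurable_cluster_fun f : continuous f -> measurable_fun setT (cluster_fun f).
Proof.
move=> cf; apply: (measurable_fun_cvg (measurable_approx_fun f)) => w _.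
exact: cvg_approx_fun.
Qed.

Lemma measurable_cluster_event : measurable cluster_event.
Proof.
have c1 : continuous (fun _ : 'M[R]_(k, d) => 1 : R) by exact: cst_continuous.
have := measurable_cluster_fun c1 measurableT (measurable_set1 1).
rewrite setTI (_ : _ @^-1` _ = cluster_event)//.
apply/seteqP; split => w /=; rewrite /cluster_fun; case: asboolP => // _ /eqP.
by rewrite eq_sym oner_eq0.
Qed.

Definition cluster_matrix w : 'M[R]_(k, d) :=
  if `[< cluster_event w >] then cluster_points w else 0.

Lemma measurable_cluster_matrix : measurable_fun setT cluster_matrix.
Proof.
apply: measurable_mxP => i j.
rewrite (_ : (fun w => _) = cluster_fun (fun x => x i j)).
  by apply: measurable_cluster_fun; exact: coord_continuous.
by apply/funext => w; rewrite /cluster_matrix /cluster_fun; case: asboolP => // _; rewrite mxE.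
Qed.

Definition approx_density (f : 'M[R]_(k, d) -> R) m y : R :=
  if lexinc (grid m y) && vconnected (grid m y) (@grid_radius R d m) then
  f (grid m y) * (lam ^+ k * expR (- (lam * fine (vol (grid_union m (grid m y)))))) else 0.

Definition cluster_density (f : 'M[R]_(k, d) -> R) y : R :=
  if lexinc y && vconnected y 1 then
  f y * (lam ^+ k * expR (- (lam * fine (vol (ball_union y))))) else 0.

Lemma measurable_approx_density f m : measurable_fun setT (approx_density f m).
Proof.
apply: (measurable_grid_fun m (fun y => if lexinc y && vconnected y (@grid_radius R d m) then
  f y * (lam ^+ k * expR (- (lam * fine (vol (grid_union m y))))) else 0)).
Qed.

Lemma near_vconnected_grid y :
  \forall m \near \oo, vconnected (grid m y) (@grid_radius R d m) = vconnected y 1.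
Proof.
have : \forall m \near \oo, forall p : option 'I_k * option 'I_k, setT p ->
     (N (grid m (vertex y p.1) - grid m (vertex y p.2)) <= @grid_radius R d m) =
     (N (vertex y p.1 - vertex y p.2) <= 1).
  by apply: near_finite_set => [|p _]; [exact: finite_finset|exact: near_grid_edge].
apply: filterS => m h; apply: eq_forallb => i; apply: eq_connect => u v.
have vg t : vertex (grid m y) t = grid m (vertex y t).
  by case: t => [j|] /=; rewrite ?row_grid ?grid0.
by rewrite !vg; exact: (h (u, v) I).
Qed.

Lemma cvg_approx_density f y : continuous f ->
  approx_density f m y @[m --> \oo] --> cluster_density f y.
Proof.
move=> cf.
have h : \forall m \near \oo, lexinc (grid m y) && vconnected (grid m y) (@grid_radius R d m) =
    lexinc y && vconnected y 1.
  by apply: filterS2 (near_lexinc_grid y) (near_vconnected_grid y) => m -> ->.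
rewrite /cluster_density; case: ifPn => hy; last first.
  by apply: cvg_near_cst; apply: filterS h => m h; rewrite /approx_density h (negbTE hy).
have : f (grid m y) * (lam ^+ k * expR (- (lam * fine (vol (grid_union m (grid m y)))))) @[m --> \oo]
    --> f y * (lam ^+ k * expR (- (lam * fine (vol (ball_union y))))).
  apply: cvgM.
    apply: (@cvg_comp _ _ _ (fun m => grid m y) f); first exact: cvg_grid.
    exact: cf.
  have h2 : lam * fine (vol (grid_union m (grid m y))) @[m --> \oo] --> lam * fine (vol (ball_union y)).
    by apply: cvgM; [exact: cvg_cst|exact: cvg_grid_union].
  have h3 : - (lam * fine (vol (grid_union m (grid m y)))) @[m --> \oo] --> - (lam * fine (vol (ball_union y))).
    exact: cvgN h2.
  have h4 := continuous_cvg _ (@continuous_expR R (- (lam * fine (vol (ball_union y))))) h3.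
  by apply: cvgM; [exact: cvg_cst|exact: h4].
by apply: cvg_trans; apply: near_eq_cvg; apply: filterS h => m h; rewrite /approx_density h hy.
Qed.

Lemma integral_approx f m : (forall x, 0 <= f x) ->
  (\int[P]_w (approx_fun f m w)%:E = \int[lebesgue_mx k d]_y (approx_density f m y)%:E)%E.
Proof.
move=> f0.
pose F c : set 'M[R]_(k, d) := if lexinc (@gridpt R m k d c) && vconnected (@gridpt R m k d c) (@grid_radius R d m)
  then [set y | grid m y = gridpt m c] else set0.
pose h2 c := f (gridpt m c) * (lam ^+ k * expR (- (lam * fine (vol (grid_union m (@gridpt R m k d c)))))).
rewrite (integral_discrete (F := approx_event m) (h := fun c => f (gridpt m c)))//; last 4 first.
- exact: measurable_approx_event.
- exact: approx_event_unique.
- by move=> c w; exact: approx_funE.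
- by move=> w; exact: approx_fun0.
rewrite (integral_discrete (F := F) (h := h2)); last 5 first.
- by move=> c; rewrite /F; case: ifP => // _; exact: grid_preimage_measurable.
- move=> c c' y; rewrite /F; case: ifP => // _ /= yc; case: ifP => // _ /= yc'.
  by apply: (@gridpt_inj R m); rewrite -yc.
- by move=> c y; rewrite /F /approx_density; case: ifP => // h /= ->; rewrite h.
- move=> y h; rewrite /approx_density; case: ifP => // hy.
  have := h (map_mx (fun t => Num.floor (m.+1%:R * t)) y); rewrite /F -gridE hy.
  by case.
- by move=> c; rewrite /h2 !mulr_ge0 ?expR_ge0 ?exprn_ge0// ltW.
apply: eq_eseriesr => n _; case: choice.pickle_inv => // c.
rewrite /F; case: ifPn => [/andP[h1 h3]|h].
  rewrite (_ : approx_event m c = [set w | pattern m (H w) (gridpt m c)]); last first.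
    by apply/seteqP; split => w /= => [[]|p]; last split.
  have pp := probability_pattern h1; have lc := lebesgue_grid_cell m c.
  rewrite -[X in (_ * X)%E = _]/(P [set w | pattern m (H w) (gridpt m c)]) pp.
  rewrite -[X in _ = (_ * X)%E]/(lebesgue_mx k d [set y | grid m y = gridpt m c]) lc.
  by rewrite -!EFinM /h2; congr EFin; ring.
rewrite measure0 mule0 (_ : approx_event m c = set0) ?measure0 ?mule0//.
by rewrite -subset0 => w [h1 h3 _]; move: h; rewrite h1 h3.
Qed.

Lemma cluster_law (f : 'M[R]_(k, d) -> R) (K : R) : continuous f -> (forall x, 0 <= f x <= K) ->
  [/\ measurable_fun setT (cluster_density f),
   (\int[lebesgue_mx k d]_y (cluster_density f y)%:E < +oo)%E &
  (\int[P]_w (cluster_fun f w)%:E = \int[lebesgue_mx k d]_y (cluster_density f y)%:E)%E].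
Proof.
move=> cf f0K; have f0 x : 0 <= f x by have /andP[] := f0K x.
have fK x : f x <= K by have /andP[] := f0K x.
have K0 : 0 <= K by exact: le_trans (f0 0) (fK 0).
have [_ _ _ c1] : [/\ measurable_fun setT (cluster_fun f), (forall x, 0 <= cluster_fun f x),
    (\int[P]_x (cluster_fun f x)%:E < +oo)%E &
    (\int[P]_x (approx_fun f n x)%:E @[n --> \oo] --> \int[P]_x (cluster_fun f x)%:E)%E].
  apply: (@bounded_convergence _ _ R P (approx_fun f) (cluster_fun f) (fun=> K)).
  - exact: measurable_approx_fun.
  - by move=> w; exact: cvg_approx_fun.
  - by move=> m w; rewrite /approx_fun; case: pselect => // *; rewrite lexx K0.
  - by [].
  - have -> : (\int[P]__ K%:E = K%:E * P setT)%E by rewrite integral_cst.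
    by rewrite probability_setT mule1 ltry.
pose b : nat := (Num.truncn (k%:R * (1 + 2 * d%:R) + d%:R : R)).+1.
pose W : set 'M[R]_(k, d) := mxcube b.
have mW : measurable W by exact: mxbox_measurable.
have [m2 _ i2 c2] : [/\ measurable_fun setT (cluster_density f), (forall x, 0 <= cluster_density f x),
    (\int[lebesgue_mx k d]_x (cluster_density f x)%:E < +oo)%E &
    (\int[lebesgue_mx k d]_x (approx_density f n x)%:E @[n --> \oo] -->
    \int[lebesgue_mx k d]_x (cluster_density f x)%:E)%E].
  apply: (@bounded_convergence _ _ R (lebesgue_mx k d) (approx_density f) (cluster_density f)
    (fun y => K * lam ^+ k * \1_W y)).
  - exact: measurable_approx_density.
  - by move=> y; exact: cvg_approx_density.
  - move=> m y; rewrite /approx_density; case: ifPn => [/andP[_ cy]|_]; last first.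
      by rewrite lexx/= !mulr_ge0// exprn_ge0// ltW.
    have lk : 0 <= lam ^+ k by rewrite exprn_ge0// ltW.
    rewrite !mulr_ge0 ?expR_ge0//= indicE mem_set ?mulr1; last first.
      move=> i j; rewrite !mxE.
      have h : `|y i j| < b%:R.
        apply: le_lt_trans (truncnS_gt _).
        have -> : y i j = (row i y) 0 j by rewrite mxE.
        apply: (le_trans (coord_le_enorm _ _)).
        rewrite -[row i y](subrK (grid m (row i y))) addrC; apply: le_trans (enorm_triangle _ _) _.
        apply: lerD.
          rewrite -row_grid; apply: le_trans (connect_vertex_norm _ cy i) _.
            by apply: le_trans (@grid_radius_ge1 R d m).
          by rewrite ler_wpM2l// grid_radius_le.
        apply: le_trans (enorm_grid m _) _.
        by rewrite ler_piMr// invf_le1 ?ler1n.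
      by move: h; rewrite ltr_norml => /andP[/ltW -> ->].
    apply: ler_pM => //; first by rewrite mulr_ge0 ?expR_ge0.
    rewrite ler_piMr// -[leRHS]expR0 ler_expR oppr_le0 mulr_ge0 ?(ltW lam0)//.
    exact: fine_ge0.
  - by apply: measurable_funM.
  - rewrite ge0_integralrZ//; last by rewrite mulr_ge0// exprn_ge0// ltW.
    rewrite integral_indic// setIT -[X in (_ * X)%E]/(lebesgue_mx k d W) lebesgue_mxcube.
    by rewrite -EFinM ltry.
split => //.
have E : (fun n => \int[P]_x (approx_fun f n x)%:E)%E = (fun n => \int[lebesgue_mx k d]_x (approx_density f n x)%:E)%E.
  by apply/funext => n; exact: integral_approx.
rewrite E in c1.
exact: (cvg_unique _ c1 c2).
Qed.

End poisson_cluster.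

(** * Weak convergence *)

Section density.
Context {dT} {T : measurableType dT} {R : realType}.
Implicit Types mu nu : {measure set T -> \bar R}.

Import HBNNSimple.

Lemma eq_measurable_integral (mu nu : set T -> \bar R) (f : T -> \bar R) :
  (forall A, measurable A -> mu A = nu A) -> (\int[mu]_x f x = \int[nu]_x f x)%E.
Proof.
move=> h; have E (g : {nnsfun T >-> R}) : sintegral mu g = sintegral nu g.
  by apply: eq_fsbigr => x _; rewrite h//; exact: measurable_sfunP.
have S (F : set {nnsfun T >-> R}) :
    [set sintegral mu g | g in F] = [set sintegral nu g | g in F].
  by apply/seteqP; split => _ [g Fg <-]; exists g => //; rewrite E.
by rewrite /integral !S.
Qed.

Lemma nnsfun_integral_density mu nu (h : T -> R) (s : {nnsfun T >-> R}) :
  measurable_fun setT h -> (forall x, 0 <= h x) ->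
  (forall A, measurable A -> nu A = \int[mu]_(x in A) (h x)%:E)%E ->
  (\int[nu]_x (s x)%:E = \int[mu]_x (s x * h x)%:E)%E.
Proof.
move=> mh h0 nuE; rewrite integralT_nnsfun sintegralE.
have ms y : measurable (s @^-1` [set y]) by exact: measurable_sfunP.
have y0 y : range s y -> 0 <= y by move=> [x _ <-].
pose F y x := (`|y| * (\1_(s @^-1` [set y]) x * h x))%:E.
have mF y : measurable_fun setT (F y).
  by apply/measurable_EFinP; apply: measurable_funM => //; apply: measurable_funM.
have F0 y x : (0 <= F y x)%E by rewrite lee_fin !mulr_ge0//.
transitivity (\int[mu]_x (\sum_(y \in range s) F y x))%E.
  rewrite ge0_integral_fsum//.
  apply: eq_fsbigr => y /set_mem ys; rewrite nuE// ge0_integralrZ//.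
  - rewrite ger0_norm ?y0// integral_mkcond; congr (_ * _)%E; apply: eq_integral => x _.
    by rewrite patchE indicE; case: ifPn => _; rewrite ?mul1r ?mul0r.
  - by apply: measurable_funM.
  - by move=> x; rewrite mulr_ge0.
apply: eq_integral => x _; rewrite [in RHS]fimfunE EFinM -fsumEFin// ge0_mule_fsuml.
  by apply: eq_fsbigr => y /set_mem ys; rewrite /F ger0_norm ?y0// mulrA EFinM.
by move=> y; exact: nnfun_muleindic_ge0.
Qed.

Lemma ge0_integral_density mu nu (h g : T -> R) :
  measurable_fun setT h -> (forall x, 0 <= h x) ->
  (forall A, measurable A -> nu A = \int[mu]_(x in A) (h x)%:E)%E ->
  measurable_fun setT g -> (forall x, 0 <= g x) ->
  (\int[nu]_x (g x)%:E = \int[mu]_x (g x * h x)%:E)%E.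
Proof.
move=> mh h0 nuE mg g0; have mg' : measurable_fun setT (EFin \o g) by exact/measurable_EFinP.
have g0' x : setT x -> (0 <= (EFin \o g) x)%E by rewrite lee_fin.
pose s := nnsfun_approx measurableT mg'.
have sg x : (s n x)%:E @[n --> \oo] --> (g x)%:E by exact: (cvg_nnsfun_approx measurableT mg' g0').
have nds x : {homo (fun n => s n x) : n m / (n <= m)%N >-> n <= m}.
  by move=> a b ab; exact/lefP/nd_nnsfun_approx.
have ms n : measurable_fun setT (s n) by exact: measurable_funP.
have shg x : (s n x * h x)%:E @[n --> \oo] --> (g x * h x)%:E.
  under eq_fun do rewrite EFinM; rewrite EFinM; apply: cvgeZr => //; exact: sg.
transitivity (limn (fun n => \int[nu]_x (s n x)%:E))%E.
  rewrite -monotone_convergence//.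
  - by apply: eq_integral => x _; apply/esym/cvg_lim => //; exact: sg.
  - by move=> n; exact/measurable_EFinP.
  - by move=> n x _; rewrite lee_fin.
  - by move=> x _ a b ab; rewrite lee_fin; exact: nds.
transitivity (limn (fun n => \int[mu]_x (s n x * h x)%:E))%E.
  by congr (limn _); apply/funext => n; exact: nnsfun_integral_density.
rewrite -monotone_convergence//.
- by apply: eq_integral => x _; apply/cvg_lim => //; exact: shg.
- by move=> n; apply/measurable_EFinP; exact: measurable_funM.
- by move=> n x _; rewrite lee_fin mulr_ge0.
- by move=> x _ a b ab; rewrite lee_fin ler_wpM2r//; exact: nds.
Qed.

Lemma integral_max mu (f : T -> R) :
  (\int[mu]_x (f x)%:E =
   \int[mu]_x (Num.max (f x) 0)%:E - \int[mu]_x (Num.max (- f x) 0)%:E)%E.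
Proof.
rewrite integralE; congr (_ - _)%E; apply: eq_integral => x _.
  by rewrite funeposE EFin_max.
by rewrite funenegE EFin_max EFinN.
Qed.

End density.

Section cond_distribution.
Context {dO dT : measure_display} {Omega : measurableType dO} {T : measurableType dT}
  {R : realType} (P : probability Omega R) (E : set Omega) (X X' : Omega -> T).
Hypotheses (mE : measurable E) (mX : measurable_fun setT X') (XX : forall w, E w -> X w = X' w).

Let c : R := (fine (P E))^-1.

Let c0 : 0 <= c. Proof. by rewrite invr_ge0 fine_ge0. Qed.

Let cond_measure : {measure set T -> \bar R} :=
  mscale (NngNum c0) (pushforward_measure (mrestr P mE) mX).

Let cond_distributionE A : measurable A -> cond_distribution P E X A = cond_measure A.
Proof.
move=> mA; rewrite /cond_distribution /cond_measure /= /mscale/= /pushforward/= /mrestr.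
have -> : X @^-1` A `&` E = X' @^-1` A `&` E.
  by apply/seteqP; split => w /= [h Ew]; split => //; rewrite ?XX// -XX.
rewrite EFinM muleC fineK//; apply: fin_num_measure; apply: measurableI => //.
by rewrite -[X in measurable X]setTI; exact: mX.
Qed.

Lemma ge0_integral_cond_distribution (f : T -> R) :
  measurable_fun setT f -> (forall x, 0 <= f x) ->
  (\int[cond_distribution P E X]_x (f x)%:E =
   ((fine (P E))^-1)%:E * \int[P]_w (if `[< E w >] then f (X' w) else 0)%:E)%E.
Proof.
move=> mf f0; rewrite (eq_measurable_integral _ cond_distributionE).
have mf' : measurable_fun setT (fun x => (f x)%:E) by exact/measurable_EFinP.
rewrite ge0_integral_mscale//.
- congr (_ * _)%E; rewrite ge0_integral_pushforward//; last by move=> x _; rewrite lee_fin.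
  rewrite preimage_setT (@ge0_integral_density _ _ _ P _ \1_E (f \o X'))//.
  + apply: eq_integral => w _; rewrite indicE; case: asboolP => Ew.
      by rewrite mem_set// mulr1.
    by rewrite memNset// mulr0.
  + by move=> A mA; rewrite integral_indic// setIC.
  + exact: measurableT_comp.
  + by move=> w; exact: f0.
- by move=> x _; rewrite lee_fin.
Qed.

Lemma integral_cond_distribution_max (f : T -> R) :
  (\int[cond_distribution P E X]_x (f x)%:E =
   \int[cond_distribution P E X]_x (Num.max (f x) 0)%:E -
   \int[cond_distribution P E X]_x (Num.max (- f x) 0)%:E)%E.
Proof. by rewrite !(eq_measurable_integral _ cond_distributionE); exact: integral_max. Qed.

End cond_distribution.

Section lex_points_rows.
Context {R : realType} {d k : nat}.
Implicit Types z : 'M[R]_(k, d).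

Definition lex_rows z : 'M[R]_(k, d) := lex_points k (rows z).

Lemma measurable_lex_rows : measurable_fun setT lex_rows.
Proof.
apply: measurable_mxP => i j.
apply: (@measurable_fun_cvg _ _ _ _ (fun m z => lex_rows (grid m z) i j)).
  by move=> m; exact: (measurable_grid_fun m (fun z => lex_rows z i j)).
move=> z _.
have h : grid m (lex_rows z) i j @[m --> \oo] --> lex_rows z i j.
  apply: (@cvg_comp _ _ _ (fun m => grid m (lex_rows z)) (fun x : 'M[R]_(k, d) => x i j)).
    exact: cvg_grid.
  exact: coord_continuous.
apply: cvg_trans h; apply: near_eq_cvg.
have h : \forall m \near \oo, lex_rows (grid m z) = grid m (lex_rows z).
  have := @near_lex_points_grid R d k (rows z) (finite_rows z); apply: filterS => m h.
  by rewrite /lex_rows -grid_rows h.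
by apply: filterS h => m ->.
Qed.

Lemma rows_row_perm (s : 'S_k) z : rows (row_perm s z) = rows z.
Proof.
apply/seteqP; split => [_ [i _ <-]|_ [i _ <-]].
  by exists (s i) => //; apply/rowP => j; rewrite !mxE.
by exists ((s^-1)%g i) => //; apply/rowP => j; rewrite !mxE permKV.
Qed.

Definition distinct_rows z : bool := [forall i, forall j, (row i z == row j z) ==> (i == j)].

Lemma distinct_rowsP z : reflect (injective (fun i => row i z)) (distinct_rows z).
Proof.
apply: (iffP forallP) => h i; last first.
  by apply/forallP => j; apply/implyP => /eqP ij; apply/eqP; exact: h.
by move=> j /= ij; have /forallP/(_ j)/implyP/(_ _)/eqP := h i; apply; apply/eqP.
Qed.

Lemma lexinc_row_perm_uniq (s t : 'S_k) z : distinct_rows z ->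
  lexinc (row_perm s z) -> lexinc (row_perm t z) -> s = t.
Proof.
move=> /distinct_rowsP iz ls lt.
have E : row_perm s z = row_perm t z.
  by apply: lexinc_rows_inj => //; rewrite !rows_row_perm.
apply/permP => i; apply: iz => /=; apply/rowP => j.
by have := congr1 (fun x : 'M[R]_(k, d) => x i j) E; rewrite !mxE.
Qed.

Lemma lexinc_row_perm_ex z : distinct_rows z ->
  exists2 s : 'S_k, lexinc (row_perm s z) & row_perm s z = lex_rows z.
Proof.
move=> /distinct_rowsP iz.
have fX := finite_rows z.
have Xk : (rows z #= `I_k)%card by exact: card_range_ord.
have lz : lexinc (lex_rows z) by exact: lexinc_lex_points.
have rz : rows (lex_rows z) = rows z by exact: rows_lex_points.
have h i : exists j, row j z = row i (lex_rows z).
  have : rows z (row i (lex_rows z)) by rewrite -rz; exists i.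
  by move=> [j _ ?]; exists j.
pose s i := projT1 (cid (h i)).
have sE i : row (s i) z = row i (lex_rows z) by rewrite /s; case: cid.
have si : injective s by move=> i j ij; apply: (lexinc_inj lz) => /=; rewrite -!sE ij.
have E : row_perm (perm si) z = lex_rows z.
  by apply/row_matrixP => i; rewrite -sE; apply/rowP => j; rewrite !mxE permE.
by exists (perm si) => //; rewrite E.
Qed.

Lemma lex_rows_sum (f g : 'M[R]_(k, d) -> R) z : distinct_rows z ->
  (forall (s : 'S_k) y, g (row_perm s y) = g y) ->
  f (lex_rows z) * g z =
  \sum_(s : 'S_k) (if lexinc (row_perm s z) then f (row_perm s z) * g (row_perm s z) else 0).
Proof.
move=> dz gs; have [s ls sE] := lexinc_row_perm_ex dz.
rewrite (bigD1 s)//= ls gs sE big1 ?addr0// => t ts; case: ifPn => // lt.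
by rewrite (lexinc_row_perm_uniq dz lt ls) eqxx in ts.
Qed.

Lemma measurable_lexinc : measurable_fun setT (@lexinc R d k).
Proof.
apply: (measurable_fun_bool true) => //; rewrite setTI.
suff m : measurable_fun setT (fun z => (lexinc z)%:R : R).
  have := m measurableT [set 1] (measurable_set1 _); rewrite setTI.
  rewrite (_ : _ @^-1` [set 1] = @lexinc R d k @^-1` [set true])//.
  apply/seteqP; split => z /=; first by case: lexinc => // /eqP; rewrite eq_sym oner_eq0.
  by move=> ->.
apply: (@measurable_fun_cvg _ _ _ _ (fun m z => (lexinc (grid m z))%:R : R)).
  by move=> m; exact: (measurable_grid_fun m (fun z => (lexinc z)%:R : R)).
move=> z _; apply: cvg_near_cst.
by apply: filterS (near_lexinc_grid z) => m ->.
Qed.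

Lemma distinct_rows_ae : (0 < d)%N -> {ae lebesgue_mx k d, forall z, distinct_rows z}.
Proof.
move=> d0.
pose D (p : 'I_k * 'I_k) : set 'M[R]_(k, d) :=
  if p.1 != p.2 then [set x | row p.1 x = row p.2 x] else set0.
have nD p : (lebesgue_mx k d).-negligible (D p).
  rewrite /D; case: ifPn => [p12|_]; last exact: negligible_set0.
  by apply/negligibleP; [exact: measurable_row_eq|exact: lebesgue_mx_row_eq].
pose F n : set 'M[R]_(k, d) := if @choice.unpickle ('I_k * 'I_k)%type n is Some p then D p else set0.
have nF n : (lebesgue_mx k d).-negligible (F n).
  by rewrite /F; case: choice.unpickle => [p|]; [exact: nD|exact: negligible_set0].
apply: (negligibleS _ (negligible_bigcup nF)) => z /= /negP /forallPn[i /forallPn[j]].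
rewrite negb_imply => /andP[/eqP rij ij].
by exists (choice.pickle (i, j)) => //; rewrite /F choice.pickleK /D/= ij.
Qed.

End lex_points_rows.

Section symmetrization.
Context {R : realType} {d k : nat}.
Implicit Types z : 'M[R]_(k, d).
Local Notation vol := (lebesgue_mx k d).

Definition lex_weight (f g : 'M[R]_(k, d) -> R) z : R := if lexinc z then f z * g z else 0.

Lemma measurable_lex_weight f g : measurable_fun setT f -> measurable_fun setT g ->
  measurable_fun setT (lex_weight f g).
Proof.
move=> mf mg; apply: measurable_fun_ifT => //; first exact: measurable_lexinc.
exact: measurable_funM.
Qed.

Lemma integral_lex_rows (f g : 'M[R]_(k, d) -> R) : (0 < d)%N ->
  measurable_fun setT f -> (forall z, 0 <= f z) ->
  measurable_fun setT g -> (forall z, 0 <= g z) ->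
  (forall (s : 'S_k) y, g (row_perm s y) = g y) ->
  (\int[vol]_z (f (lex_rows z) * g z)%:E = k`!%:R%:E * \int[vol]_z (lex_weight f g z)%:E)%E.
Proof.
move=> d0 mf f0 mg g0 gs.
have mw := measurable_lex_weight mf mg.
have w0 z : 0 <= lex_weight f g z by rewrite /lex_weight; case: ifP => // _; rewrite mulr_ge0.
have mws (s : 'S_k) : measurable_fun setT (fun z => (lex_weight f g (row_perm s z))%:E).
  by apply/measurable_EFinP; exact: (measurableT_comp mw (measurable_row_perm s)).
transitivity (\int[vol]_z (\sum_(s <- enum 'S_k) (lex_weight f g (row_perm s z))%:E))%E.
  apply: ge0_ae_eq_integral => //.
  - apply/measurable_EFinP; apply: measurable_funM => //.
    exact: (measurableT_comp mf measurable_lex_rows).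
  - exact: emeasurable_sum.
  - by move=> z _; rewrite lee_fin mulr_ge0.
  - by move=> z _; apply: sume_ge0 => s _; rewrite lee_fin.
  - have := @distinct_rows_ae R d k d0; apply: negligibleS => z /= h dz; apply: h => _.
    by rewrite (lex_rows_sum f dz gs) sumEFin big_enum.
rewrite ge0_integral_sum//; last by move=> s z _; rewrite lee_fin.
rewrite (eq_bigr (fun=> \int[vol]_z (lex_weight f g z)%:E)%E); last first.
  move=> s _; apply: (ge0_integral_row_perm s (f := fun z => (lex_weight f g z)%:E)).
    exact/measurable_EFinP.
  by move=> z; rewrite lee_fin.
rewrite big_const_seq count_predT iter_addr addr0 -cardE -[#|_|]/(#|{: 'S_k}|) card_Sn.
elim: (k`!) => [|n IH]; first by rewrite mulr0n mul0e.
by rewrite mulrSr IH -natr1 EFinD ge0_muleDl ?mul1e// lee_fin.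
Qed.

End symmetrization.

Section asymptotic_density.
Context {R : realType} {e k : nat}.
Local Notation d := e.+1.
Implicit Types (z : 'M[R]_(k, d)) (f : 'M[R]_(k, d) -> R).
Local Notation N := (@enorm R d).
Local Notation vol := (@lebesgue_mx R 1 d).
Local Notation B := (eball (0 : 'rV[R]_d) 1).
Local Notation S := (@shell_constant R e).

Lemma gfun_le z : gfun z <= rows_norm z * S.
Proof. by rewrite -lee_fin gfun_ray_integral; exact: ray_integral_le. Qed.

Lemma gfun_row_perm (s : 'S_k) z : gfun (row_perm s z) = gfun z.
Proof.
have E i : row i (row_perm s z) = row (s i) z by apply/rowP => j; rewrite !mxE.
suff D : Dset (row_perm s z) = Dset z by rewrite /gfun D.
apply/seteqP; split => [x [i _]|x [i _]]; first by rewrite E; exists (s i).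
by exists ((s^-1)%g i) => //; rewrite E permKV.
Qed.

Lemma excess_rows_norm z : vconnected z 1 ->
  fine (vol B) / (2 + k%:R) / k.+1%:R * rows_norm z <= excess z.
Proof.
move=> cz; set c := _ / (2 + _).
have h i : c * N (row i z) <= excess z.
  apply: excess_ge => //; rewrite -[k%:R]mulr1.
  exact: (connect_vertex_norm ler01 cz).
rewrite mulrAC ler_pdivrMr// /rows_norm mulr_sumr.
apply: (@le_trans _ _ (\sum_(i < k) excess z)); first exact: ler_sum.
rewrite sumr_const card_ord -[_ *+ k]mulr_natr ler_wpM2l ?excess_ge0// ler_nat//.
Qed.

Lemma cvg_excess (u : R^nat) z : u n @[n --> \oo] --> +oo ->
  u n * excess ((u n)^-1 *: z) @[n --> \oo] --> gfun z.
Proof.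
move=> uy; pose T := rows_norm z.
have upos : \forall n \near \oo, 0 < u n by exact: (cvgryPgt _).1 uy 0.
have t0 : (u n)^-1 @[n --> \oo] --> (0 : R) by apply/(gtr0_cvgV0 upos).
have q : 1 + 2 * ((u n)^-1 * (T + (u n)^-1 * T ^+ 2)) @[n --> \oo] --> 1 + 2 * (0 * (T + 0 * T ^+ 2)).
  apply: cvgD; first exact: cvg_cst.
  apply: cvgM; first exact: cvg_cst.
  apply: cvgM => //; apply: cvgD; first exact: cvg_cst.
  by apply: cvgM => //; exact: cvg_cst.
have tTS (a : R) : a + (u n)^-1 * T ^+ 2 * S @[n --> \oo] --> a + 0 * T ^+ 2 * S.
  apply: cvgD; first exact: cvg_cst.
  apply: cvgM; last exact: cvg_cst.
  by apply: cvgM => //; exact: cvg_cst.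
have up : (1 + 2 * ((u n)^-1 * (T + (u n)^-1 * T ^+ 2))) ^+ e * (gfun z + (u n)^-1 * T ^+ 2 * S)
    @[n --> \oo] --> gfun z.
  rewrite -[X in _ --> X](_ : (1 + 2 * (0 * (T + 0 * T ^+ 2))) ^+ e * (gfun z + 0 * T ^+ 2 * S) = _); last first.
    by rewrite !mul0r mulr0 !addr0 expr1n mul1r.
  apply: cvgM; last exact: tTS.
  exact: (continuous_cvg _ (@exprn_continuous R e _) q).
have lo : gfun z - (u n)^-1 * T ^+ 2 * S @[n --> \oo] --> gfun z.
  rewrite -[X in _ --> X](_ : gfun z - 0 * T ^+ 2 * S = _); last by rewrite !mul0r subr0.
  apply: cvgB; first exact: cvg_cst.
  apply: cvgM; last exact: cvg_cst.
  by apply: cvgM => //; exact: cvg_cst.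
apply: (squeeze_cvgr _ lo up); apply: filterS upos => n un.
have un' : 0 < (u n)^-1 by rewrite invr_gt0.
apply/andP; split.
  rewrite lerBlDr -(ler_pM2l un') mulrDr mulKf ?lt0r_neq0// mulrA.
  have := excess_lower z un'; rewrite -/T.
  by move: (_ * S) (gfun z) => *; rewrite -?mulrA.
rewrite -(ler_pM2l un') mulKf ?lt0r_neq0//.
exact: excess_upper.
Qed.

Lemma measurable_excess : measurable_fun setT (@excess R d k).
Proof.
have -> : @excess R d k = (fun y => fine (vol (ball_union y)) - fine (vol B)).
  by apply/funext => y; rewrite fine_vol_ball_union addrAC subrr add0r.
apply: measurable_funB => //.
apply: (@measurable_fun_cvg _ _ _ _ (fun m y => fine (vol (grid_union m (grid m y))))).
  by move=> m; exact: (measurable_grid_fun m (fun y => fine (vol (grid_union m y)))).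
by move=> y _; exact: cvg_grid_union.
Qed.

Lemma measurable_gfun : measurable_fun setT (@gfun R d k).
Proof.
apply: (@measurable_fun_cvg _ _ _ _ (fun n (y : 'M[R]_(k, d)) => n.+1%:R * excess (n.+1%:R^-1 *: y))).
  move=> n; apply: measurable_funM => //.
  exact: (measurableT_comp measurable_excess (measurable_scalemx _)).
move=> z _; apply: (cvg_excess (u := fun n => n.+1%:R)).
by apply/cvgryPge => A; apply: filterS (nbhs_infty_ger A) => n /le_trans; apply; rewrite ler_nat.
Qed.

Definition scaled_density (lam : R) f z : R :=
  if lexinc z && vconnected (lam^-1 *: z) 1 then f z * expR (- (lam * excess (lam^-1 *: z))) else 0.

Lemma near_vconnected (u : R^nat) z : u n @[n --> \oo] --> +oo ->
  \forall n \near \oo, vconnected ((u n)^-1 *: z) 1.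
Proof.
move=> uy; have h : \forall n \near \oo, rows_norm z < u n by exact: (cvgryPgt _).1 uy _.
apply: filterS h => n h; have un : 0 < u n by exact: le_lt_trans (rows_norm_ge0 z) h.
apply/forallP => i; apply: connect1; rewrite !vertexZ /= scaler0 sub0r enormN enormZ.
rewrite gtr0_norm ?invr_gt0// ler_pdivrMl// mulr1.
by apply: le_trans (ltW h); exact: (enorm_vertex_le z (Some i)).
Qed.

Lemma cvg_scaled_density (u : R^nat) f z : u n @[n --> \oo] --> +oo ->
  scaled_density (u n) f z @[n --> \oo] --> lex_weight f (fun z => expR (- gfun z)) z.
Proof.
move=> uy; rewrite /scaled_density /lex_weight; case: ifPn => lz /=; last exact: cvg_cst.
have h : f z * expR (- (u n * excess ((u n)^-1 *: z))) @[n --> \oo] --> f z * expR (- gfun z).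
  apply: cvgM; first exact: cvg_cst.
  have h : - (u n * excess ((u n)^-1 *: z)) @[n --> \oo] --> - gfun z.
    by apply: cvgN; exact: cvg_excess.
  exact: (continuous_cvg _ (@continuous_expR R _) h).
apply: cvg_trans h; apply: near_eq_cvg.
have h := @near_vconnected u z uy.
by apply: filterS h => n ->.
Qed.

Hypothesis ig : (\int[lebesgue_mx k d]_z (expR (- @gfun R d k z))%:E < +oo)%E.

Lemma integral_exp_rows_norm (c : R) : 0 < c ->
  (\int[lebesgue_mx k d]_z (expR (- (c * rows_norm z)))%:E < +oo)%E.
Proof.
move=> c0; have S1 : 0 < S + 1 by rewrite ltr_wpDl ?shell_constant_ge0.
pose F z := expR (- ((S + 1) * rows_norm z)).
have mF : measurable_fun setT F.
  apply: measurableT_comp => //; apply: measurable_funN; apply: measurable_funM => //.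
  exact: measurable_rows_norm.
have cS : 0 < c / (S + 1) by rewrite divr_gt0.
rewrite (eq_integral (fun z => (F ((c / (S + 1)) *: z))%:E)); last first.
  move=> z _; congr EFin; rewrite /F rows_normZ gtr0_norm//; congr (expR (- _)).
  by rewrite [RHS]mulrA [(S + 1) * _]mulrC divfK// lt0r_neq0.
rewrite (ge0_integral_scalemx (f := EFin \o F) cS)//; last 2 first.
- exact/measurable_EFinP.
- by move=> z; rewrite lee_fin expR_ge0.
apply: lte_mul_pinfty => //; first by rewrite lee_fin invr_ge0 exprn_ge0// ltW.
apply: le_lt_trans ig; apply: ge0_le_integralr => //.
- by move=> z; exact: expR_ge0.
- by apply: measurableT_comp => //; apply: measurable_funN; exact: measurable_gfun.
- move=> z; rewrite /F ler_expR lerN2; apply: le_trans (gfun_le z) _.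
  by rewrite mulrC ler_wpM2r ?rows_norm_ge0// lerDl.
Qed.

Lemma cvg_integral_scaled_density f (K : R) (u : R^nat) :
  (forall x, 0 <= f x <= K) -> (forall lam, 0 < lam -> measurable_fun setT (scaled_density lam f)) ->
  u n @[n --> \oo] --> +oo ->
  (\int[lebesgue_mx k d]_z (lex_weight f (fun z => expR (- gfun z)) z)%:E < +oo)%E /\
  (\int[lebesgue_mx k d]_z (scaled_density (u n) f z)%:E @[n --> \oo] -->
    \int[lebesgue_mx k d]_z (lex_weight f (fun z => expR (- gfun z)) z)%:E)%E.
Proof.
move=> f0K mf uy; pose c : R := fine (vol B) / (2 + k%:R) / k.+1%:R.
have K0 : 0 <= K by have /andP[a b] := f0K 0; exact: le_trans b.
have c0 : 0 < c by rewrite !divr_gt0 ?fine_vol_ball_gt0// ltr_wpDr.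
pose v n := Num.max 1 (u n); have v0 n : 0 < v n by rewrite lt_max ltr01.
have uv : \forall n \near \oo, v n = u n.
  have h : \forall n \near \oo, 1 < u n by exact: (cvgryPgt _).1 uy 1.
  by apply: filterS h => n h; rewrite /v max_r// ltW.
have vy : v n @[n --> \oo] --> +oo.
  by apply: cvg_trans uy; apply: near_eq_cvg; apply: filterS uv => n ->.
have := @bounded_convergence _ _ R (lebesgue_mx k d)
  (fun n => scaled_density (v n) f) (lex_weight f (fun z => expR (- gfun z)))
  (fun z => K * expR (- (c * rows_norm z))) (fun n => mf _ (v0 n))
  (fun z => @cvg_scaled_density v f z vy) _ _ _.
case.
- move=> n z; rewrite /scaled_density; case: ifPn => [/andP[_ cz]|_]; last first.
    by rewrite lexx mulr_ge0// expR_ge0.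
  have /andP[fz0 fzK] := f0K z.
  rewrite mulr_ge0 ?expR_ge0//= ler_pM ?expR_ge0// ler_expR lerN2.
  have := excess_rows_norm cz; rewrite -/c rows_normZ gtr0_norm ?invr_gt0//.
  by rewrite mulrCA ler_pdivrMl.
- apply: measurable_funM => //; apply: measurableT_comp => //; apply: measurable_funN.
  by apply: measurable_funM => //; exact: measurable_rows_norm.
- rewrite ge0_integralrZ//.
  + by apply: lte_mul_pinfty => //; exact: integral_exp_rows_norm.
  + apply: measurableT_comp => //; apply: measurable_funN.
    by apply: measurable_funM => //; exact: measurable_rows_norm.
move=> _ _ h1 h2; split; first exact: h1.
pose I lam := (\int[lebesgue_mx k d]_z (scaled_density lam f z)%:E)%E.
have uvI : \forall n \near \oo, I (v n) = I (u n) by apply: filterS uv => n ->.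
exact: cvg_trans (near_eq_cvg uvI) h2.
Qed.

End asymptotic_density.

Lemma scaled_density_ge0 {R : realType} {e k : nat} (lam : R) (f : 'M[R]_(k, e.+1) -> R) z :
  (forall x, 0 <= f x) -> 0 <= scaled_density lam f z.
Proof.
move=> f0; rewrite /scaled_density; case: ifP => _; last exact: lexx.
by rewrite mulr_ge0 ?expR_ge0.
Qed.

Lemma lex_weight_ge0 {R : realType} {d k : nat} (f g : 'M[R]_(k, d) -> R) z :
  (forall x, 0 <= f x) -> (forall x, 0 <= g x) -> 0 <= lex_weight f g z.
Proof.
move=> f0 g0; rewrite /lex_weight; case: ifP => _; last exact: lexx.
by rewrite mulr_ge0.
Qed.

Lemma lexltZ {R : realType} {d : nat} (s : R) (x y : 'rV[R]_d) : 0 < s ->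
  lexlt (s *: x) (s *: y) = lexlt x y.
Proof.
move=> s0; apply/idP/idP => /lexltP[l h xy]; apply/lexltP; exists l => [j /h|].
- by rewrite !mxE => /(mulfI (lt0r_neq0 s0)).
- by move: xy; rewrite !mxE ltr_pM2l.
- by rewrite !mxE => ->.
- by rewrite !mxE ltr_pM2l.
Qed.

Lemma lexincZ {R : realType} {d k : nat} (s : R) (z : 'M[R]_(k, d)) : 0 < s ->
  lexinc (s *: z) = lexinc z.
Proof.
move=> s0; have h i : row i (s *: z) = s *: row i z by apply/rowP => j; rewrite !mxE.
apply: eq_forallb => i; apply: eq_forallb => j; by rewrite !h lexltZ.
Qed.

Section rescaled_law.
Context {R : realType} {e k : nat} {dO : measure_display} {Omega : measurableType dO}.
Local Notation d := e.+1.
Variables (P : probability Omega R) (lam : R) (H : Omega -> set 'rV[R]_d).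
Hypotheses (lam0 : 0 < lam) (HP : poisson_process P lam H).
Implicit Types (z : 'M[R]_(k, d)) (f : 'M[R]_(k, d) -> R).
Local Notation vol := (@lebesgue_mx R 1 d).
Local Notation B := (eball (0 : 'rV[R]_d) 1).

Let c : R := lam ^+ k * expR (- (lam * fine (vol B))).

Let c_gt0 : 0 < c. Proof. by rewrite mulr_gt0 ?exprn_gt0 ?expR_gt0. Qed.

Let scaled_cluster_density f z :
  cluster_density lam (fun y => f (lam *: y)) z = c * scaled_density lam f (lam *: z).
Proof.
rewrite /cluster_density /scaled_density lexincZ// scalerA mulVf ?lt0r_neq0// scale1r.
case: ifP => _; last by rewrite mulr0.
rewrite fine_vol_ball_union mulrDr opprD expRD /c.
move: (f _) (lam ^+ k) (expR _) (expR _) => a b p q; ring.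
Qed.

Let E : set Omega := [set w | (origin_cluster (H w) #= `I_k.+1)%card].

Let X w : 'M[R]_(k, d) := lam *: lex_points k (origin_cluster (H w) `\ 0).

Lemma integral_rescaled_cluster f (K : R) : continuous f -> (forall x, 0 <= f x <= K) ->
  [/\ measurable_fun setT (scaled_density lam f),
    (\int[lebesgue_mx k d]_z (scaled_density lam f z)%:E < +oo)%E &
    (\int[P]_w (cluster_fun H (fun y => f (lam *: y)) w)%:E =
     (c * lam ^- (k * d))%:E * \int[lebesgue_mx k d]_z (scaled_density lam f z)%:E)%E].
Proof.
move=> cf f0K.
have cf' : continuous (fun y : 'M[R]_(k, d) => f (lam *: y)).
  move=> y; apply: (@continuous_comp _ _ _ (fun y : 'M[R]_(k, d) => lam *: y)); last exact: cf.
  exact: scaler_continuous.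
have [m1 i1 e1] := cluster_law (ltn0Sn e) lam0 HP cf' (fun y => f0K (lam *: y)).
have m2 : measurable_fun setT (scaled_density lam f).
  have -> : scaled_density lam f = (fun z => c^-1 * cluster_density lam (fun y => f (lam *: y)) (lam^-1 *: z)).
    apply/funext => z; rewrite scaled_cluster_density scalerA mulfV ?lt0r_neq0// scale1r.
    by rewrite mulKf ?lt0r_neq0.
  have h := measurableT_comp m1 (measurable_scalemx lam^-1).
  by apply: measurable_funM; [exact: measurable_cst|exact: h].
have s0 z : 0 <= scaled_density lam f z.
  by apply: scaled_density_ge0 => x; have /andP[] := f0K x.
have e2 : (\int[lebesgue_mx k d]_y (cluster_density lam (fun y => f (lam *: y)) y)%:E =
  (c * lam ^- (k * d))%:E * \int[lebesgue_mx k d]_z (scaled_density lam f z)%:E)%E.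
  rewrite (eq_integral (fun z => (c * scaled_density lam f (lam *: z))%:E)); last first.
    by move=> z _; rewrite scaled_cluster_density.
  have h := measurableT_comp m2 (measurable_scalemx lam).
  rewrite (ge0_integralrZ _ h (fun z => s0 _) (ltW c_gt0)).
  have s0' z : (0 <= (EFin \o scaled_density lam f) z)%E by rewrite lee_fin.
  have m2' : measurable_fun setT (EFin \o scaled_density lam f).
    apply/measurable_EFinP; exact: m2.
  rewrite (EFinM c (lam ^- (k * d))) -muleA; congr (_ * _)%E.
  exact: (ge0_integral_scalemx lam0 m2' s0').
split => //; last by rewrite e1.
have cl : 0 < c * lam ^- (k * d) by rewrite mulr_gt0// invr_gt0 exprn_gt0.
rewrite -(@lte_pmul2l _ (c * lam ^- (k * d))%:E)//.
by rewrite -e2 gt0_muley ?lte_fin.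
Qed.

Let X' w : 'M[R]_(k, d) := lam *: @cluster_matrix R d k _ Omega H w.

Let mE : measurable E. Proof. exact: measurable_cluster_event HP. Qed.

Let mX : measurable_fun setT X'.
Proof. exact: (measurableT_comp (measurable_scalemx lam) (measurable_cluster_matrix HP)). Qed.

Let XX w : E w -> X w = X' w.
Proof. by move=> Ew; rewrite /X' /cluster_matrix asboolT. Qed.

Lemma integral_cond_cluster_max f :
  (\int[cond_distribution P E X]_x (f x)%:E =
   \int[cond_distribution P E X]_x (Num.max (f x) 0)%:E -
   \int[cond_distribution P E X]_x (Num.max (- f x) 0)%:E)%E.
Proof. exact: (integral_cond_distribution_max P mE mX XX). Qed.

Definition scaled_mass f : R := fine (\int[lebesgue_mx k d]_z (scaled_density lam f z)%:E).

Lemma integral_cond_cluster f (K : R) : continuous f -> (forall x, 0 <= f x <= K) ->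
  (\int[cond_distribution P E X]_x (f x)%:E = (scaled_mass f / scaled_mass (fun=> 1))%:E)%E.
Proof.
move=> cf f0K; have f0 x : 0 <= f x by have /andP[] := f0K x.
have c1 : continuous (fun _ : 'M[R]_(k, d) => 1 : R) by exact: cst_continuous.
have [_ i1 e1] := integral_rescaled_cluster (K := 1) c1 (fun _ => introT andP (conj ler01 (lexx 1))).
have [_ i2 e2] := integral_rescaled_cluster cf f0K.
have cl : 0 < c * lam ^- (k * d) by rewrite mulr_gt0// invr_gt0 exprn_gt0.
have fm : (\int[lebesgue_mx k d]_z (scaled_density lam f z)%:E \is a fin_num)%E.
  rewrite ge0_fin_numE//; apply: integral_ge0 => z _; rewrite lee_fin.
  exact: scaled_density_ge0.
have fm1 : (\int[lebesgue_mx k d]_z (scaled_density lam (fun=> 1 : R) z)%:E \is a fin_num)%E.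
  rewrite ge0_fin_numE//; apply: integral_ge0 => z _; rewrite lee_fin.
  by apply: scaled_density_ge0 => x; exact: ler01.
have PE : fine (P E) = c * lam ^- (k * d) * scaled_mass (fun=> 1).
  suff -> : P E = (\int[P]_w (cluster_fun H (fun _ : 'M[R]_(k, d) => 1%R : R) w)%:E)%E.
    by rewrite e1 fineM.
  rewrite -[in LHS](setIT E) -integral_indic//; apply: eq_integral => w _.
  rewrite indicE /cluster_fun; case: asboolP => h; first by rewrite mem_set.
  by rewrite memNset.
rewrite (ge0_integral_cond_distribution P mE mX XX)//; last first.
  exact: continuous_mx_measurable.
rewrite (_ : (\int[P]_w _)%E = (\int[P]_w (cluster_fun H (fun y => f (lam *: y)) w)%:E)%E); last first.
  apply: eq_integral => w _; rewrite /cluster_fun /X' /cluster_matrix.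
  by case: asboolP => // Ew; rewrite asboolT.
rewrite e2 -[(\int[_]_z (scaled_density lam f z)%:E)%E]fineK// -!EFinM PE; congr EFin.
rewrite -/(scaled_mass f) invfM [_^-1 * _]mulrC -mulrA mulKf ?lt0r_neq0// mulrC.
by [].
Qed.

End rescaled_law.

Section weak_limit.
Context {R : realType} {e k : nat}.
Local Notation d := e.+1.
Implicit Types (z : 'M[R]_(k, d)) (f : 'M[R]_(k, d) -> R).

Definition limit_mass f : R :=
  fine (\int[lebesgue_mx k d]_z (lex_weight f (fun z => expR (- gfun z)) z)%:E).

Lemma continuous_bounded_max f : continuous f -> bounded_fun f ->
  exists K, [/\ continuous (fun x => Num.max (f x) 0), continuous (fun x => Num.max (- f x) 0),
    forall x, 0 <= Num.max (f x) 0 <= K & forall x, 0 <= Num.max (- f x) 0 <= K].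
Proof.
move=> cf [M [_ hM]]; have fM x : `|f x| <= `|M| + 1.
  apply: hM => //; by rewrite ltr_pwDr// ler_norm.
have K0 : 0 <= `|M| + 1 by rewrite addr_ge0.
have c0 : continuous (fun _ : 'M[R]_(k, d) => 0 : R) by exact: cst_continuous.
exists (`|M| + 1); split.
- by move=> x; exact: (continuous_max (cf x) (c0 x)).
- move=> x; apply: (continuous_max _ (c0 x)).
  exact: (continuousN (cf x)).
- move=> x; rewrite le_max lexx orbT ge_max K0 andbT.
  exact: le_trans (ler_norm _) (fM x).
- move=> x; rewrite le_max lexx orbT ge_max K0 andbT.
  by apply: le_trans (ler_norm _) _; rewrite normrN.
Qed.

Section limit_law.
Context {dO' : measure_display} {Omega' : measurableType dO'}
  (P' : probability Omega' R) (U : {RV P' >-> 'M[R]_(k, d)}).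
Hypothesis U_density : forall A : set 'M[R]_(k, d), measurable A ->
  distribution P' U A = (\int[lebesgue_mx k d]_(z in A) (limit_density z)%:E)%E.

Let V w : 'M[R]_(k, d) := lex_points k (range (fun i => row i (U w))).

Let C : R := (k`!%:R * alpha d k)^-1.

Let C0 : 0 <= C.
Proof.
rewrite invr_ge0 mulr_ge0// mulr_ge0 ?invr_ge0//.
by apply: Rintegral_ge0 => z _; exact: expR_ge0.
Qed.

Let g z : R := expR (- gfun z).

Let g0 z : 0 <= g z. Proof. exact: expR_ge0. Qed.

Let mg : measurable_fun setT g.
Proof. by apply: measurableT_comp => //; apply: measurable_funN; exact: measurable_gfun. Qed.

Lemma integral_lex_points_density f : measurable_fun setT f -> (forall x, 0 <= f x) ->
  (\int[pushforward P' V]_x (f x)%:E =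
   (C * k`!%:R)%:E * \int[lebesgue_mx k d]_z (lex_weight f g z)%:E)%E.
Proof.
move=> mf f0.
have mfL : measurable_fun setT (fun z => f (lex_rows z)).
  exact: (measurableT_comp mf measurable_lex_rows).
rewrite (_ : (\int[pushforward P' V]_x (f x)%:E)%E =
    (\int[distribution P' U]_z (f (lex_rows z))%:E)%E); last first.
  have mf' : measurable_fun setT (fun x => (f x)%:E) by apply/measurable_EFinP; exact: mf.
  have := @ge0_integral_pushforward _ _ _ _ R _ measurable_lex_rows (distribution P' U) setT _
    measurableT mf' _; rewrite preimage_setT => <-//.
  by move=> x _; rewrite lee_fin.
have mh : measurable_fun setT (fun z => C * g z) by apply: measurable_funM => //; exact: mg.
rewrite (@ge0_integral_density _ _ _ (lebesgue_mx k d) _ (fun z => C * g z) _ mh)//; last first.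
  by move=> z; rewrite mulr_ge0.
rewrite (eq_integral (fun z => (C * (f (lex_rows z) * g z))%:E)); last first.
  by move=> z _; rewrite mulrCA.
rewrite ge0_integralrZ//; last 2 first.
- by apply: measurable_funM.
- by move=> z; rewrite mulr_ge0.
rewrite EFinM -muleA; congr (_ * _)%E.
have gs (s : 'S_k) y : g (row_perm s y) = g y by rewrite /g gfun_row_perm.
exact: (integral_lex_rows (ltn0Sn e) mf f0 mg g0 gs).
Qed.

Lemma integral_exp_gfun_lty : (\int[lebesgue_mx k d]_z (expR (- @gfun R d k z))%:E < +oo)%E.
Proof.
have h : (C%:E * \int[lebesgue_mx k d]_z (g z)%:E = 1)%E.
  rewrite -ge0_integralrZ// -(U_density measurableT) /distribution /pushforward preimage_setT.
  exact: probability_setT.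
have C1 : 0 < C.
  rewrite lt0r C0 andbT; apply/eqP => C_0; move: h; rewrite C_0 mul0e => /esym/eqP.
  by rewrite onee_eq0.
rewrite -(@lte_pmul2l _ C%:E)// -/g.
by rewrite h gt0_muley ?ltry ?lte_fin.
Qed.
Lemma integral_lex_points_limit f (K : R) : measurable_fun setT f -> (forall x, 0 <= f x <= K) ->
  limit_mass (fun=> 1) != 0 /\
  (\int[pushforward P' V]_x (f x)%:E = (limit_mass f / limit_mass (fun=> 1))%:E)%E.
Proof.
move=> mf f0K; have f0 x : 0 <= f x by have /andP[] := f0K x.
have ig := integral_exp_gfun_lty.
have le1 (h : 'M[R]_(k, d) -> R) (M : R) : measurable_fun setT h -> (forall x, 0 <= h x <= M) ->
    (\int[lebesgue_mx k d]_z (lex_weight h g z)%:E \is a fin_num)%E.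
  move=> mh hM; have h0 x : 0 <= h x by have /andP[] := hM x.
  rewrite ge0_fin_numE; last first.
    by apply: integral_ge0 => z _; rewrite lee_fin; exact: lex_weight_ge0.
  have M0 : 0 <= M by have /andP[a b] := hM 0; exact: le_trans b.
  apply: (@le_lt_trans _ _ (\int[lebesgue_mx k d]_z (M * g z)%:E)%E).
    apply: ge0_le_integralr.
    - exact: measurable_lex_weight.
    - by move=> z; exact: lex_weight_ge0.
    - by apply: measurable_funM; [exact: measurable_cst|exact: mg].
    - move=> z; rewrite /lex_weight; case: ifP => _; last by rewrite mulr_ge0.
      by apply: ler_wpM2r => //; have /andP[] := hM z.
  rewrite ge0_integralrZ//; apply: lte_mul_pinfty => //.
have f1 := le1 _ _ mf f0K.
have m1 : measurable_fun setT (fun _ : 'M[R]_(k, d) => 1 : R) by exact: measurable_cst.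
have f2 := le1 _ 1 m1 (fun _ => introT andP (conj ler01 (lexx 1))).
have E1 := integral_lex_points_density m1 (fun=> ler01).
have E2 := integral_lex_points_density mf f0.
have L1 : 1 = C * k`!%:R * limit_mass (fun=> 1).
  apply: EFin_inj; rewrite EFinM fineK//; rewrite -[RHS]E1.
  rewrite -[RHS]/(\int[pushforward_measure (distribution P' U) measurable_lex_rows]_x 1%E)%E.
  rewrite integral_cst// mul1e /= /pushforward !preimage_setT.
  by rewrite probability_setT.
have n0 : limit_mass (fun=> 1) != 0.
  by apply/eqP => h; move: L1; rewrite h mulr0 => /eqP; rewrite oner_eq0.
split => //; rewrite E2 -[(\int[_]_z _)%E]fineK// -EFinM -/(limit_mass f); congr EFin.
apply: (mulIf n0); rewrite divfK// mulrAC -L1 mul1r.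
by [].
Qed.

End limit_law.

Lemma cvg_scaled_mass f (K : R) :
  (\int[lebesgue_mx k d]_z (expR (- @gfun R d k z))%:E < +oo)%E -> (forall x, 0 <= f x <= K) ->
  (forall lam, 0 < lam -> measurable_fun setT (scaled_density lam f)) ->
  scaled_mass lam f @[lam --> +oo] --> limit_mass f.
Proof.
move=> ig f0K mf; apply/cvg_pinftyP => u uy.
have [h1 h2] := cvg_integral_scaled_density ig f0K mf uy.
apply: fine_cvg; rewrite fineK ?ge0_fin_numE//.
apply: integral_ge0 => z _; rewrite lee_fin.
by apply: lex_weight_ge0 => x; [have /andP[] := f0K x|exact: expR_ge0].
Qed.

End weak_limit.

Theorem theorem2p2 (R : realType) (d k : nat) (d_gt0 : (0 < d)%N)
    (k_gt0 : (0 < k)%N)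
    (dO : R -> measure_display)
    (Omega : forall lam : R, measurableType (dO lam))
    (P : forall lam : R, probability (Omega lam) R)
    (H : forall lam : R, Omega lam -> set 'rV[R]_d)
    (H_poisson : forall lam : R, 0 < lam ->
      poisson_process (P lam) lam (H lam))
    (dO' : measure_display) (Omega' : measurableType dO')
    (P' : probability Omega' R) (U : {RV P' >-> 'M[R]_(k, d)})
    (U_density : forall A : set 'M[R]_(k, d), measurable A ->
      distribution P' U A =
      (\int[lebesgue_mx k d]_(z in A) (limit_density z)%:E)%E) :
  weak_cvg (pinfty_nbhs R)
    (fun lam : R => cond_distribution (P lam)
      [set w | (origin_cluster (H lam w) #= `I_k.+1)%card]
      (fun w => lam *: lex_points k (origin_cluster (H lam w) `\ 0)))
    (pushforward P' (fun w => lex_points k (range (fun i => row i (U w))))).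
Proof.
destruct d as [|e]; first by [].
move=> f cf bf; have [K [c1 c2 b1 b2]] := continuous_bounded_max cf bf.
have ig := integral_exp_gfun_lty U_density.
pose mu lam := cond_distribution (P lam)
  [set w | (origin_cluster (H lam w) #= `I_k.+1)%card]
  (fun w => lam *: lex_points k (origin_cluster (H lam w) `\ 0)).
pose nu := pushforward P' (fun w => lex_points k (range (fun i => row i (U w)))).
pose one (_ : 'M[R]_(k, e.+1)) : R := 1.
have cvg_ge0 (h : 'M[R]_(k, e.+1) -> R) : continuous h -> (forall x, 0 <= h x <= K) ->
    (\int[mu lam]_x (h x)%:E @[lam --> +oo%R] --> \int[nu]_x (h x)%:E)%E /\
    (\int[nu]_x (h x)%:E \is a fin_num)%E.
  move=> ch hK.
  have [n0 nuE] := integral_lex_points_limit U_density (continuous_mx_measurable ch) hK.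
  rewrite -/nu in nuE; rewrite nuE; split => //.
  have K1 (x : 'M[R]_(k, e.+1)) : 0 <= (1 : R) <= 1 by rewrite ler01 lexx.
  have ch1 : continuous one by exact: cst_continuous.
  have mass_cvg (h' : 'M[R]_(k, e.+1) -> R) (K' : R) : continuous h' -> (forall x, 0 <= h' x <= K') ->
      scaled_mass lam h' @[lam --> +oo] --> limit_mass h'.
    move=> ch' hK'; apply: (cvg_scaled_mass ig hK') => lam lam0.
    by have [] := integral_rescaled_cluster lam0 (H_poisson _ lam0) ch' hK'.
  have h0 : scaled_mass lam h / scaled_mass lam one @[lam --> +oo] -->
      limit_mass h / limit_mass one.
    by apply: cvgM; [exact: mass_cvg ch hK|apply: cvgV => //; exact: mass_cvg ch1 K1].
  have h1 : (scaled_mass lam h / scaled_mass lam one)%:E @[lam --> +oo%R] -->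
      (limit_mass h / limit_mass one)%:E.
    by apply: (cvg_EFin _ h0); exact: nearW.
  have near_eq : \forall lam \near +oo%R, (scaled_mass lam h / scaled_mass lam one)%:E =
      (\int[mu lam]_x (h x)%:E)%E.
    have h2 : \forall lam \near +oo%R, (0 : R) < lam by exact: nbhs_pinfty_gt.
    apply: filterS h2 => lam lam0.
    by rewrite (integral_cond_cluster lam0 (H_poisson _ lam0) ch hK).
  exact: cvg_trans (near_eq_cvg near_eq) h1.
have [l1 n1] := cvg_ge0 _ c1 b1; have [l2 n2] := cvg_ge0 _ c2 b2.
have nuE : (\int[nu]_x (f x)%:E = \int[nu]_x (Num.max (f x) 0)%:E - \int[nu]_x (Num.max (- f x) 0)%:E)%E.
  exact: (integral_max (pushforward_measure (distribution P' U) measurable_lex_rows) f).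
have h : (\int[mu lam]_x (Num.max (f x) 0)%:E - \int[mu lam]_x (Num.max (- f x) 0)%:E
    @[lam --> +oo%R] --> \int[nu]_x (f x)%:E)%E.
  by rewrite nuE; apply: cvgeB => //; exact: fin_num_adde_defr.
have near_eq : \forall lam \near +oo%R,
    (\int[mu lam]_x (Num.max (f x) 0)%:E - \int[mu lam]_x (Num.max (- f x) 0)%:E)%E =
    (\int[mu lam]_x (f x)%:E)%E.
  have h2 : \forall lam \near +oo%R, (0 : R) < lam by exact: nbhs_pinfty_gt.
  apply: filterS h2 => lam lam0.
  exact: esym (integral_cond_cluster_max (H_poisson _ lam0) f).
exact: cvg_trans (near_eq_cvg near_eq) h.
Qed.
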